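(* Let $b\ge 2$ be an integer, let $0\le\alpha<1$, and assume that $1<p\le2\le q<\infty$ and $q>\frac1{1-\alpha}$. Then there exist two constants $c_1,c_2>0$ depending only on $b,\alpha,p,q$ such that the following holds. Let $W$ be a random weight, i.e. a non-constant random variable with $W\ge0$ and $\mathbb{E}[W]=1$, satisfying $\mathbb{E}[W\log W]<\log b$ and $\mathbb{E}[W^q]<\infty$, and let $\mu_\infty$ be the Mandelbrot canonical cascade measure on $[0,1]$ associated with $(W,b)$. Then $$c_1\cdot\frac{\|\mathring W\|_1}{\|W\|_2}\cdot\|\mathcal{R}\|_{\ell^{q/p}}^{1/p}\ \le\ \mathcal{N}^{(\alpha,p,q)}(\mu_\infty)\ \le\ c_2\cdot\|\mathring W\|_q\cdot\|\mathcal{R}\|_{\ell^1}^{1/p},$$ where both sides may be $+\infty$, $\mathring W=W-\mathbb{E}[W]$, and $\mathcal{R}=(\mathcal{R}_n)_{n\ge1}$ is the sequence $$\mathcal{R}_n=\mathbb{E}\big[\mathscr{M}_{n-1}(W^{(2)})^{p/2}\big]\cdot\Big(\frac{\mathbb{E}[W^2]}{b^{1-2\alpha-\frac2q}}\Big)^{\frac{np}2}.$$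
   Context: Convention: $0\log0=0$; $\|\cdot\|_r$ denotes the $L^r(\mathbb{P})$ norm. Cascade measure. Let $\mathcal{A}=\{0,1,\dots,b-1\}$ and $\mathcal{A}^*=\bigsqcup_{n\ge0}\mathcal{A}^n$ (finite words, $\mathcal{A}^0=\{\emptyset\}$); $|u|$ is the length of $u$, $u_k$ its $k$-th letter, $u|_j$ its prefix of length $j$. For $|u|=n$ let $I_u=[\sum_{k=1}^n u_kb^{-k},\ \sum_{k=1}^n u_kb^{-k}+b^{-n})$. Let $(W(u))_{u\in\mathcal{A}^*\setminus\{\emptyset\}}$ be i.i.d. copies of $W$ and $W(\emptyset)=1$. Define random measures on $[0,1]$ by $\mu_n(dt)=\sum_{|u|=n}\big(\prod_{j=0}^nW(u|_j)\big)\mathbf{1}_{I_u}(t)\,dt$. Almost surely $\mu_n$ converges weakly to a random measure $\mu_\infty$, the Mandelbrot canonical cascade measure. $\widehat{\mu}_\infty(\zeta)=\int e^{-2\pi i\zeta x}d\mu_\infty(x)$. $\mathscr{M}_0(W^{(2)})=1$ and $\mathscr{M}_n(W^{(2)})=b^{-n}\sum_{|u|=n}\prod_{j=1}^n\frac{W(u|_j)^2}{\mathbb{E}[W^2]}$ for $n\ge1$. $\mathcal{N}^{(\alpha,p,q)}(\mu_\infty)=\Big(\mathbb{E}\Big[\Big\{\sum_{n\ge1}|n^\alpha\,\widehat\mu_\infty(n)|^q\Big\}^{p/q}\Big]\Big)^{1/p}\in[0,+\infty]$. *)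

(* Defs.v *)
From HB Require Import structures.
From mathcomp Require Import all_boot all_order all_algebra.
From mathcomp Require Import complex.
From mathcomp Require Import all_classical all_reals all_analysis.
From mathcomp Require Import measurable_realfun numfun.

Set Implicit Arguments.
Unset Strict Implicit.
Unset Printing Implicit Defensive.

Import Order.TTheory GRing.Theory Num.Theory.
Import numFieldNormedType.Exports.

Local Open Scope classical_set_scope.
Local Open Scope ring_scope.

(* Mutual independence of the subfamily of X indexed by D: the product rule
   on every finite subfamily. *)
Definition mutually_independent {R : realType} {d : measure_display}
    {T : measurableType d} (P : probability T R) (I : choiceType) (D : set I)
    (X : I -> {RV P >-> R}) : Prop :=
  forall (s : seq I) (A : I -> set R),
    uniq s -> (forall i, i \in s -> D i) -> (forall i, measurable (A i)) ->
    P (\bigcap_(i in [set` s]) (X i @^-1` A i)) =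
    (\prod_(i <- s) P (X i @^-1` A i))%E.

(* For finite measures carried by [0, 1], bounded continuous test functions on
   R give the same notion as continuous functions on [0, 1]. *)
Definition weakly_converges {R : realType}
    (m : nat -> {measure set R -> \bar R}) (l : {measure set R -> \bar R}) :
    Prop :=
  forall f : R -> R, continuous f -> bounded_fun f ->
    (\int[m n]_x (f x)%:E)%E @[n --> \oo] --> (\int[l]_x (f x)%:E)%E.

(* Real and imaginary parts of the integral of exp (- 2 i pi zeta x) are
   integrated separately, as the library integrates real functions only. *)
Definition fourier {R : realType} (m : {measure set R -> \bar R}) (zeta : R) :
    R[i] :=
  Complex (\int[m]_x cos (- (2 * pi * zeta * x)))
          (\int[m]_x sin (- (2 * pi * zeta * x))).

(* l^r norm of a sequence indexed by n >= 1, with values in the extended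
   reals. *)
Definition ell_norm {R : realType} (r : R) (a : nat -> \bar R) : \bar R :=
  ((\sum_(1 <= n <oo) (`|a n| `^ r)) `^ r^-1)%E.

Definition centered {R : realType} {d : measure_display}
    {T : measurableType d} (P : probability T R) (W : T -> R) : T -> R :=
  fun x => W x - fine 'E_P[W]%E.

Definition random_weight {R : realType} {d : measure_display}
    {T : measurableType d} (P : probability T R) (W : {RV P >-> R}) : Prop :=
  [/\ {ae P, forall x, 0 <= W x},
      'E_P[W]%E = 1%E
    & ~ exists c : R, {ae P, forall x, W x = c}].

Section cascade.
Context {R : realType} (b : nat).

Implicit Types u : seq 'I_b.

Definition word_left u : R :=
  \sum_(k < size u) (nth 0%N (map (@nat_of_ord b) u) k)%:R * b%:R ^- k.+1.

Definition word_interval u : set R :=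
  `[word_left u, word_left u + b%:R ^- size u[%classic.

(* The copies may live on another probability space than W0; the root [::] is
   excluded from the i.i.d. family and carries the constant weight 1. *)
Definition iid_copies {d' : measure_display} {T' : measurableType d'}
    {P' : probability T' R} (W0 : {RV P' >-> R})
    {d : measure_display} {T : measurableType d} {P : probability T R}
    (W : seq 'I_b -> {RV P >-> R}) : Prop :=
  [/\ forall x, W [::] x = 1,
      forall u, u != [::] -> forall A : set R, measurable A ->
        distribution P (W u) A = distribution P' W0 A
    & mutually_independent [set u | u != [::]] W].

Context {d : measure_display} {T : measurableType d}.
Variable W : seq 'I_b -> T -> R.

Definition cascade_density (n : nat) (x : T) (t : R) : R :=
  \sum_(u : n.-tuple 'I_b)
    (\prod_(0 <= j < n.+1) W (take j u) x) * \1_(word_interval u) t.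

(* The weights are only almost surely nonnegative; taking the positive part
   of the density makes every realization a measure and changes nothing
   almost surely. *)
Definition cascade_measure (n : nat) (x : T) (A : set R) : \bar R :=
  (\int[lebesgue_measure]_(t in A) ((cascade_density n x)^\+ t)%:E)%E.

Lemma measurable_cascade_density n x :
  measurable_fun [set: R] (cascade_density n x).
Proof.
apply: measurable_sum => u; apply: measurable_funM => //.
by apply: measurable_indic; exact: measurable_itv.
Qed.

Section cascade_measure_is_measure.
Variables (n : nat) (x : T).

Let cascade_measure0 : cascade_measure n x set0 = 0%E.
Proof. by rewrite /cascade_measure integral_set0. Qed.

Let cascade_measure_ge0 A : (0 <= cascade_measure n x A)%E.
Proof. by apply: integral_ge0 => t _; rewrite lee_fin funrpos_ge0. Qed.

Let cascade_measure_sigma_additive : semi_sigma_additive (cascade_measure n x).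
Proof.
move=> /= F mF tF mUF; rewrite /cascade_measure; apply: cvg_toP.
  apply: ereal_nondecreasing_is_cvgn => k m km.
  apply: lee_sum_nneg_natr => // i _ _; apply: integral_ge0 => /= t _.
  by rewrite lee_fin funrpos_ge0.
rewrite ge0_integral_bigcup//=.
- apply/measurable_funTS/measurableT_comp => //.
  by apply: measurable_funrpos; exact: measurable_cascade_density.
- by move=> t _; rewrite lee_fin funrpos_ge0.
Qed.

HB.instance Definition _ := isMeasure.Build _ _ _ (cascade_measure n x)
  cascade_measure0 cascade_measure_ge0 cascade_measure_sigma_additive.

End cascade_measure_is_measure.

(* M_n (W^(2)); m2 stands for the second moment E[W^2]. *)
Definition square_martingale (m2 : R) (n : nat) (x : T) : R :=
  b%:R ^- n * \sum_(u : n.-tuple 'I_b)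
    \prod_(1 <= j < n.+1) (W (take j u) x ^+ 2 / m2).

(* A random measure on [0, 1] (a finite kernel into R, carried by [0, 1]) that
   is almost surely the weak limit of the cascade. *)
Definition cascade_limit (P : probability T R) (mu : R.-ftker T ~> R) : Prop :=
  (forall x, mu x (~` `[0, 1]%classic) = 0%E) /\
  {ae P, forall x, weakly_converges
                     (fun n => cascade_measure n x : {measure set R -> \bar R})
                     (mu x)}.

End cascade.

Definition fourier_norm {R : realType} {d : measure_display}
    {T : measurableType d} (P : probability T R) (alpha p q : R)
    (mu : R.-ftker T ~> R) : \bar R :=
  ((\int[P]_x
     (\sum_(1 <= n <oo)
        (Normc.normc ((n%:R `^ alpha)%R%:C%C * fourier (mu x) n%:R)%R `^ q)%:E)
     `^ (p / q)) `^ p^-1)%E.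

Definition cascade_seq {R : realType} (b : nat) {d : measure_display}
    {T : measurableType d} (P : probability T R) (W : seq 'I_b -> T -> R)
    (m2 alpha p q : R) (n : nat) : \bar R :=
  ('E_P[fun x => (square_martingale W m2 n.-1 x `^ (p / 2))%R] *
   ((m2 / b%:R `^ (1 - 2 * alpha - 2 / q)) `^ (n%:R * p / 2))%R%:E)%E.

(* Main.v *)
(* Write [W = 1 + X] with [X] centered. If [F' = f], the integral of [f] against
   the [n]-th cascade measure is [Y_n = sum_(|u| = n) Q(u) c(u)], where [Q(u)] is
   the product of the weights along [u] and [c(u)] the increment of [F] over
   [I_u]. Since [c] is additive, [Y_n] is a martingale, and its difference [D_n]
   is, given the first [n] levels, a sum of independent centered variables with
   coefficients [Q(u) c(u i)].

   Upper bound: for [p <= 2 <= q] the function [||.||_q ^ p] is bounded by its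
   first order expansion plus [C ||.||_q ^ p], so [E ||Y_(n+1)||^p] exceeds
   [E ||Y_n||^p] by at most [C E ||D_n||^p]. The Marcinkiewicz--Zygmund inequality
   given the first [n] levels, and the bound [min(b^-(n+1), 1/k)] on the
   coefficients at frequency [k], bound the latter by [R_(n+1)]; conclude by
   Fatou.

   Lower bound: subcriticality yields [r > 1] with [E W^r < b^(r-1)], whence
   [E |D_n|] decays geometrically and [Y_n] converges in mean. By Jensen,
   [E |mu^(k)|^p] then dominates [E |Y_(n+1)|^p], hence [E |D_n|^p] up to a
   constant, and Khinchin's inequality shows that the latter is at least of
   order [R_(n+1)] for the frequencies [b^n <= k <= 3/2 b^n]. Minkowski's
   inequality in [l^(q/p)] assembles the frequencies. *)
Require Import Defs.
From HB Require Import structures.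
From mathcomp Require Import all_boot all_order all_algebra.
From mathcomp Require Import complex.
From mathcomp Require Import all_classical all_reals all_analysis.
From mathcomp Require Import measurable_realfun numfun.
From mathcomp Require Import ring lra zify.

Set Implicit Arguments.
Unset Strict Implicit.
Unset Printing Implicit Defensive.

Import Order.TTheory GRing.Theory Num.Theory.
Import numFieldNormedType.Exports.

Local Open Scope classical_set_scope.
Local Open Scope ring_scope.

(** No conditional expectation is formed. Independence of the first [n] levels from the next one is
    turned into a product measure, and every statement given the first [n] levels is proved with
    those levels frozen as a parameter. The moment inequalities then share one mechanism: a
    pointwise expansion to first order whose linear term is centered, so that only the remainder
    survives integration. Real and imaginary parts of each frequency are separate real coordinates,
    which costs constants only; in the lower bound the two must be recombined, since either may
    vanish on an interval. The two bounds use the limit in opposite ways. From above, almost sure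
    convergence and Fatou suffice. From below, Fatou points the wrong way and the [p]-th moments of
    the martingale need not stay bounded; convergence is therefore obtained in mean, from a moment
    of some order [r] above 1. The division by the norm of [W] on the left compensates the factor
    [E[W^2]] to the power [p / 2] in the sequence; on the right this factor is harmless because
    [E[W^2] >= 1]. *)

Ltac nonneg := repeat first [assumption | exact: powR_ge0 | exact: sqr_ge0
  | exact: normr_ge0 | apply: ltW; assumption | exact: ler0n | apply: mulr_ge0 | apply: addr_ge0].

(** * Convexity inequalities for real powers *)

Section power_inequalities.
Context {R : realType}.
Implicit Types x y t r s : R.

(** Weighted arithmetic-geometric mean inequality, the common source of the tangent and Hölder
    inequalities below. The endpoints are treated apart because the conjugate exponents [t^-1] and
    [(1 - t)^-1] degenerate there. *)
Lemma young_powR t x y : 0 <= t <= 1 -> 0 <= x -> 0 <= y ->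
  x `^ t * y `^ (1 - t) <= t * x + (1 - t) * y.
Proof.
move=> /andP[t0 t1] x0 y0.
have [->|tn0] := eqVneq t 0; first by rewrite subr0 powRr0 powRr1//; lra.
have [->|tn1] := eqVneq t 1; first by rewrite subrr powRr0 powRr1//; lra.
have tp : 0 < t by rewrite lt_neqAle eq_sym tn0.
have tp1 : 0 < 1 - t by rewrite subr_gt0 lt_neqAle tn1.
have := @conjugate_powR R (x `^ t) (y `^ (1 - t)) t^-1 (1 - t)^-1.
rewrite !invrK -!powRrM !mulfV ?gt_eqF// !powRr1// [x * _]mulrC [y * _]mulrC.
by apply; rewrite ?powR_ge0 ?invr_gt0//; lra.
Qed.

(** Young's inequality with weight [r^-1] for the [r]-th powers of [x] and [y], multiplied by [r].
    This route covers [y = 0] without differentiation. *)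
Lemma powR_ge_tangent r x y : 1 <= r -> 0 <= x -> 0 <= y ->
  y `^ r + r * y `^ (r - 1) * (x - y) <= x `^ r.
Proof.
move=> r1 x0 y0; have rp : 0 < r by lra.
have rV : 0 <= r^-1 <= 1 by rewrite invr_ge0 (ltW rp) invf_le1.
have := young_powR rV (powR_ge0 x r) (powR_ge0 y r).
rewrite -!powRrM mulfV ?gt_eqF// powRr1// mulrBr mulr1 mulfV ?gt_eqF//.
rewrite -(ler_pM2l rp) !mulrDr !mulrA mulfV ?gt_eqF// !mul1r.
rewrite mulrBr mulfV ?gt_eqF// mulr1.
have -> : y `^ r = y * y `^ (r - 1) by rewrite mulr_powRB1.
lra.
Qed.

Lemma gt0_powRD x r s : 0 < x -> x `^ (r + s) = x `^ r * x `^ s.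
Proof. by move=> x0; rewrite powRD// (gt_eqF x0) implybT. Qed.

Lemma powR_le_tangent r x y : 0 <= r <= 1 -> 0 <= x -> 0 < y ->
  x `^ r <= y `^ r + r * y `^ (r - 1) * (x - y).
Proof.
move=> r01 x0 y0; have := young_powR r01 x0 (ltW y0).
have yp : 0 < y `^ (1 - r) by exact: powR_gt0.
rewrite -ler_pdivlMr// => /le_trans; apply.
have -> : (y `^ (1 - r))^-1 = y `^ (r - 1) by rewrite -powRN opprB.
have -> : y `^ r = y * y `^ (r - 1).
  by rewrite -[X in _ = X * _](powRr1 (ltW y0)) -gt0_powRD// addrC subrK.
by rewrite le_eqVlt; apply/orP; left; apply/eqP; ring.
Qed.

Lemma holder2 x1 y1 x2 y2 t : 0 <= t <= 1 -> 0 <= x1 -> 0 <= y1 -> 0 <= x2 -> 0 <= y2 ->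
  x1 `^ t * y1 `^ (1 - t) + x2 `^ t * y2 `^ (1 - t) <=
  (x1 + x2) `^ t * (y1 + y2) `^ (1 - t).
Proof.
move=> t01 x10 y10 x20 y20.
have [->|tn0] := eqVneq t 0; first by rewrite subr0 !powRr0 !mul1r !powRr1 ?addr_ge0.
have [->|tn1] := eqVneq t 1; first by rewrite subrr !powRr0 !mulr1 !powRr1 ?addr_ge0.
have t1n0 : 1 - t != 0 by rewrite subr_eq0 eq_sym.
have [A0|An0] := eqVneq (x1 + x2) 0.
  have [-> ->] : x1 = 0 /\ x2 = 0 by split; lra.
  by rewrite addr0 powR0// !mul0r addr0.
have [B0|Bn0] := eqVneq (y1 + y2) 0.
  have [-> ->] : y1 = 0 /\ y2 = 0 by split; lra.
  by rewrite addr0 powR0// !mulr0 addr0.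
set A := x1 + x2 in An0 *; set B := y1 + y2 in Bn0 *.
have A0 : 0 <= A by exact: addr_ge0.
have B0 : 0 <= B by exact: addr_ge0.
have AB : 0 <= A `^ t * B `^ (1 - t) by rewrite mulr_ge0 ?powR_ge0.
(* Young's inequality for the normalized quantities [u / A] and [v / B]; after summation over both
   pairs the weights add up to 1. *)
have H u v : 0 <= u -> 0 <= v -> u `^ t * v `^ (1 - t) <=
    A `^ t * B `^ (1 - t) * (t * (u / A) + (1 - t) * (v / B)).
  move=> u0 v0; have := young_powR t01 (divr_ge0 u0 A0) (divr_ge0 v0 B0).
  move=> /(ler_wpM2l AB); apply: le_trans.
  by rewrite mulrACA -!powRM ?divr_ge0// ![_ * (_ / _)]mulrC !divfK.
apply: (le_trans (lerD (H _ _ x10 y10) (H _ _ x20 y20))).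
rewrite -mulrDr; have -> : t * (x1 / A) + (1 - t) * (y1 / B) + (t * (x2 / A) + (1 - t) * (y2 / B)) = t * (A / A) + (1 - t) * (B / B) by rewrite /A /B; ring.
by rewrite !divff// !mulr1 (addrC t) subrK mulr1.
Qed.

Lemma holder_sum (I : Type) (s : seq I) (X Y : I -> R) t : 0 <= t <= 1 ->
  (forall i, 0 <= X i) -> (forall i, 0 <= Y i) ->
  \sum_(i <- s) X i `^ t * Y i `^ (1 - t) <=
  (\sum_(i <- s) X i) `^ t * (\sum_(i <- s) Y i) `^ (1 - t).
Proof.
move=> t01 X0 Y0; elim: s => [|i s IH].
  by rewrite !big_nil mulr_ge0 ?powR_ge0.
rewrite !big_cons; apply: le_trans (holder2 t01 _ _ _ _) => //; last 2 first.
- exact: sumr_ge0.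
- exact: sumr_ge0.
by rewrite lerD2l.
Qed.

(** Signed power; for the exponent [q - 1] it is the derivative of the [q]-th power of the absolute
    value, up to the factor [q]. *)
Definition spow r x : R := Num.sg x * `|x| `^ r.

Lemma spowN r x : spow r (- x) = - spow r x.
Proof. by rewrite /spow sgrN normrN mulNr. Qed.

Lemma spow_lipschitz r x y : 1 <= r ->
  `|spow r x - spow r y| <= r * Num.max `|x| `|y| `^ (r - 1) * `|x - y|.
Proof.
move=> r1.
have H (u v : R) : 0 <= v -> v <= u -> spow r u - spow r v <= r * u `^ (r - 1) * (u - v) /\ 0 <= spow r u - spow r v.
  move=> v0 vu; have u0 : 0 <= u by exact: le_trans vu.
  have sp w : 0 <= w -> spow r w = w `^ r.
    move=> w0; rewrite /spow ger0_norm//; have [->|wn0] := eqVneq w 0.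
      by rewrite sgr0 mul0r powR0//; lra.
    by rewrite gtr0_sg ?mul1r// lt_neqAle eq_sym wn0.
  rewrite !sp//; split; last by rewrite subr_ge0 ge0_ler_powR//; lra.
  have := powR_ge_tangent r1 v0 u0; lra.
(* Arguments of opposite signs: [v] stands for the modulus of the nonpositive one. *)
have G (u v : R) : 0 <= v -> 0 <= u -> spow r u + spow r v <= r * Num.max u v `^ (r - 1) * (u + v) /\ 0 <= spow r u + spow r v.
  move=> v0 u0.
  have E w : 0 <= w -> w <= Num.max u v -> 0 <= spow r w <= Num.max u v `^ (r - 1) * w.
    move=> w0 wm; rewrite /spow ger0_norm//; have [->|wn0] := eqVneq w 0.
      by rewrite sgr0 mul0r mulr0 lexx.
    have wp : 0 < w by rewrite lt_neqAle eq_sym wn0.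
    rewrite gtr0_sg// mul1r powR_ge0/= -(mulr_powRB1 w0); last lra.
    rewrite mulrC ler_wpM2r// ge0_ler_powR// ?nnegrE//; first lra.
    by rewrite le_max u0.
  have /andP[a1 a2] := E u u0 (ltac:(by rewrite le_max lexx)).
  have /andP[b1 b2] := E v v0 (ltac:(by rewrite le_max lexx orbT)).
  split; last by lra.
  have : 0 <= Num.max u v `^ (r - 1) * (u + v) by rewrite mulr_ge0 ?powR_ge0 ?addr_ge0.
  nra.
wlog xy : x y / `|y| <= `|x|.
  move=> W; have /orP[yx|xy] := le_total `|y| `|x|; first exact: W.
  by rewrite distrC [`|x - y|]distrC maxC; apply: W.
wlog x0 : x y xy / 0 <= x.
  move=> W; have [x0|/ltW x0] := leP 0 x; first by apply: W.
  have := W (- x) (- y); rewrite !normrN !spowN oppr_ge0 => /(_ xy x0).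
  by rewrite -!opprD !normrN.
rewrite (max_idPl xy) (ger0_norm x0).
rewrite (ger0_norm x0) in xy.
have [y0|/ltW y0] := leP 0 y.
  rewrite (ger0_norm y0) in xy.
  have [h1 h2] := H _ _ y0 xy.
  by rewrite !ger0_norm// subr_ge0.
rewrite ler0_norm// in xy.
have ny0 : 0 <= - y by rewrite oppr_ge0.
have [h1 h2] := G _ _ ny0 x0.
rewrite spowN (max_idPl xy) in h1 h2.
by rewrite ger0_norm// [`|x - y|]ger0_norm//; lra.
Qed.

Lemma ler_powRD_max x y r : 0 <= r -> 0 <= x -> 0 <= y ->
  (x + y) `^ r <= 2 `^ r * (x `^ r + y `^ r).
Proof.
move=> r0 x0 y0; apply: (@le_trans _ _ ((2 * Num.max x y) `^ r)).
  rewrite ge0_ler_powR ?nnegrE ?addr_ge0 ?mulr_ge0 ?le_max ?x0//.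
  by rewrite mulr_natl mulr2n lerD ?le_max ?lexx ?orbT.
rewrite powRM ?le_max ?x0// ler_wpM2l ?powR_ge0//.
have [_|_] := leP x y; first by rewrite lerDr powR_ge0.
by rewrite lerDl powR_ge0.
Qed.

Lemma spow_mul_le r x y : `|spow r x * y| <= `|x| `^ r * `|y|.
Proof.
rewrite /spow !normrM (ger0_norm (powR_ge0 _ _)) ler_wpM2r//.
rewrite ler_piMl ?powR_ge0// normr_sg; by case: (_ != _) => //=.
Qed.

(** The tangent is taken at [x + y] instead of [x], which bounds the increment from above, and its
    slope is then compared with the slope at [x] by the Lipschitz bound. No second derivative is
    needed. *)
Lemma powR_smooth q x y : 2 <= q ->
  `|x + y| `^ q <= `|x| `^ q + q * spow (q - 1) x * y
     + q * (q - 1) * 2 `^ (q - 2) * (`|x| `^ (q - 2) * y ^+ 2 + `|y| `^ q).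
Proof.
move=> q2; have q1 : 1 <= q by lra.
have T : `|x + y| `^ q <= `|x| `^ q + q * (spow (q - 1) (x + y) * y).
  have := powR_ge_tangent q1 (normr_ge0 x) (normr_ge0 (x + y)).
  suff : `|x + y| `^ (q - 1) * (`|x + y| - `|x|) <= spow (q - 1) (x + y) * y.
    rewrite -(ler_pM2l (ltac:(lra) : 0 < q)); lra.
  rewrite /spow mulrAC mulrC ler_wpM2r ?powR_ge0//.
  have -> : `|x + y| = Num.sg (x + y) * (x + y) by rewrite normrEsg.
  rewrite lerBlDr -lerBlDl -mulrBr addrK.
  apply: le_trans (ler_norm _) _; rewrite normrM ler_piMl// normr_sg.
  by case: (_ != _).
apply: (le_trans T); rewrite -addrA lerD2l.
have L := spow_lipschitz (x + y) x (ltac:(lra) : 1 <= q - 1).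
move: T L; move: (spow (q - 1) (x + y)) (spow (q - 1) x) => u v T L.
rewrite -[q * v * y]mulrA -lerBlDl -mulrBr -!mulrA ler_pM2l; last lra.
rewrite -mulrBl; apply: (le_trans (ler_norm _)).
rewrite normrM; apply: (le_trans (ler_wpM2r (normr_ge0 y) L)).
have -> : x + y - x = y by ring.
rewrite -!mulrA ler_pM2l; last lra.
have -> : q - 1 - 1 = q - 2 by ring.
have M : Num.max `|x + y| `|x| `^ (q - 2) <= 2 `^ (q - 2) * (`|x| `^ (q - 2) + `|y| `^ (q - 2)).
  have q20 : 0 <= q - 2 by lra.
  apply: le_trans (ler_powRD_max q20 (normr_ge0 x) (normr_ge0 y)).
  rewrite (ge0_ler_powR q20) ?nnegrE ?le_max ?normr_ge0// ?addr_ge0//.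
  by rewrite ge_max ler_normD lerDl normr_ge0.
apply: (le_trans (ler_wpM2r (mulr_ge0 (normr_ge0 y) (normr_ge0 y)) M)).
rewrite -mulrA ler_wpM2l ?powR_ge0// mulrDl -expr2 real_normK ?num_real// lerD2l.
have [->|y0] := eqVneq y 0; first by rewrite expr0n/= mulr0 powR_ge0.
have yp : 0 < `|y| by rewrite normr_gt0.
rewrite -(real_normK (num_real y)) -powR_mulrn// -gt0_powRD// subrK//.
Qed.

End power_inequalities.

(** * Smoothness of the [p]-th power of the l^q norm *)

Section lq_smooth.
Context {R : realType}.
Variables (p q : R) (I : Type) (s : seq I).
Implicit Types x y : I -> R.

Definition lq_pow (x : I -> R) := \sum_(i <- s) `|x i| `^ q.

Lemma lq_pow_ge0 x : 0 <= lq_pow x.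
Proof. by apply: sumr_ge0 => i _; exact: powR_ge0. Qed.

(* coordinates of the gradient of [x |-> lq_pow x `^ (p / q)] *)
Definition lq_grad (x : I -> R) i :=
  p * lq_pow x `^ (p / q - 1) * spow (q - 1) (x i).

(** The first summand serves the case where [y] is smaller than [x], with a factor 2 for the two
    error terms of [powR_smooth]. The other two serve the opposite case and bound the left-hand side
    and the linear term separately. *)
Definition lq_cst : R := (p / q) * (q * (q - 1) * 2 `^ (q - 2)) * 2 + 2 `^ (1 + p) + p.

Lemma lq_cst_ge0 : 1 <= p -> 2 <= q -> 0 <= lq_cst.
Proof.
move=> p1 q2; rewrite /lq_cst !addr_ge0 ?powR_ge0//; last lra.
by rewrite !mulr_ge0 ?invr_ge0 ?powR_ge0//; lra.
Qed.

Lemma sum_powR_mul_le x y : 2 <= q ->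
  \sum_(i <- s) `|x i| `^ (q - 1) * `|y i| <=
  lq_pow x `^ ((q - 1) / q) * lq_pow y `^ q^-1.
Proof.
move=> q2; have q0 : 0 < q by lra.
have := @holder_sum R I s (fun i => `|x i| `^ q) (fun i => `|y i| `^ q) ((q - 1) / q).
have -> : 1 - (q - 1) / q = q^-1 by field; rewrite gt_eqF.
rewrite divr_ge0 ?ler_pdivrMr//; [|lra|lra].
rewrite mul1r (_ : q - 1 <= q); last lra.
move=> /(_ isT (fun=> powR_ge0 _ _) (fun=> powR_ge0 _ _)); apply: le_trans.
apply: ler_sum => i _; rewrite -!powRrM mulfV ?gt_eqF// powRr1//.
by rewrite mulrCA mulfV ?gt_eqF// mulr1.
Qed.

Lemma sum_powR_sqr_le x y : 2 <= q ->
  \sum_(i <- s) `|x i| `^ (q - 2) * y i ^+ 2 <=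
  lq_pow x `^ (1 - 2 / q) * lq_pow y `^ (2 / q).
Proof.
move=> q2; have q0 : 0 < q by lra.
have := @holder_sum R I s (fun i => `|x i| `^ q) (fun i => `|y i| `^ q) (1 - 2 / q).
have t01 : 0 <= 1 - 2 / q <= 1.
  by rewrite subr_ge0 ler_pdivrMr// mul1r q2/= gerBl divr_ge0// ltW.
rewrite subKr => /(_ t01 (fun=> powR_ge0 _ _) (fun=> powR_ge0 _ _)); apply: le_trans.
apply: ler_sum => i _; rewrite -!powRrM.
have -> : q * (1 - 2 / q) = q - 2 by field; rewrite gt_eqF.
have -> : q * (2 / q) = 2 by field; rewrite gt_eqF.
by rewrite powR_mulrn// real_normK ?num_real.
Qed.

Lemma lq_pow_smooth x y : 1 <= p -> p <= 2 -> 2 <= q ->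
  lq_pow (fun i => x i + y i) `^ (p / q) <= lq_pow x `^ (p / q)
    + \sum_(i <- s) lq_grad x i * y i + lq_cst * lq_pow y `^ (p / q).
Proof.
move=> p1 p2 q2; have q0 : 0 < q by lra.
have pq0 : 0 <= p / q by rewrite divr_ge0//; lra.
have pq1 : p / q <= 1 by rewrite ler_pdivrMr// mul1r; lra.
set A := lq_pow x; set B := lq_pow y.
have A0 : 0 <= A by exact: lq_pow_ge0.
have B0 : 0 <= B by exact: lq_pow_ge0.
set G := \sum_(i <- s) lq_grad x i * y i.
have GE : G = p * A `^ (p / q - 1) * \sum_(i <- s) spow (q - 1) (x i) * y i.
  by rewrite /G mulr_sumr; apply: eq_bigr => i _; rewrite /lq_grad mulrA.
set C1 := q * (q - 1) * 2 `^ (q - 2).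
have C10 : 0 <= C1 by rewrite !mulr_ge0 ?powR_ge0//; lra.
have S1 : lq_pow (fun i => x i + y i) <= A + q * \sum_(i <- s) spow (q - 1) (x i) * y i
    + C1 * (A `^ (1 - 2 / q) * B `^ (2 / q) + B).
  apply: (@le_trans _ _ (A + q * \sum_(i <- s) spow (q - 1) (x i) * y i
    + C1 * ((\sum_(i <- s) `|x i| `^ (q - 2) * y i ^+ 2) + B))); last first.
    by rewrite lerD2l ler_wpM2l// lerD2r sum_powR_sqr_le.
  rewrite /lq_pow /A /B !mulr_sumr -!big_split/= mulr_sumr -big_split/=.
  by apply: ler_sum => i _; rewrite mulrA; exact: powR_smooth.
have L : lq_pow (fun i => x i + y i) <= 2 `^ q * (A + B).
  rewrite /A /B /lq_pow -big_split/= mulr_sumr; apply: ler_sum => i _.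
  apply: le_trans (ler_powRD_max (ltW q0) (normr_ge0 _) (normr_ge0 _)).
  by rewrite (ge0_ler_powR (ltW q0)) ?nnegrE ?normr_ge0 ?addr_ge0// ler_normD.
have L3 : `|\sum_(i <- s) spow (q - 1) (x i) * y i| <= A `^ ((q - 1) / q) * B `^ q^-1.
  apply: le_trans (sum_powR_mul_le _ _ q2); apply: (le_trans (ler_norm_sum _ _ _)).
  by apply: ler_sum => i _; exact: spow_mul_le.
have N0 := lq_pow_ge0 (fun i => x i + y i).
have CE : lq_cst = p / q * C1 * 2 + 2 `^ (1 + p) + p by [].
move: A0 B0 GE C10 S1 L L3 N0 CE.
move: A B G C1 (\sum_(i <- s) spow _ _ * _) (lq_pow _) lq_cst => A B G C1 S N C A0 B0 GE C10 S1 L L3 N0 CE.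
rewrite {G}GE.
have [AB|BA] := leP A B; last first.
- have Ap : 0 < A by exact: le_lt_trans BA.
  have pq01 : 0 <= p / q <= 1 by rewrite pq0.
  apply: (le_trans (powR_le_tangent pq01 N0 Ap)).
  rewrite -addrA lerD2l.
  have c0 : 0 <= (p / q) * A `^ (p / q - 1) by rewrite mulr_ge0 ?powR_ge0.
  have {}S1 : N - A <= q * S + C1 * (A `^ (1 - 2 / q) * B `^ (2 / q) + B) by lra.
  apply: (le_trans (ler_wpM2l c0 S1)).
  rewrite mulrDr; apply: lerD.
    rewrite le_eqVlt; apply/orP; left; apply/eqP; field; by rewrite gt_eqF.
  (* The total exponent of [A] is [- ((2 - p) / q)], nonpositive because [p <= 2], so [A] may be
     replaced by the smaller [B]. *)
  have E1 : A `^ (p / q - 1) * (A `^ (1 - 2 / q) * B `^ (2 / q)) <= B `^ (p / q).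
    have [->|Bn0] := eqVneq B 0.
      by rewrite [_ `^ (2 / q)]powR0 ?mulr0 ?powR_ge0// mulf_neq0 ?invr_eq0 ?gt_eqF.
    have Bp : 0 < B by rewrite lt_neqAle eq_sym Bn0.
    rewrite mulrA -gt0_powRD//.
    have -> : p / q - 1 + (1 - 2 / q) = - ((2 - p) / q) by field; rewrite gt_eqF.
    rewrite powRN -ler_pdivlMl ?invr_gt0 ?powR_gt0// invrK.
    have -> : B `^ (2 / q) = B `^ ((2 - p) / q) * B `^ (p / q).
      by rewrite -gt0_powRD//; congr powR; field; rewrite gt_eqF.
    have r0 : 0 <= (2 - p) / q by rewrite divr_ge0//; lra.
    by rewrite ler_wpM2r ?powR_ge0// ge0_ler_powR ?nnegrE ?(ltW BA) ?(ltW Ap).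
  have E2 : A `^ (p / q - 1) * B <= B `^ (p / q).
    have [->|Bn0] := eqVneq B 0; first by rewrite mulr0 powR_ge0.
    have Bp : 0 < B by rewrite lt_neqAle eq_sym Bn0.
    rewrite -(opprB 1) powRN -ler_pdivlMl ?invr_gt0 ?powR_gt0// invrK.
    have {1}-> : B = B `^ (1 - p / q) * B `^ (p / q).
      by rewrite -gt0_powRD// subrK powRr1.
    rewrite ler_wpM2r ?powR_ge0// ge0_ler_powR ?nnegrE//; lra.
  have -> : p / q * A `^ (p / q - 1) * (C1 * (A `^ (1 - 2 / q) * B `^ (2 / q) + B)) =
     (p / q) * C1 * (A `^ (p / q - 1) * (A `^ (1 - 2 / q) * B `^ (2 / q)) + A `^ (p / q - 1) * B) by ring.
  apply: (@le_trans _ _ ((p / q) * C1 * 2 * B `^ (p / q))).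
    have c1 : 0 <= p / q * C1 by exact: mulr_ge0.
    have := ler_wpM2l c1 (lerD E1 E2); lra.
  rewrite ler_wpM2r ?powR_ge0// CE -addrA lerDl addr_ge0 ?powR_ge0//; lra.
- have L2 : N `^ (p / q) <= 2 `^ (1 + p) * B `^ (p / q).
    have {}L : N <= 2 `^ (q + 1) * B.
      apply: (le_trans L); rewrite gt0_powRD// powRr1// -mulrA ler_wpM2l ?powR_ge0//; lra.
    apply: (@le_trans _ _ ((2 `^ (q + 1) * B) `^ (p / q))).
      have h0 : 0 <= 2 `^ (q + 1) * B by rewrite mulr_ge0 ?powR_ge0.
      by rewrite (ge0_ler_powR pq0) ?nnegrE.
    rewrite powRM ?powR_ge0// ler_wpM2r ?powR_ge0// -powRrM ler_powR//; first lra.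
    rewrite mulrDl mulrCA mulfV ?gt_eqF// mulr1 mul1r; lra.
  have {}L3 : - (p * A `^ (p / q - 1) * S) <= p * B `^ (p / q).
    apply: (le_trans (ler_norm _)); rewrite normrN normrM.
    rewrite ger0_norm ?mulr_ge0 ?powR_ge0//; last lra.
    rewrite -mulrA ler_pM2l; last lra.
    apply: (le_trans (ler_wpM2l (powR_ge0 _ _) L3)).
    have [->|An0] := eqVneq A 0.
      rewrite [_ `^ ((q - 1) / q)]powR0 ?mul0r ?mulr0 ?powR_ge0// mulf_neq0 ?invr_eq0 ?gt_eqF//; lra.
    have Ap : 0 < A by rewrite lt_neqAle eq_sym An0.
    have Bp : 0 < B by exact: lt_le_trans AB.
    rewrite mulrA -gt0_powRD//.
    have -> : p / q - 1 + (q - 1) / q = (p - 1) / q by field; rewrite gt_eqF.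
    have -> : B `^ (p / q) = B `^ ((p - 1) / q) * B `^ q^-1.
      by rewrite -gt0_powRD//; congr powR; field; rewrite gt_eqF.
    have r0 : 0 <= (p - 1) / q by rewrite divr_ge0//; lra.
    by rewrite ler_wpM2r ?powR_ge0// ge0_ler_powR.
  have : 0 <= (p / q) * C1 * 2 * B `^ (p / q) by rewrite !(mulr_ge0 _ (powR_ge0 _ _), mulr_ge0 _ (ler0n _ _), mulr_ge0 pq0).
  have : 0 <= A `^ (p / q) by exact: powR_ge0.
  rewrite CE !mulrDl; lra.
Qed.

End lq_smooth.

(** * Truncated powers *)

Section truncated_power.
Context {R : realType}.
Implicit Types M p x z : R.

(* [`|x| `^ p] up to level [M], continued by its tangent: a convex function
   of linear growth that increases to the power function with [M]. *)
Definition tpow M p x : R :=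
  Num.min `|x| M `^ p + p * Num.min `|x| M `^ (p - 1) * (`|x| - Num.min `|x| M).

Definition tpow_slope M p x : R := p * Num.min `|x| M `^ (p - 1) * Num.sg x.

Let min0 M x : 0 <= M -> 0 <= Num.min `|x| M.
Proof. by move=> M0; rewrite le_min normr_ge0. Qed.

Lemma tpow_ge0 M p x : 0 <= M -> 0 <= p -> 0 <= tpow M p x.
Proof.
move=> M0 p0; rewrite addr_ge0 ?mulr_ge0 ?powR_ge0// subr_ge0.
by rewrite ge_min lexx.
Qed.

(** The truncated power dominates every tangent of the power function at a point of [[0, M]], and at
    each argument it is the value of one of them. Convexity and monotonicity in [M] both follow. *)
Let tpow_ge_line M p z s : 1 <= p -> 0 <= s -> s <= M ->
  s `^ p + p * s `^ (p - 1) * (`|z| - s) <= tpow M p z.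
Proof.
move=> p1 s0 sM; have M0 : 0 <= M by exact: le_trans sM.
rewrite /tpow; have [zM|Mz] := leP `|z| M.
  by rewrite subrr mulr0 addr0 powR_ge_tangent.
have T := powR_ge_tangent p1 M0 s0.
have : s `^ (p - 1) <= M `^ (p - 1) by rewrite ge0_ler_powR ?nnegrE//; lra.
have : 0 <= `|z| - M by lra.
move: T; move: (s `^ p) (M `^ p) (s `^ (p - 1)) (M `^ (p - 1)) => a b c d.
move=> T h1 h2; have : p * c * (`|z| - M) <= p * d * (`|z| - M).
  by rewrite ler_wpM2r// ler_wpM2l//; lra.
lra.
Qed.

Lemma tpow_ge_tangent M p x z : 1 <= p -> 0 <= M ->
  tpow M p x + tpow_slope M p x * (z - x) <= tpow M p z.
Proof.
move=> p1 M0; have m0 := min0 x M0.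
apply: le_trans (@tpow_ge_line M p z (Num.min `|x| M) p1 m0 _); last first.
  by rewrite ge_min lexx orbT.
rewrite /tpow -addrA lerD2l /tpow_slope.
have c0 : 0 <= p * Num.min `|x| M `^ (p - 1) by rewrite mulr_ge0 ?powR_ge0//; lra.
have : Num.sg x * (z - x) <= `|z| - `|x|.
  rewrite mulrBr -normrEsg lerD2r; apply: (le_trans (ler_norm _)).
  by rewrite normrM ler_piMl// normr_sg; case: (_ != _).
move=> /(ler_wpM2l c0); rewrite -mulrA; lra.
Qed.

Lemma tpow_le_powR M p x : 1 <= p -> 0 <= M -> tpow M p x <= `|x| `^ p.
Proof. by move=> p1 M0; exact: powR_ge_tangent (min0 _ _). Qed.

Lemma tpow_id M p x : `|x| <= M -> tpow M p x = `|x| `^ p.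
Proof. by move=> xM; rewrite /tpow (min_idPl xM) subrr mulr0 addr0. Qed.

Lemma tpow_slope_le M p x : 1 <= p -> 0 <= M ->
  `|tpow_slope M p x| <= p * M `^ (p - 1).
Proof.
move=> p1 M0; rewrite /tpow_slope normrM normrM ger0_norm; last lra.
rewrite (ger0_norm (powR_ge0 _ _)).
apply: (@le_trans _ _ (p * Num.min `|x| M `^ (p - 1))).
  rewrite ler_piMr ?mulr_ge0 ?powR_ge0//; first lra.
  by rewrite normr_sg; case: (_ != _).
rewrite ler_wpM2l; [|lra|]; first by [].
rewrite ge0_ler_powR ?nnegrE ?min0//; [lra|by rewrite ge_min lexx orbT].
Qed.

Lemma tpow_lipschitz M p x z : 1 <= p -> 0 <= M ->
  `|tpow M p x - tpow M p z| <= p * M `^ (p - 1) * `|x - z|.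
Proof.
move=> p1 M0.
have H u v : tpow M p u - tpow M p v <= p * M `^ (p - 1) * `|u - v|.
  have := tpow_ge_tangent u v p1 M0.
  have := ler_wpM2r (normr_ge0 (u - v)) (tpow_slope_le u p1 M0).
  rewrite -normrM => h; have := ler_norm (tpow_slope M p u * (u - v)).
  move: h => /[swap] /le_trans h /h; lra.
rewrite ler_norml H andbT; have := H z x; rewrite distrC; lra.
Qed.

Lemma tpow_mono M M' p x : 1 <= p -> 0 <= M -> M <= M' ->
  tpow M p x <= tpow M' p x.
Proof.
move=> p1 M0 MM'; apply: tpow_ge_line => //; first exact: min0.
by rewrite ge_min MM' orbT.
Qed.

Lemma continuous_tpow M p : 1 <= p -> 0 <= M -> continuous (tpow M p).
Proof.
move=> p1 M0 x; apply/cvgrPdist_le => e e0.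
have k0 : 0 < p * M `^ (p - 1) + 1.
  by rewrite ltr_wpDl// mulr_ge0 ?powR_ge0//; lra.
near=> z; apply: (le_trans (tpow_lipschitz _ _ p1 M0)).
apply: (@le_trans _ _ ((p * M `^ (p - 1) + 1) * `|x - z|)).
  by rewrite ler_wpM2r// lerDl.
rewrite mulrC -ler_pdivlMr//; near: z.
apply: (@cvgr_dist_le _ _ _ (nbhs x) _ id x) => //.
exact: divr_gt0.
Unshelve. all: by end_near.
Qed.

End truncated_power.

(** * A quartic minorant, power tails and geometric sums *)

Section misc_inequalities.
Context {R : realType}.

(* The quartic is tangent to the absolute value at [s = 3/2 * sg]. *)
Lemma norm_ge_quartic (s sg : R) : 0 < sg ->
  s ^+ 2 / sg - 4%:R / 27%:R * (s ^+ 4 / sg ^+ 3) <= `|s|.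
Proof.
move=> s0; set x := `|s| / sg.
have x0 : 0 <= x by rewrite divr_ge0// ltW.
have -> : s ^+ 2 / sg - 4%:R / 27%:R * (s ^+ 4 / sg ^+ 3)
   = sg * (x ^+ 2 - 4%:R / 27%:R * x ^+ 4).
  have -> : s ^+ 4 = `|s| ^+ 4 by rewrite -[RHS]normrX ger0_norm// (_ : 4%N = (2 * 2)%N)// exprM sqr_ge0.
  rewrite -real_normK ?num_real// /x; field; by rewrite gt_eqF.
have -> : `|s| = sg * x by rewrite /x mulrCA divff ?mulr1// gt_eqF.
rewrite ler_pM2l//; move: x x0 => {s0} x x0.
have : 0 <= x * (2 * x - 3%:R) ^+ 2 * (x + 3%:R).
  by apply: mulr_ge0; [apply: mulr_ge0 => //; exact: sqr_ge0|exact: addr_ge0].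
have -> : x * (2 * x - 3%:R) ^+ 2 * (x + 3%:R) = 27%:R * x + 4%:R * x ^+ 4 - 27%:R * x ^+ 2 by ring.
lra.
Qed.

(** Comparison with an integral that telescopes, obtained without integration: Young's inequality is
    applied to [z = k / (k + 1)] and its power [- g], with the weights for which the product of
    powers equals 1. *)
Lemma natpow_tail (beta : R) k : 1 < beta -> (0 < k)%N ->
  k.+1%:R `^ (- beta) <= (beta - 1)^-1 *
    (k%:R `^ (1 - beta) - k.+1%:R `^ (1 - beta)).
Proof.
move=> b1 k0; set g := beta - 1; have g0 : 0 < g by rewrite subr_gt0.
have -> : 1 - beta = - g by rewrite /g opprB.
have kp : (0 : R) < k%:R by rewrite ltr0n.
have kp1 : (0 : R) < k.+1%:R by rewrite ltr0n.
set z : R := k%:R / k.+1%:R; have zp : 0 < z by exact: divr_gt0.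
have t01 : 0 <= g / (1 + g) <= 1.
  rewrite divr_ge0 ?ler_pdivrMr ?mul1r; lra.
have := young_powR t01 (ltW zp) (powR_ge0 z (- g)).
have -> : 1 - g / (1 + g) = (1 + g)^-1 by field; lra.
rewrite -powRrM -gt0_powRD//.
have -> : g / (1 + g) + - g / (1 + g) = 0 by field; lra.
rewrite powRr0 -(ler_pM2l (ltac:(lra) : 0 < 1 + g)) mulr1 mulrDr.
have -> : (1 + g) * (g / (1 + g) * z) = g * z by field; lra.
have -> : (1 + g) * ((1 + g)^-1 * z `^ (- g)) = z `^ (- g) by field; lra.
have -> : k%:R `^ (- g) = z `^ (- g) * k.+1%:R `^ (- g).
  by rewrite -powRM ?(ltW zp)// /z divfK// gt_eqF.
have -> : - beta = - 1 + - g by rewrite /g; ring.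
rewrite gt0_powRD// powR_inv1//.
have gz : g * z = g - g * k.+1%:R^-1.
  rewrite /z -(natr1 k); field; by rewrite natr1 gt_eqF.
move: (z `^ (- g)) => zg; rewrite gz => h; have {}h : g * k.+1%:R^-1 <= zg - 1.
  rewrite -subr_ge0.
  have -> : zg - 1 - g / k.+1%:R = g - g / k.+1%:R + zg - (1 + g) by ring.
  by rewrite subr_ge0.
rewrite ler_pdivlMl// mulrA -[X in _ - X]mul1r -mulrBl ler_wpM2r ?powR_ge0//.
Qed.

Lemma sum_natpow_tail (beta : R) m n : 1 < beta -> (0 < m)%N ->
  \sum_(m <= k < n) k.+1%:R `^ (- beta) <= (beta - 1)^-1 * m%:R `^ (1 - beta).
Proof.
move=> b1 m0; have b0 : 0 < beta - 1 by rewrite subr_gt0.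
have [nm|mn] := leqP n m.
  by rewrite big_geq// mulr_ge0 ?powR_ge0// invr_ge0 ltW.
apply: (@le_trans _ _ ((beta - 1)^-1 *
  \sum_(m <= k < n) (k%:R `^ (1 - beta) - k.+1%:R `^ (1 - beta)))).
  rewrite mulr_sumr big_nat [leRHS]big_nat; apply: ler_sum => k /andP[mk _].
  by apply: natpow_tail => //; exact: leq_trans mk.
rewrite ler_pM2l ?invr_gt0//.
have -> : \sum_(m <= k < n) (k%:R `^ (1 - beta) - k.+1%:R `^ (1 - beta)) =
   - \sum_(m <= k < n) ((k.+1%:R : R) `^ (1 - beta) - k%:R `^ (1 - beta)).
  by rewrite -sumrN; apply: eq_bigr => k _; rewrite opprB.
by rewrite telescope_sumr 1?ltnW// opprB gerBl powR_ge0.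
Qed.

Lemma powR_exprn (x s : R) n : 0 <= x -> (x ^+ n) `^ s = (x `^ s) ^+ n.
Proof. move=> x0; elim: n => [|n IH]; first by rewrite !expr0 powR1.
by rewrite !exprS powRM ?exprn_ge0// IH. Qed.

Lemma sum_exprn_le (rho : R) n : 0 <= rho -> rho < 1 ->
  \sum_(0 <= i < n) rho ^+ i <= (1 - rho)^-1.
Proof.
move=> h0 h1; have h : 0 < 1 - rho by rewrite subr_gt0.
rewrite big_mkord -(ler_pM2l h) divff ?gt_eqF//.
have := subrX1 rho n; have := exprn_ge0 n h0; lra.
Qed.

End misc_inequalities.

(** * Independent sigma-algebras and decoupling *)

Section decoupling.
Context {R : realType} {d : measure_display} {T : measurableType d}.
Context {P : probability T R} {I : choiceType}.
Variables (D : set I) (X : I -> {RV P >-> R}).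
Hypothesis indX : mutually_independent D X.

Definition cylinders (E : set I) : set (set T) :=
  [set B | exists (s : seq I) (A : I -> set R),
    [/\ uniq s, forall i, i \in s -> E i, forall i, measurable (A i) &
        B = \bigcap_(i in [set` s]) (X i @^-1` A i)]].

Lemma measurable_cylinders E : cylinders E `<=` measurable.
Proof.
move=> _ [s [A [_ _ mA ->]]]; apply: fin_bigcap_measurable => //.
by move=> i _; rewrite -[X in measurable X]setTI; exact: measurable_funP.
Qed.

Lemma cylindersT E : cylinders E setT.
Proof.
exists [::], (fun=> setT); split => //.
by apply/esym/seteqP; split => // x _ i /=.
Qed.

Lemma cylinders_setI E : setI_closed (cylinders E).
Proof.
move=> _ _ [s1 [A1 [u1 E1 m1 ->]]] [s2 [A2 [u2 E2 m2 ->]]].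
exists (undup (s1 ++ s2)),
  (fun i => (if i \in s1 then A1 i else setT) `&` (if i \in s2 then A2 i else setT)).
split; first exact: undup_uniq.
- by move=> i; rewrite mem_undup mem_cat => /orP[/E1|/E2].
- by move=> i; apply: measurableI; case: ifP => _ //; exact: measurableT.
- apply/seteqP; split => x /=.
    move=> [h1 h2] i /= _; split; case: ifP => // is_; [exact: h1|exact: h2].
  move=> h; split => i /= is_.
    have := h i; rewrite /= mem_undup mem_cat is_ => /(_ isT)[].
    by [].
  have := h i; rewrite /= mem_undup mem_cat is_ orbT => /(_ isT)[].
  by [].
Qed.

(** The carrier is still [T], with the smaller sigma-algebra generated by the [X i] for [i] in [E];
    thus the identity is measurable from [T] into it. *)
Definition sigma_of (E : set I) := g_sigma_algebraType (cylinders E).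
HB.instance Definition _ E := Measurable.on (sigma_of E).

Lemma sigma_of_measurable E (A : set T) :
  measurable (A : set (sigma_of E)) -> d.-measurable A.
Proof.
apply: smallest_sub; first exact: sigma_algebra_measurable.
exact: measurable_cylinders.
Qed.

Lemma measurable_sigma_of E i : E i ->
  measurable_fun [set: sigma_of E] (X i : sigma_of E -> R).
Proof.
move=> Ei _ A mA; rewrite setTI; apply: sub_sigma_algebra.
exists [:: i], (fun=> A); split => //.
  by move=> j; rewrite inE => /eqP ->.
by apply/seteqP; split => x /= h; [move=> j; rewrite /= inE => /eqP ->|
  apply: h; rewrite /= inE].
Qed.

Variables (E1 E2 : set I).
Hypotheses (E1D : E1 `<=` D) (E2D : E2 `<=` D) (E12 : E1 `&` E2 = set0).

Lemma cylinders_indep A B : cylinders E1 A -> cylinders E2 B ->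
  P (A `&` B) = (P A * P B)%E.
Proof.
move=> [s1 [A1 [u1 sE1 m1 ->]]] [s2 [A2 [u2 sE2 m2 ->]]].
have dis i : i \in s1 -> i \in s2 -> False.
  by move=> /sE1 a /sE2 b; have : (E1 `&` E2) i by []; rewrite E12.
rewrite (indX u1)//; last by move=> i /sE1/E1D.
rewrite (indX u2)//; last by move=> i /sE2/E2D.
clear A B; pose A i := if i \in s1 then A1 i else A2 i.
have -> : \bigcap_(i in [set` s1]) (X i @^-1` A1 i) `&`
          \bigcap_(i in [set` s2]) (X i @^-1` A2 i) =
          \bigcap_(i in [set` s1 ++ s2]) (X i @^-1` A i).
  apply/seteqP; split => x /=.
    move=> [h1 h2] i /=; rewrite mem_cat /A; case: ifPn => [/h1//|_ /=]; exact: h2.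
  move=> h; split => i /= si.
    by have := h i; rewrite /= mem_cat /A si; exact.
  have := h i; rewrite /= mem_cat /A si orbT => /(_ isT).
  by case: ifPn => // s1i; case: (dis i).
rewrite indX.
- rewrite big_cat/=; congr (_ * _)%E; rewrite big_seq [RHS]big_seq;
    apply: eq_bigr => i si; rewrite /A ?si//.
  by case: ifPn => // s1i; case: (dis i).
- rewrite cat_uniq u1 u2 andbT/=; apply/hasPn => i s2i.
  by apply/negP => s1i; case: (dis i).
- by move=> i; rewrite mem_cat => /orP[/sE1/E1D|/sE2/E2D].
- by move=> i; rewrite /A; case: ifP.
Qed.

Lemma sigma_of_indep (A B : set T) :
  measurable (A : set (sigma_of E1)) -> measurable (B : set (sigma_of E2)) ->
  P (A `&` B) = (P A * P B)%E.
Proof.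
(* The restriction of [P] to [C] and [P] scaled by [P C] are finite measures that agree on the
   pi-system of cylinders, hence on the sigma-algebra it generates. This is applied once to each
   side. *)
have main (E : set I) (C : set T) : d.-measurable C ->
    (forall A, cylinders E A -> P (A `&` C) = (P A * P C)%E) ->
    forall A, measurable (A : set (sigma_of E)) -> P (A `&` C) = (P A * P C)%E.
  move=> mC H; pose k : {nonneg R} := NngNum (fine_ge0 (measure_ge0 P C)).
  have kE : k%:num%:E = P C by rewrite /= fineK// fin_num_measure.
  move=> A0 mA0.
  have : mrestr P mC A0 = mscale k P A0; last first.
    by rewrite /mrestr /mscale => ->; rewrite kE muleC.
  apply: (@g_sigma_algebra_measure_unique _ R T (cylinders E)
    (@measurable_cylinders E) (fun=> setT) (fun=> cylindersT E) _
    (mrestr P mC) (mscale k P) (@cylinders_setI E) _ _ A0 mA0).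
  - by apply/seteqP; split => // x _; exists 0%N.
  - move=> A' cA; transitivity (P A' * P C)%E; first exact: H.
    by change (P A' * P C = k%:num%:E * P A')%E; rewrite kE muleC.
  - move=> _; apply: (@le_lt_trans _ _ 1%E); last by rewrite ltry.
    by apply: probability_le1; exact: measurableI.
move=> mA mB; rewrite setIC muleC.
apply: (main E2) => //; first exact: sigma_of_measurable mA.
move=> {mB}B cB; rewrite setIC muleC.
apply: (main E1) => //; first exact: measurable_cylinders cB.
by move=> {mA}A cA; rewrite cylinders_indep.
Qed.

(* Under independence the image of [P] by [x |-> (x, x)] is a product measure on
   the two sub-sigma-algebras, so that Tonelli applies. *)
Lemma decouple (F : sigma_of E1 * sigma_of E2 -> \bar R) :
  measurable_fun setT F -> (forall z, 0 <= F z)%E ->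
  (\int[P]_x F (x, x) = \int[P]_x \int[P]_y F (x, y))%E.
Proof.
move=> mF F0.
have mid E : measurable_fun setT (id : T -> sigma_of E).
  by move=> _ A mA; rewrite setTI preimage_id; exact: sigma_of_measurable mA.
pose i1 : {mfun T >-> sigma_of E1} := HB.pack (id : T -> sigma_of E1)
  (isMeasurableFun.Build _ _ _ _ _ (mid E1)).
pose i2 : {mfun T >-> sigma_of E2} := HB.pack (id : T -> sigma_of E2)
  (isMeasurableFun.Build _ _ _ _ _ (mid E2)).
pose P1 := distribution P i1; pose P2 := distribution P i2.
have md : measurable_fun setT (fun x : T => (i1 x, i2 x)).
  exact/measurable_fun_pair.
pose dl : {mfun T >-> (sigma_of E1 * sigma_of E2)%type} :=
  HB.pack (fun x : T => (i1 x, i2 x)) (isMeasurableFun.Build _ _ _ _ _ md).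
have E : forall A, measurable A -> (P1 \x P2)%E A = distribution P dl A.
  apply: product_measure_unique => A B mA mB.
  exact: (sigma_of_indep mA mB).
transitivity (\int[distribution P dl]_z F z)%E.
  by rewrite ge0_integral_distribution.
transitivity (\int[(P1 \x P2)%E]_z F z)%E.
  by apply: eq_measure_integral => A mA _; apply/esym/E.
rewrite fubini_tonelli1//.
transitivity (\int[P1]_x \int[P]_y F (x, y))%E.
  apply: eq_integral => x _; rewrite /fubini_F ge0_integral_distribution//.
  exact: measurableT_comp mF (measurable_pair1 _).
rewrite ge0_integral_distribution//.
- have := measurable_fun_fubini_tonelli_F (m2 := P2) F mF F0.
  congr (measurable_fun _ _); apply/funext => x.
  rewrite /fubini_F ge0_integral_distribution//.
  exact: measurableT_comp mF (measurable_pair1 _).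
- by move=> x; exact: integral_ge0.
Qed.

Lemma measurable_decoupled (F : sigma_of E1 * sigma_of E2 -> \bar R) :
  measurable_fun setT F -> (forall z, 0 <= F z)%E ->
  measurable_fun setT (fun x : T => \int[P]_y F (x, y))%E.
Proof.
move=> mF F0.
have mid E : measurable_fun setT (id : T -> sigma_of E).
  by move=> _ A mA; rewrite setTI preimage_id; exact: sigma_of_measurable mA.
pose i2 : {mfun T >-> sigma_of E2} := HB.pack (id : T -> sigma_of E2)
  (isMeasurableFun.Build _ _ _ _ _ (mid E2)).
have m1 := measurable_fun_fubini_tonelli_F (m2 := distribution P i2) F mF F0.
have := measurableT_comp m1 (mid E1).
congr (measurable_fun _ _); apply/funext => x /=.
rewrite /fubini_F ge0_integral_distribution//.
exact: measurableT_comp mF (measurable_pair1 _).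
Qed.

(** Replaces conditioning: a bound proved with the first coordinate frozen yields a bound for the
    integral along the diagonal. *)
Lemma decouple_le (F : sigma_of E1 * sigma_of E2 -> \bar R) (G : T -> \bar R) :
  measurable_fun setT F -> (forall z, 0 <= F z)%E -> measurable_fun setT G ->
  (forall x, \int[P]_y F (x, y) <= G x)%E ->
  (\int[P]_x F (x, x) <= \int[P]_x G x)%E.
Proof.
move=> mF F0 mG FG; rewrite decouple//; apply: ge0_le_integral => //.
- by move=> x _; exact: integral_ge0.
- exact: measurable_decoupled.
Qed.

Lemma decouple_ge (F : sigma_of E1 * sigma_of E2 -> \bar R) (G : T -> \bar R) :
  measurable_fun setT F -> (forall z, 0 <= F z)%E -> measurable_fun setT G ->
  (forall x, 0 <= G x)%E -> (forall x, G x <= \int[P]_y F (x, y))%E ->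
  (\int[P]_x G x <= \int[P]_x F (x, x))%E.
Proof.
move=> mF F0 mG G0 GF; rewrite decouple//; apply: ge0_le_integral => //.
exact: measurable_decoupled.
Qed.

Lemma measurable_fst_sigma (f : sigma_of E1 -> R) :
  measurable_fun setT f ->
  measurable_fun setT (fun z : sigma_of E1 * sigma_of E2 => f z.1).
Proof. by move=> mf; exact: measurableT_comp mf measurable_fst. Qed.

Lemma measurable_snd_sigma (f : sigma_of E2 -> R) :
  measurable_fun setT f ->
  measurable_fun setT (fun z : sigma_of E1 * sigma_of E2 => f z.2).
Proof. by move=> mf; exact: measurableT_comp mf measurable_snd. Qed.

Lemma measurable_sigma_ofW E (f : T -> R) :
  measurable_fun setT (f : sigma_of E -> R) -> measurable_fun setT f.
Proof.
move=> mf _ A mA; have := mf measurableT A mA.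
by rewrite !setTI; exact: sigma_of_measurable.
Qed.

End decoupling.

(** * Integrated expansions and Jensen's inequality *)

Section integral_inequalities.
Context {R : realType} {d : measure_display} {T : measurableType d}.
Variable P : probability T R.
Implicit Types (f g h : T -> R) (K B r : R).

Lemma probability_integral_cst K : (\int[P]_x K%:E = K%:E)%E.
Proof.
by have := integral_cst P measurableT K%:E; rewrite [X in (_ * X)%E]probability_setT mule1.
Qed.

Lemma ge0_integrable f : measurable_fun setT f -> (forall x, 0 <= f x) ->
  (\int[P]_x (f x)%:E < +oo)%E -> P.-integrable setT (EFin \o f).
Proof.
move=> mf f0 If; apply/integrableP; split; first exact/measurable_EFinP.
by under eq_integral => x _ do rewrite /= ger0_norm//.
Qed.

(** Integrates a first-order expansion: [K] is the value, [g] the linear term, [h] the remainder.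
    Integrability of [f] and [h] is not assumed, because an infinite right-hand side is harmless. *)
Lemma integral_le_centered f g h K : measurable_fun setT f -> (forall x, 0 <= f x) ->
  P.-integrable setT (EFin \o g) -> (\int[P]_x (g x)%:E = 0)%E ->
  measurable_fun setT h -> (forall x, 0 <= h x) ->
  (forall x, f x <= K + g x + h x) ->
  (\int[P]_x (f x)%:E <= K%:E + \int[P]_x (h x)%:E)%E.
Proof.
move=> mf f0 ig g0 mh h0 fgh.
have [Ih|] := ltP (\int[P]_x (h x)%:E)%E +oo%E; last first.
  by rewrite leye_eq => /eqP ->; rewrite addey// leey.
have ih := ge0_integrable mh h0 Ih.
have iK : P.-integrable setT (EFin \o cst K) by exact: finite_measure_integrable_cst.
have iKg : P.-integrable setT (fun x => K%:E + (g x)%:E)%E by exact: integrableD.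
apply: (@le_trans _ _ (\int[P]_x (K%:E + (g x)%:E + (h x)%:E))%E).
  apply: ge0_le_integral => //.
  - by move=> x _; rewrite lee_fin.
  - exact/measurable_EFinP.
  - by apply: (measurable_int P); exact: integrableD.
  - by move=> x _; rewrite -!EFinD lee_fin.
rewrite integralD//= integralD//=.
by rewrite g0 adde0 probability_integral_cst.
Qed.

Lemma integral_ge_centered f g K : measurable_fun setT f -> (forall x, 0 <= f x) ->
  P.-integrable setT (EFin \o g) -> (\int[P]_x (g x)%:E = 0)%E ->
  (forall x, K + g x <= f x) -> (K%:E <= \int[P]_x (f x)%:E)%E.
Proof.
move=> mf f0 ig g0 fg.
have [If|] := ltP (\int[P]_x (f x)%:E)%E +oo%E; last first.
  by rewrite leye_eq => /eqP ->; rewrite leey.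
have if_ := ge0_integrable mf f0 If.
have iK : P.-integrable setT (EFin \o cst K) by exact: finite_measure_integrable_cst.
have -> : K%:E = (\int[P]_x (K%:E + (g x)%:E))%E.
  by rewrite integralD//= g0 adde0 probability_integral_cst.
apply: le_integral => //; first exact: integrableD.
by move=> x _; rewrite /= lee_fin.
Qed.

Lemma integral_powR_le f B r : measurable_fun setT f -> (forall x, 0 <= f x) ->
  0 <= B -> 0 <= r <= 1 -> (\int[P]_x (f x)%:E <= B%:E)%E ->
  (\int[P]_x (f x `^ r)%:E <= (B `^ r)%:E)%E.
Proof.
move=> mf f0 B0 r01 fB.
have mfr : measurable_fun setT (fun x => f x `^ r).
  exact: measurableT_comp (measurable_powR r) mf.
(* Jensen by the tangent at a point [C] above the mean bound. The point is kept positive because for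
   [r < 1] the power has no tangent at 0; the case [B = 0] follows by letting [C] decrease to 0. *)
have H C : 0 < C -> B <= C -> (\int[P]_x (f x `^ r)%:E <= (C `^ r)%:E)%E.
  move=> C0 BC.
  have k0 : 0 <= r * C `^ (r - 1) by rewrite mulr_ge0 ?powR_ge0//; case/andP: r01.
  have iC k : P.-integrable setT (EFin \o cst k) by exact: finite_measure_integrable_cst.
  have iff : P.-integrable setT (EFin \o f).
    by apply: ge0_integrable => //; rewrite (le_lt_trans fB)// ltry.
  apply: (@le_trans _ _ (\int[P]_x (((C `^ r - r * C `^ (r - 1) * C)%R)%:E + (r * C `^ (r - 1))%:E * (f x)%:E))%E).
    apply: ge0_le_integral => //.
    - by move=> x _; rewrite lee_fin powR_ge0.
    - exact/measurable_EFinP.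
    - by apply/measurable_EFinP; apply: measurable_funD => //; exact: measurable_funM.
    - move=> x _; rewrite -EFinM -EFinD lee_fin.
      have := powR_le_tangent r01 (f0 x) C0; lra.
  rewrite integralD//=; [|exact: iC|exact: integrableZl].
  rewrite probability_integral_cst integralZl//.
  have Ifin : (\int[P]_x (f x)%:E)%E \is a fin_num by exact: integrable_fin_num.
  rewrite -(fineK Ifin) -EFinM -EFinD lee_fin.
  have : fine (\int[P]_x (f x)%:E)%E <= C by rewrite -lee_fin fineK// (le_trans fB).
  move=> /(ler_wpM2l k0); lra.
have [B00|Bn0] := eqVneq B 0; last by apply: H => //; rewrite lt_neqAle eq_sym Bn0.
rewrite {}B00 in fB B0 H *.
have [->|r0] := eqVneq r 0.
  under eq_integral do rewrite powRr0.
  by rewrite powRr0 probability_integral_cst.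
have rp : 0 < r by rewrite lt_neqAle eq_sym r0; case/andP: r01.
rewrite powR0//; apply/lee_addgt0Pr => e e0; rewrite add0e.
have := H (e `^ r^-1) (powR_gt0 _ e0) (powR_ge0 _ _).
by rewrite -powRrM mulVf// powRr1// ltW.
Qed.

Lemma powR_le_integral f B r : measurable_fun setT f -> (forall x, 0 <= f x) ->
  0 <= B -> 1 <= r -> (B%:E <= \int[P]_x (f x)%:E)%E ->
  ((B `^ r)%:E <= \int[P]_x (f x `^ r)%:E)%E.
Proof.
move=> mf f0 B0 r1 Bf.
have mfr : measurable_fun setT (fun x => f x `^ r).
  exact: measurableT_comp (measurable_powR r) mf.
have I0 : (0 <= \int[P]_x (f x `^ r)%:E)%E.
  by apply: integral_ge0 => x _; rewrite lee_fin powR_ge0.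
have rp : 0 < r by lra.
case E : (\int[P]_x (f x `^ r)%:E)%E => [C| |]; last by rewrite E in I0.
  rewrite E lee_fin in I0.
  have := @integral_powR_le (fun x => f x `^ r) C r^-1 mfr (fun=> powR_ge0 _ _) I0.
  rewrite E lexx invr_ge0 (ltW rp) invf_le1// r1 => /(_ isT isT).
  under eq_integral do rewrite -powRrM mulfV ?gt_eqF// powRr1//.
  move=> /(le_trans Bf); rewrite !lee_fin => BC.
  have := @ge0_ler_powR R r (ltW rp) B (C `^ r^-1).
  by rewrite !nnegrE powR_ge0 B0 BC -powRrM mulVf ?gt_eqF// powRr1//; apply.
by rewrite leey.
Qed.

End integral_inequalities.

Section scalar_smooth.
Context {R : realType}.

Lemma powR_smooth_le2 (r : R) : 1 <= r -> r <= 2 ->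
  exists2 C : R, 0 < C & exists g : R -> R, forall x y,
    `|x + y| `^ r <= `|x| `^ r + g x * y + C * `|y| `^ r.
Proof.
move=> r1 r2; exists (lq_cst r 2 + 1).
  by have := @lq_cst_ge0 R r 2 r1 (lexx _); lra.
pose f (x : R) := fun _ : unit => x.
exists (fun x => lq_grad r 2 [:: tt] (f x) tt) => x y.
have := @lq_pow_smooth R r 2 unit [:: tt] (f x) (f y) r1 r2 (lexx _).
rewrite /lq_pow !big_seq1 /f -!powRrM (_ : 2 * (r / 2) = r); last by field.
move=> /le_trans; apply; rewrite lerD2l ler_wpM2r ?powR_ge0//; lra.
Qed.

End scalar_smooth.

Lemma measurable_fun_powR {R : realType} d1 (T1 : measurableType d1) (f : T1 -> R) (r : R) :
  measurable_fun setT f -> measurable_fun setT (fun x => f x `^ r).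
Proof. exact: measurableT_comp (measurable_powR r). Qed.

Lemma measurable_fun2 {R : realType} d1 (T1 : measurableType d1) (f : R -> R -> R)
    (u v : T1 -> R) :
  measurable_fun setT (fun z : R * R => f z.1 z.2) ->
  measurable_fun setT u -> measurable_fun setT v ->
  measurable_fun setT (fun x => f (u x) (v x)).
Proof.
move=> mf mu mv.
exact: (measurableT_comp mf (measurable_fun_pair mu mv)).
Qed.

(** * Sums of independent centered variables *)

Section independent_sums.
Context {R : realType} {d : measure_display} {T : measurableType d}.
Context {P : probability T R} {I : choiceType}.
Variables (D : set I) (X : I -> {RV P >-> R}).
Hypothesis indX : mutually_independent D X.
Hypothesis intX : forall i, D i -> P.-integrable setT (EFin \o X i).
Hypothesis centX : forall i, D i -> (\int[P]_x (X i x)%:E = 0)%E.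
Implicit Types (a : I -> R) (s : seq I).

Definition wsum a s (x : T) : R := \sum_(i <- s) a i * X i x.

Lemma measurable_wsum_sigma a s (E : set I) : (forall i, i \in s -> E i) ->
  measurable_fun [set: sigma_of X E] (wsum a s : sigma_of X E -> R).
Proof.
move=> sE; rewrite /wsum.
have -> : (fun x : sigma_of X E => \sum_(i <- s) a i * X i x) =
  (fun x : sigma_of X E => \sum_(i <- s) if i \in s then a i * X i x else 0).
  by apply/funext => x; rewrite big_seq [RHS]big_seq; apply: eq_bigr => i ->.
apply: measurable_sum => i.
have [si|_] := boolP (i \in s); last exact: measurable_cst.
apply: measurable_funM; first exact: measurable_cst.
by apply: (measurable_sigma_of (X := X)); exact: sE.
Qed.

Lemma measurable_wsum a s : measurable_fun setT (wsum a s).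
Proof.
by apply: measurable_sum => i; apply: measurable_funM => //; exact: measurable_funP.
Qed.

Lemma measurable_norm_powR (r : R) d1 (T1 : measurableType d1) (f : T1 -> R) :
  measurable_fun setT f -> measurable_fun setT (fun x => `|f x| `^ r).
Proof.
move=> mf; apply: measurableT_comp (measurable_powR r) _.
exact: measurableT_comp.
Qed.

Lemma integrable_wsum a s : (forall i, i \in s -> D i) ->
  P.-integrable setT (EFin \o wsum a s).
Proof.
move=> sD; have -> : EFin \o wsum a s =
    fun x => (\sum_(i <- s | i \in s) (a i)%:E * (X i x)%:E)%E.
  by apply/funext => x /=; rewrite -big_seq /wsum -sumEFin; apply: eq_bigr => i _; rewrite EFinM.
by apply: integrable_sum => // i si; apply: integrableZl => //; exact/intX/sD.
Qed.

Lemma integral_wsum a s : (forall i, i \in s -> D i) ->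
  (\int[P]_x (wsum a s x)%:E = 0)%E.
Proof.
elim: s => [|i s IH] sD.
  by under eq_integral do rewrite /wsum big_nil; rewrite integral0.
have Di : D i by apply: sD; rewrite inE eqxx.
have sD' j : j \in s -> D j by move=> js; apply: sD; rewrite inE js orbT.
transitivity (\int[P]_x ((a i)%:E * (X i x)%:E + (wsum a s x)%:E))%E.
  by apply: eq_integral => x _; rewrite /wsum big_cons EFinD EFinM.
rewrite integralD//=; [|by apply: integrableZl => //; exact: intX|exact: integrable_wsum].
by rewrite integralZl//; [rewrite centX// mule0 IH//; rewrite add0e|exact: intX].
Qed.

Section disjoint_blocks.
Variables (s1 s2 : seq I).
Hypotheses (s1D : forall i, i \in s1 -> D i) (s2D : forall i, i \in s2 -> D i).
Hypothesis s12 : ~~ has (mem s1) s2.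

Let E1 := [set i | i \in s1].
Let E2 := [set i | i \in s2].
Let E12 : E1 `&` E2 = set0.
Proof.
apply/seteqP; split => // i [/= i1 i2].
by move/negP: s12; apply; apply/hasP; exists i.
Qed.

Lemma decouple_wsum_le a (f : R -> R -> R) (h : R -> R) :
  measurable_fun setT (fun z : R * R => f z.1 z.2) ->
  measurable_fun setT (fun x => h (wsum a s1 x)) ->
  (forall x y, 0 <= f x y) ->
  (forall u, (\int[P]_y (f u (wsum a s2 y))%:E <= (h u)%:E)%E) ->
  (\int[P]_x (f (wsum a s1 x) (wsum a s2 x))%:E <=
   \int[P]_x (h (wsum a s1 x))%:E)%E.
Proof.
move=> mf mh f0 fh.
pose F (z : sigma_of X E1 * sigma_of X E2) : \bar R :=
  (f (wsum a s1 z.1) (wsum a s2 z.2))%:E.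
apply: (@decouple_le _ _ _ _ _ D X indX E1 E2 _ _ E12 F) => //.
- apply/measurable_EFinP.
  apply: (measurable_fun2 mf).
    by apply: measurable_fst_sigma; exact: measurable_wsum_sigma.
  by apply: measurable_snd_sigma; exact: measurable_wsum_sigma.
- by move=> z; rewrite lee_fin.
- exact/measurable_EFinP.
- by move=> x; exact (fh (wsum a s1 x)).
Qed.

Lemma decouple_wsum_ge a (f : R -> R -> R) (h : R -> R) :
  measurable_fun setT (fun z : R * R => f z.1 z.2) ->
  measurable_fun setT (fun x => h (wsum a s1 x)) ->
  (forall x y, 0 <= f x y) -> (forall x, 0 <= h x) ->
  (forall u, ((h u)%:E <= \int[P]_y (f u (wsum a s2 y))%:E)%E) ->
  (\int[P]_x (h (wsum a s1 x))%:E <=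
   \int[P]_x (f (wsum a s1 x) (wsum a s2 x))%:E)%E.
Proof.
move=> mf mh f0 h0 fh.
pose F (z : sigma_of X E1 * sigma_of X E2) : \bar R :=
  (f (wsum a s1 z.1) (wsum a s2 z.2))%:E.
apply: (@decouple_ge _ _ _ _ _ D X indX E1 E2 _ _ E12 F) => //.
- apply/measurable_EFinP.
  apply: (measurable_fun2 mf).
    by apply: measurable_fst_sigma; exact: measurable_wsum_sigma.
  by apply: measurable_snd_sigma; exact: measurable_wsum_sigma.
- by move=> z; rewrite lee_fin.
- exact/measurable_EFinP.
- by move=> x; rewrite lee_fin.
Qed.

(** Conditional Jensen: with the first block frozen at [u], the sign of [u] is a subgradient of the
    absolute value and the second block is centered. *)
Lemma integral_norm_wsum_subset a :
  (\int[P]_x `|wsum a s1 x|%:E <= \int[P]_x `|wsum a s1 x + wsum a s2 x|%:E)%E.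
Proof.
apply: (@decouple_wsum_ge a (fun u v => `|u + v|) (fun u => `|u|)) => //.
- by apply: measurableT_comp => //; exact: measurable_funD.
- by apply: measurableT_comp => //; exact: measurable_wsum.
- move=> u; apply: (@integral_ge_centered _ _ _ P _ (fun x => Num.sg u * wsum a s2 x)).
  + apply: measurableT_comp => //; apply: measurable_funD => //; exact: measurable_wsum.
  + by move=> x.
  + have -> : EFin \o (fun x => Num.sg u * wsum a s2 x) =
      (fun x => (Num.sg u)%:E * (EFin \o wsum a s2) x)%E by apply/funext => x /=.
    by apply: integrableZl => //; exact: integrable_wsum.
  + under eq_integral do rewrite EFinM.
    by rewrite integralZl ?integral_wsum ?mule0//; exact: integrable_wsum.
  + move=> x; rewrite [`|u|]normrEsg -mulrDr; apply: (le_trans (ler_norm _)).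
    by rewrite normrM ler_piMl// normr_sg; case: (_ != _).
Qed.

End disjoint_blocks.

Lemma wsum_cons a i s x : wsum a (i :: s) x = wsum a s x + wsum a [:: i] x.
Proof. by rewrite /wsum !big_cons big_nil addr0 addrC. Qed.

Lemma wsum1 a i x : wsum a [:: i] x = a i * X i x.
Proof. by rewrite /wsum big_seq1. Qed.

End independent_sums.

(* The constant is chosen so that the induction over the summands closes in
   the Marcinkiewicz--Zygmund inequality. *)
Definition mz_cst {R : realType} (q : R) : R :=
  (1 + 2 * (q * (q - 1) * 2 `^ (q - 2))) `^ (q / 2).

Lemma mz_cst_gt0 {R : realType} (q : R) : 2 <= q -> 0 < mz_cst q.
Proof.
move=> q2; apply: powR_gt0.
have : 0 <= q * (q - 1) * 2 `^ (q - 2) by rewrite !mulr_ge0 ?powR_ge0//; lra.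
lra.
Qed.

(** * Upper moment bounds for independent sums *)

Section independent_sum_moments.
Context {R : realType} {d : measure_display} {T : measurableType d}.
Context {P : probability T R} {I : choiceType}.
Variables (D : set I) (X : I -> {RV P >-> R}).
Hypothesis indX : mutually_independent D X.
Hypothesis intX : forall i, D i -> P.-integrable setT (EFin \o X i).
Hypothesis centX : forall i, D i -> (\int[P]_x (X i x)%:E = 0)%E.
Implicit Types (a : I -> R) (s : seq I).

Lemma integrable_cmul (k : R) i : D i -> P.-integrable setT (EFin \o (fun x => k * X i x)).
Proof.
move=> Di; have -> : EFin \o (fun x => k * X i x) = (fun x => k%:E * (EFin \o X i) x)%E.
  by apply/funext => x /=.
by apply: integrableZl => //; exact: intX.
Qed.

Lemma integral_cmul (k : R) i : D i -> (\int[P]_x (k * X i x)%:E = 0)%E.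
Proof.
move=> Di; under eq_integral do rewrite EFinM.
by rewrite integralZl ?centX ?mule0//; exact: intX.
Qed.

(** Inductive step for moments of sums: the head is integrated out with the sum of the others frozen
    at [u]. *)
Lemma decouple_cons_le a i s (f h : R -> R) : uniq (i :: s) ->
  (forall j, j \in i :: s -> D j) -> (forall u, 0 <= f u) ->
  measurable_fun setT f -> measurable_fun setT h ->
  (forall u, (\int[P]_y (f (u + a i * X i y))%:E <= (h u)%:E)%E) ->
  (\int[P]_x (f (wsum X a (i :: s) x))%:E <= \int[P]_x (h (wsum X a s x))%:E)%E.
Proof.
move=> /= /andP[is_ us] sD f0 mf mh fh.
under eq_integral do rewrite wsum_cons.
apply: (@decouple_wsum_le _ _ _ _ _ D X indX s [:: i] _ _ _ a (fun u v => f (u + v)) h).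
- by move=> j js; apply: sD; rewrite inE js orbT.
- by move=> j; rewrite inE => /eqP ->; apply: sD; rewrite inE eqxx.
- by rewrite /= orbF.
- by apply: measurableT_comp mf _; exact: measurable_funD.
- by apply: measurableT_comp mh _; exact: measurable_wsum.
- by move=> x y.
- by move=> u; under eq_integral do rewrite wsum1; exact: fh.
Qed.

(* von Bahr--Esseen *)
Lemma integral_wsum_powR_le2 (r : R) : 1 <= r -> r <= 2 ->
  exists2 C : R, 0 < C & forall m a s, uniq s -> (forall i, i \in s -> D i) ->
  (forall i, D i -> \int[P]_x (`|X i x| `^ r)%:E <= m%:E)%E ->
  (\int[P]_x (`|wsum X a s x| `^ r)%:E <= (C * m * \sum_(i <- s) `|a i| `^ r)%:E)%E.
Proof.
move=> r1 r2; have [C C0 [g sm]] := powR_smooth_le2 r1 r2.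
exists C => // m a s us sD mX.
have mp : measurable_fun setT (fun u : R => `|u| `^ r).
  by apply: measurable_norm_powR; exact: measurable_id.
elim: s us sD => [|i s IH] us sD.
  under eq_integral do rewrite /wsum big_nil normr0 powR0 ?gt_eqF ?(lt_le_trans ltr01)//.
  by rewrite integral0 big_nil mulr0.
have Di : D i by apply: sD; rewrite inE eqxx.
have {}IH := IH (proj2 (andP us)) (fun j js => sD j (ltac:(by rewrite inE js orbT))).
have k0 : 0 <= C * m * `|a i| `^ r.
  have m0 : 0 <= m.
    by rewrite -lee_fin; apply: le_trans (mX i Di); apply: integral_ge0 => x _; rewrite lee_fin powR_ge0.
  by nonneg.
apply: (le_trans (decouple_cons_le (h := fun u => `|u| `^ r + C * m * `|a i| `^ r) us sD _ mp _ _)).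
- by move=> u; exact: powR_ge0.
- exact: measurable_funD.
- move=> u; apply: (le_trans (@integral_le_centered _ _ _ P _ (fun x => g u * a i * X i x)
    (fun x => C * (`|a i| `^ r * `|X i x| `^ r)) (`|u| `^ r) _ _ _ _ _ _ _)).
  + apply: measurable_norm_powR; apply: measurable_funD => //; exact: measurable_funM.
  + by move=> x; exact: powR_ge0.
  + exact: integrable_cmul.
  + exact: integral_cmul.
  + apply: measurable_funM => //; apply: measurable_funM => //.
    by apply: measurable_norm_powR; exact: measurable_funP.
  + by move=> x; nonneg.
  + by move=> x; rewrite -powRM// -normrM -mulrA; exact: sm.
  rewrite EFinD leeD2l//.
  under eq_integral do rewrite mulrA EFinM.
  rewrite ge0_integralZl_EFin//.
  - have -> : (C * m * `|a i| `^ r)%:E = ((C * `|a i| `^ r)%:E * m%:E)%E.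
      by rewrite -EFinM; congr EFin; ring.
    apply: lee_wpmul2l; last exact: mX.
    by rewrite lee_fin mulr_ge0 ?powR_ge0// ltW.
  - by apply/measurable_EFinP; apply: measurable_norm_powR; exact: measurable_funP.
  - by rewrite mulr_ge0 ?powR_ge0// ltW.
under eq_integral do rewrite EFinD.
rewrite ge0_integralD//.
- rewrite probability_integral_cst big_cons mulrDr addrC EFinD; exact: leeD.
- by apply/measurable_EFinP; apply: measurable_norm_powR; exact: measurable_wsum.
Qed.

(** By [powR_smooth], a new summand adds a pure [q]-th power and a mixed term with the old sum to
    the power [q - 2]. The mean of the latter is bounded by applying Jensen to the induction
    hypothesis. *)
Lemma integral_wsum_powR_ge2 (q m : R) a s : 2 <= q -> 0 <= m -> uniq s ->
  (forall i, i \in s -> D i) ->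
  (forall i, D i -> \int[P]_x (`|X i x| `^ q)%:E <= m%:E)%E ->
  (\int[P]_x (`|wsum X a s x| `^ q)%:E
     <= (mz_cst q * m * (\sum_(i <- s) a i ^+ 2) `^ (q / 2))%:E)%E.
Proof.
move=> q2 m0 us sD mX; have q0 : 0 < q by lra.
have [C C0 CE] : exists2 C : R, 0 <= C & q * (q - 1) * 2 `^ (q - 2) = C.
  by eexists; last reflexivity; rewrite !mulr_ge0 ?powR_ge0//; lra.
rewrite /mz_cst CE; pose K := (1 + 2 * C) `^ (q / 2); rewrite -/K.
have K0 : 0 < K by apply: powR_gt0; lra.
have K1 : C <= K / 2.
  have : 1 + 2 * C <= K by apply: le1r_powR; lra.
  lra.
(* The power [2 / q] of [K] is [1 + 2 * C], whose half exceeds [C]; this is why [mz_cst] has this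
   form. *)
have K2 : C * K `^ (1 - 2 / q) <= K / 2.
  have -> : K / 2 = K `^ (2 / q) / 2 * K `^ (1 - 2 / q).
    rewrite mulrAC -gt0_powRD//; congr (_ / 2).
    by rewrite addrC subrK powRr1// ltW.
  rewrite ler_wpM2r ?powR_ge0// /K -powRrM.
  have -> : q / 2 * (2 / q) = 1 by field; lra.
  rewrite powRr1; lra.
have mp (t : R) : measurable_fun setT (fun u : R => `|u| `^ t).
  by apply: measurable_norm_powR; exact: measurable_id.
elim: s us sD => [|i s IH] us sD.
  under eq_integral do rewrite /wsum big_nil normr0 powR0 ?gt_eqF//.
  by rewrite integral0 big_nil lee_fin !mulr_ge0 ?powR_ge0// ltW.
have Di : D i by apply: sD; rewrite inE eqxx.
have {}IH := IH (proj2 (andP us)) (fun j js => sD j (ltac:(by rewrite inE js orbT))).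
have v0 : (\int[P]_x (X i x ^+ 2)%:E <= (m `^ (2 / q))%:E)%E.
  have r01 : 0 <= 2 / q <= 1 by rewrite divr_ge0 ?(ltW q0)//= ler_pdivrMr// mul1r.
  have mm := measurable_norm_powR q (@measurable_funP _ _ _ _ setT (X i)).
  have := integral_powR_le mm (fun=> powR_ge0 _ _) m0 r01 (mX i Di).
  under eq_integral => x _.
    rewrite -powRrM (_ : q * (2 / q) = 2); last by field; lra.
    rewrite powR_mulrn// real_normK ?num_real//.
    over.
  by [].
set A := \sum_(j <- s) a j ^+ 2 in IH.
have A0 : 0 <= A by apply: sumr_ge0 => j _; exact: sqr_ge0.
pose h (u : R) := `|u| `^ q + (C * (a i ^+ 2 * m `^ (2 / q)) * `|u| `^ (q - 2) + C * (`|a i| `^ q * m)).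
have c1 : 0 <= C * (a i ^+ 2 * m `^ (2 / q)) by nonneg.
have c2 : 0 <= C * (`|a i| `^ q * m) by nonneg.
apply: (le_trans (decouple_cons_le (h := h) us sD _ (mp q) _ _)).
- by move=> u; exact: powR_ge0.
- apply: measurable_funD => //; apply: measurable_funD => //; exact: measurable_funM.
- move=> u; apply: (le_trans (@integral_le_centered _ _ _ P _
    (fun x => q * spow (q - 1) u * a i * X i x)
    (fun x => C * (`|u| `^ (q - 2) * a i ^+ 2) * X i x ^+ 2 + C * `|a i| `^ q * `|X i x| `^ q)
    (`|u| `^ q) _ _ _ _ _ _ _)).
  + apply: measurable_norm_powR; apply: measurable_funD => //; exact: measurable_funM.
  + by move=> x; exact: powR_ge0.
  + exact: integrable_cmul.
  + exact: integral_cmul.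
  + apply: measurable_funD; apply: measurable_funM => //.
      by apply: measurable_funX; exact: measurable_funP.
    by apply: measurable_norm_powR; exact: measurable_funP.
  + by move=> x; nonneg.
  + move=> x; have := powR_smooth u (a i * X i x) q2.
    rewrite CE => /le_trans; apply; rewrite normrM powRM// exprMn.
    by rewrite le_eqVlt; apply/orP; left; apply/eqP; ring.
  rewrite /h EFinD leeD2l//.
  under eq_integral do rewrite EFinD !(EFinM (_ * _)).
  have mq : measurable_fun setT (fun x => (`|X i x| `^ q)%:E).
    by apply/measurable_EFinP; apply: measurable_norm_powR; exact: measurable_funP.
  have m2 : measurable_fun setT (fun x => (X i x ^+ 2)%:E).
    by apply/measurable_EFinP; apply: measurable_funX; exact: measurable_funP.
  have k1 : 0 <= C * (`|u| `^ (q - 2) * a i ^+ 2) by nonneg.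
  have k2 : 0 <= C * `|a i| `^ q by nonneg.
  rewrite ge0_integralD//; last 4 first.
  - by move=> x _; rewrite -EFinM lee_fin mulr_ge0 ?sqr_ge0.
  - exact: emeasurable_funM.
  - by move=> x _; rewrite -EFinM lee_fin mulr_ge0 ?powR_ge0.
  - exact: emeasurable_funM.
  rewrite !ge0_integralZl_EFin//; last by move=> x _; rewrite lee_fin sqr_ge0.
  rewrite EFinD; apply: leeD.
    have -> : C * (a i ^+ 2 * m `^ (2 / q)) * `|u| `^ (q - 2) =
      C * (`|u| `^ (q - 2) * a i ^+ 2) * m `^ (2 / q) by ring.
    by rewrite [leRHS]EFinM lee_wpmul2l// lee_fin.
  have -> : C * (`|a i| `^ q * m) = C * `|a i| `^ q * m by ring.
  by rewrite [leRHS]EFinM lee_wpmul2l ?lee_fin//; exact: mX.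
have mw := measurable_wsum X a s.
have B0 : 0 <= K * m * A `^ (q / 2) by nonneg.
have t01 : 0 <= 1 - 2 / q <= 1.
  by rewrite subr_ge0 ler_pdivrMr// mul1r q2/= gerBl divr_ge0// ltW.
have Iq2 : (\int[P]_x (`|wsum X a s x| `^ (q - 2))%:E <= (K `^ (1 - 2 / q) * m `^ (1 - 2 / q) * A `^ (q / 2 - 1))%:E)%E.
  have -> : K `^ (1 - 2 / q) * m `^ (1 - 2 / q) * A `^ (q / 2 - 1) =
      (K * m * A `^ (q / 2)) `^ (1 - 2 / q).
    rewrite powRM ?powR_ge0 ?mulr_ge0 ?(ltW K0)// powRM ?(ltW K0)// -powRrM.
    by congr (_ * _ `^ _); field; lra.
  have := integral_powR_le (measurable_norm_powR q mw) (fun=> powR_ge0 _ _) B0 t01 IH.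
  under eq_integral => x _.
    rewrite -powRrM (_ : q * (1 - 2 / q) = q - 2); last by field; lra.
    over.
  by [].
rewrite /h; under eq_integral do rewrite !EFinD (EFinM (C * _)).
rewrite ge0_integralD//; last 3 first.
- by apply/measurable_EFinP; exact: measurable_norm_powR.
- by move=> x _; rewrite -EFinM -EFinD lee_fin addr_ge0// mulr_ge0// powR_ge0.
- apply: emeasurable_funD => //; apply: emeasurable_funM => //.
  by apply/measurable_EFinP; exact: measurable_norm_powR.
rewrite ge0_integralD//; last 2 first.
- by move=> x _; rewrite -EFinM lee_fin mulr_ge0// powR_ge0.
- by apply: emeasurable_funM => //; apply/measurable_EFinP; exact: measurable_norm_powR.
rewrite probability_integral_cst ge0_integralZl_EFin//; last first.
  by apply/measurable_EFinP; exact: measurable_norm_powR.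
have c1E : (0 <= (C * (a i ^+ 2 * m `^ (2 / q)))%:E)%E by rewrite lee_fin.
apply: (le_trans (leeD IH (leeD (lee_wpmul2l c1E Iq2) (lexx _)))).
rewrite -EFinM -!EFinD lee_fin big_cons -/A addrC.
set u := a i ^+ 2; have u0 : 0 <= u by exact: sqr_ge0.
have -> : `|a i| `^ q = u `^ (q / 2).
  rewrite /u -real_normK ?num_real// -powR_mulrn// -powRrM; congr powR; by field.
have [m00|mn0] := eqVneq m 0.
  rewrite m00 !(mulr0, mul0r, addr0) powR0 ?(mulr0, mul0r, addr0)//.
  by rewrite mulf_neq0 ?invr_eq0 ?gt_eqF.
have mp0 : 0 < m by rewrite lt_neqAle eq_sym mn0.
have mm : m `^ (2 / q) * m `^ (1 - 2 / q) = m.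
  by rewrite -gt0_powRD// addrC subrK powRr1.
have -> : C * (u * m `^ (2 / q)) * (K `^ (1 - 2 / q) * m `^ (1 - 2 / q) * A `^ (q / 2 - 1)) =
   (m `^ (2 / q) * m `^ (1 - 2 / q)) * (C * K `^ (1 - 2 / q)) * (u * A `^ (q / 2 - 1)) by ring.
rewrite {}mm.
have t0 : 0 <= q / 2 - 1 by lra.
(* The increase of the [q / 2] power leaves room for half of the mixed term and half of the pure
   term, which is what [K2] and [K1] require. *)
have S : A `^ (q / 2) + 2^-1 * (u * A `^ (q / 2 - 1) + u `^ (q / 2)) <= (u + A) `^ (q / 2).
  have E w : 0 <= w -> w `^ (q / 2) = w * w `^ (q / 2 - 1).
    by move=> w0; rewrite mulr_powRB1//; lra.
  rewrite !E ?addr_ge0//.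
  have h1 : A `^ (q / 2 - 1) <= (u + A) `^ (q / 2 - 1).
    by rewrite (ge0_ler_powR t0) ?nnegrE ?lerDr// addr_ge0.
  have h2 : u `^ (q / 2 - 1) <= (u + A) `^ (q / 2 - 1).
    by rewrite (ge0_ler_powR t0) ?nnegrE ?lerDl// addr_ge0.
  have := ler_wpM2l A0 h1; have := ler_wpM2l u0 h1; have := ler_wpM2l u0 h2; lra.
have Km0 : 0 <= K * m by rewrite mulr_ge0// ltW.
have := ler_wpM2l Km0 S; apply: le_trans.
have uA : 0 <= m * (u * A `^ (q / 2 - 1)) by nonneg.
have uq : 0 <= m * u `^ (q / 2) by nonneg.
have := ler_wpM2r uA K2; have := ler_wpM2r uq K1.
move: (C * K `^ _) (A `^ _) (A `^ _) (u `^ _) => ? ? ? ?; lra.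
Qed.

End independent_sum_moments.

(** * Khinchin's inequality and lower moment bounds *)

Section khinchin.
Context {R : realType}.

(* Mean of [`|s + sum_i (+/-) y_i|] over all choices of signs. *)
Fixpoint sign_mean (l : seq R) (s : R) : R :=
  if l is y :: l' then (sign_mean l' (s + y) + sign_mean l' (s - y)) / 2
  else `|s|.

Lemma sign_mean_ge0 l s : 0 <= sign_mean l s.
Proof.
elim: l s => [|y l IH] s /=; first exact: normr_ge0.
by rewrite divr_ge0 ?addr_ge0.
Qed.

(** Mean of the quartic minorant of the absolute value. The signed sum has second moment [s^2 + V],
    and its fourth moment is at most [s^4 + 6 s^2 V + 3 V^2], as in the Gaussian case; the induction
    discards a multiple of [y^4] at each step. *)
Lemma sign_mean_ge_quartic l s sg : 0 < sg ->
  let V := \sum_(y <- l) y ^+ 2 in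
  (s ^+ 2 + V) / sg
    - 4%:R / 27%:R * ((s ^+ 4 + 6%:R * s ^+ 2 * V + 3%:R * V ^+ 2) / sg ^+ 3)
  <= sign_mean l s.
Proof.
move=> sg0 /=; elim: l s => [|y l IH] s /=.
  rewrite big_nil; have := norm_ge_quartic s sg0.
  by rewrite !(expr0n, mulr0, addr0).
rewrite big_cons; set V := \sum_(z <- l) z ^+ 2 in IH *.
rewrite ler_pdivlMr//; apply: le_trans (lerD (IH (s + y)) (IH (s - y))).
have i1 : 0 < sg^-1 by rewrite invr_gt0.
have i3 : 0 < (sg ^+ 3)^-1 by rewrite invr_gt0 exprn_gt0.
move: (sg^-1) ((sg ^+ 3)^-1) i1 i3 => v w v0 w0.
rewrite -subr_ge0.
have -> : ((s + y) ^+ 2 + V) * v -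
  4 / 27 * (((s + y) ^+ 4 + 6 * (s + y) ^+ 2 * V + 3 * V ^+ 2) * w) +
  (((s - y) ^+ 2 + V) * v -
   4 / 27 * (((s - y) ^+ 4 + 6 * (s - y) ^+ 2 * V + 3 * V ^+ 2) * w)) -
  ((s ^+ 2 + (y ^+ 2 + V)) * v -
   4 / 27 *
   ((s ^+ 4 + 6 * s ^+ 2 * (y ^+ 2 + V) + 3 * (y ^+ 2 + V) ^+ 2) * w)) * 2
  = 16%:R / 27%:R * (y ^+ 2) ^+ 2 * w by field.
by apply: mulr_ge0; [apply: mulr_ge0; [exact: divr_ge0|exact: sqr_ge0]|exact: ltW].
Qed.

(** The scale [sg] is the square root of [V], which gives the constant [5/9 = 1 - 3 * 4/27]. *)
Lemma sign_mean_ge l :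
  5%:R / 9%:R * (\sum_(y <- l) y ^+ 2) `^ 2^-1 <= sign_mean l 0.
Proof.
set V := \sum_(y <- l) _.
have V0 : 0 <= V by apply: sumr_ge0 => y _; exact: sqr_ge0.
have [->|Vn0] := eqVneq V 0.
  by rewrite powR0 ?invr_eq0// mulr0 sign_mean_ge0.
have Vp : 0 < V by rewrite lt_neqAle eq_sym Vn0.
have sg0 : 0 < V `^ 2^-1 by exact: powR_gt0.
have := @sign_mean_ge_quartic l 0 _ sg0; rewrite /= -/V.
have VE : V = (V `^ 2^-1) ^+ 2.
  by rewrite -powR_mulrn ?powR_ge0// -powRrM mulVf// powRr1.
move: (V `^ 2^-1) sg0 VE => sg sg0 VE; apply: le_trans.
rewrite VE le_eqVlt; apply/orP; left; apply/eqP; field; by rewrite gt_eqF.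
Qed.

End khinchin.

Section independent_sum_lower.
Context {R : realType} {d : measure_display} {T : measurableType d}.
Context {P : probability T R} {I : choiceType}.
Variables (D : set I) (X : I -> {RV P >-> R}).
Hypothesis indX : mutually_independent D X.
Hypothesis intX : forall i, D i -> P.-integrable setT (EFin \o X i).
Hypothesis centX : forall i, D i -> (\int[P]_x (X i x)%:E = 0)%E.
Implicit Types (a : I -> R) (s : seq I).

Definition signed (eps : I -> bool) a i : R := (-1) ^+ eps i * a i.

(* Jensen: dropping an independent centered block does not increase the
   mean of the absolute value, so flipping signs at most doubles it. *)
Lemma integral_norm_wsum_signed (eps : I -> bool) a s : uniq s ->
  (forall i, i \in s -> D i) ->
  (\int[P]_x `|wsum X (signed eps a) s x|%:E
     <= 2%:E * \int[P]_x `|wsum X a s x|%:E)%E.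
Proof.
move=> us sD; pose sp := seq.filter (predC eps) s; pose sm := seq.filter eps s.
have E1 x : wsum X a s x = wsum X a sp x + wsum X a sm x.
  by rewrite /wsum /sp /sm !big_filter (bigID (predC eps))/=; under [X in _ + X]eq_bigl do rewrite negbK.
have E2 x : wsum X (signed eps a) s x = wsum X a sp x - wsum X a sm x.
  rewrite /wsum /sp /sm !big_filter (bigID (predC eps))/= -sumrN; congr (_ + _).
    by apply: eq_bigr => i /negbTE e; rewrite /signed e expr0 mul1r.
  under eq_bigl do rewrite negbK.
  by apply: eq_bigr => i e; rewrite /signed e expr1 mulN1r mulNr.
have spD i : i \in sp -> D i by rewrite mem_filter => /andP[_ /sD].
have smD i : i \in sm -> D i by rewrite mem_filter => /andP[_ /sD].
have dis : ~~ has (mem sp) sm.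
  apply/hasPn => i; rewrite mem_filter => /andP[e _].
  by rewrite /= mem_filter /= e.
have dis' : ~~ has (mem sm) sp by rewrite has_sym.
have h1 := integral_norm_wsum_subset indX intX centX spD smD dis a.
have h2 := integral_norm_wsum_subset indX intX centX smD spD dis' a.
have mn (l : seq I) : measurable_fun setT (fun x => (`|wsum X a l x|)%:E).
  by apply/measurable_EFinP; apply: measurableT_comp => //; exact: measurable_wsum.
apply: (@le_trans _ _ (\int[P]_x (`|wsum X a sp x|%:E + `|wsum X a sm x|%:E))%E).
  apply: ge0_le_integral => //.
  - by apply/measurable_EFinP; apply: measurableT_comp => //; exact: measurable_wsum.
  - by apply: emeasurable_funD.
  - by move=> x _; rewrite E2 -EFinD lee_fin ler_normB.
rewrite ge0_integralD//.
have -> : (2%:E * \int[P]_x `|wsum X a s x|%:E =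
   \int[P]_x `|wsum X a s x|%:E + \int[P]_x `|wsum X a s x|%:E)%E.
  by rewrite -[2%R]/(1 + 1)%R EFinD ge0_muleDl ?mul1e// lee_fin.
apply: leeD.
  by apply: (le_trans h1); under [leRHS]eq_integral do rewrite E1.
by apply: (le_trans h2); under [leRHS]eq_integral do rewrite E1 addrC.
Qed.

Lemma measurable_sign_mean a s (f : T -> R) : measurable_fun setT f ->
  measurable_fun setT (fun x => sign_mean [seq a i * X i x | i <- s] (f x)).
Proof.
elim: s f => [|i s IH] f mf /=; first exact: measurableT_comp.
have mX : measurable_fun setT (fun x => a i * X i x).
  by apply: measurable_funM => //; exact: measurable_funP.
apply: measurable_funM => //; apply: measurable_funD; apply: IH.
  exact: measurable_funD.
exact: measurable_funB.
Qed.

Lemma integral_sign_mean_le a s (f : T -> R) (B : \bar R) : uniq s ->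
  measurable_fun setT f ->
  (forall eps, \int[P]_x `|f x + wsum X (signed eps a) s x|%:E <= B)%E ->
  (\int[P]_x (sign_mean [seq a i * X i x | i <- s] (f x))%:E <= B)%E.
Proof.
elim: s f => [|i s IH] f us mf H /=.
  have := H (fun=> true); congr (_ <= _)%E; apply: eq_integral => x _.
  by rewrite /wsum big_nil addr0.
move: us => /= /andP[is_ us].
have mX : measurable_fun setT (fun x => a i * X i x).
  by apply: measurable_funM => //; exact: measurable_funP.
(* The sign of the head is fixed by [b]. Since [i] is not in [s], overriding [eps] at [i] does not
   change the signs in the tail. *)
have key (b : bool) : (\int[P]_x (sign_mean [seq a i * X i x | i <- s]
    (f x + (-1) ^+ b * (a i * X i x)))%:E <= B)%E.
  apply: (IH (fun x => f x + (-1) ^+ b * (a i * X i x))) => //.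
    by apply: measurable_funD => //; exact: measurable_funM.
  move=> eps; have := H (fun j => if j == i then b else eps j).
  congr (_ <= _)%E; apply: eq_integral => x _; congr (`| _ |%:E).
  rewrite /wsum big_cons /signed eqxx addrA !mulrA; congr (_ + _).
  by apply: eq_big_seq => j js; rewrite ifN//; apply: contraNneq is_ => <-.
have := key true; have := key false; rewrite /= expr0 expr1.
under eq_integral do rewrite mul1r.
under [X in _ -> (X <= _)%E -> _]eq_integral do rewrite mulN1r.
move=> h1 h2.
have m1 := measurable_sign_mean a s (measurable_funD mf mX).
have m2 := measurable_sign_mean a s (measurable_funB mf mX).
under eq_integral do rewrite mulrC EFinM EFinD.
rewrite ge0_integralZl_EFin//; last 2 first.
- by move=> x _; rewrite -EFinD lee_fin addr_ge0 ?sign_mean_ge0.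
- by apply: emeasurable_funD; exact/measurable_EFinP.
rewrite ge0_integralD//; last 4 first.
- by move=> x _; rewrite lee_fin sign_mean_ge0.
- exact/measurable_EFinP.
- by move=> x _; rewrite lee_fin sign_mean_ge0.
- exact/measurable_EFinP.
apply: (@le_trans _ _ (2^-1%:E * (B + B))%E).
  by apply: lee_wpmul2l; [rewrite lee_fin invr_ge0|exact: leeD].
have B0 : (0 <= B)%E.
  by apply: le_trans h1; apply: integral_ge0 => x _; rewrite lee_fin sign_mean_ge0.
have -> : (B + B = 2%:E * B)%E.
  by rewrite -[2%R]/(1 + 1)%R EFinD ge0_muleDl ?mul1e// lee_fin.
by rewrite muleA -EFinM mulVf// mul1e.
Qed.

(** Averaging over signs costs a factor 2, so that [5/9] becomes [5/18]; Khinchin then applies at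
    each outcome with the random coefficients [a i * X i x]. *)
Lemma integral_norm_wsum_ge a s (m : R) : 0 <= m -> uniq s ->
  (forall i, i \in s -> D i) ->
  (forall i, D i -> m%:E <= \int[P]_x `|X i x|%:E)%E ->
  ((5%:R / 18%:R * m * (\sum_(i <- s) a i ^+ 2) `^ 2^-1)%:E
     <= \int[P]_x `|wsum X a s x|%:E)%E.
Proof.
move=> m0 us sD mX; set A := \sum_(i <- s) a i ^+ 2.
have A0 : 0 <= A by apply: sumr_ge0 => i _; exact: sqr_ge0.
have [->|An0] := eqVneq A 0.
  rewrite powR0 ?invr_eq0// mulr0; apply: integral_ge0 => x _.
  by rewrite lee_fin.
have Ap : 0 < A by rewrite lt_neqAle eq_sym An0.
have S := integral_sign_mean_le (a := a) us (measurable_cst (0 : R))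
  (B := (2%:E * \int[P]_x `|wsum X a s x|%:E)%E).
have {}S : (\int[P]_x (sign_mean [seq a i * X i x | i <- s] 0)%:E
    <= 2%:E * \int[P]_x `|wsum X a s x|%:E)%E.
  apply: S => eps; under eq_integral do rewrite add0r.
  exact: integral_norm_wsum_signed.
(* Cauchy-Schwarz with weights [a i ^+ 2] makes the square function linear in the absolute values of
   the [X i], so only first absolute moments enter. *)
have pw x : 5%:R / 9%:R * A `^ (- 2^-1) * (\sum_(i <- s) a i ^+ 2 * `|X i x|)
    <= sign_mean [seq a i * X i x | i <- s] 0.
  apply: le_trans (sign_mean_ge _); rewrite big_map -mulrA.
  rewrite ler_wpM2l ?divr_ge0// powRN ler_pdivrMl ?powR_gt0//.
  have := @holder_sum R I s (fun i => a i ^+ 2) (fun i => (a i * X i x) ^+ 2) 2^-1.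
  have -> : 1 - 2^-1 = 2^-1 :> R by field.
  rewrite invr_ge0 ler0n invf_le1//= ler1n => /(_ isT (fun=> sqr_ge0 _) (fun=> sqr_ge0 _)).
  apply: le_trans; rewrite le_eqVlt; apply/orP; left; apply/eqP.
  apply: eq_bigr => i _; rewrite !powR12_sqrt ?sqr_ge0// !sqrtr_sqr normrM mulrA.
  by rewrite -expr2 real_normK ?num_real.
have mXi i : measurable_fun setT (fun x => (a i ^+ 2 * `|X i x|)).
  by apply: measurable_funM => //; apply: measurableT_comp => //; exact: measurable_funP.
have c0 : 0 <= 5%:R / 9%:R * A `^ (- 2^-1) by rewrite mulr_ge0 ?powR_ge0// divr_ge0.
have L : ((5%:R / 9%:R * m * A `^ 2^-1)%:E <=
    \int[P]_x (5%:R / 9%:R * A `^ (- 2^-1) * (\sum_(i <- s) a i ^+ 2 * `|X i x|))%:E)%E.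
  under eq_integral do rewrite EFinM.
  rewrite ge0_integralZl_EFin//; last 2 first.
  - by move=> x _; rewrite lee_fin; apply: sumr_ge0 => i _; rewrite mulr_ge0 ?sqr_ge0.
  - by apply/measurable_EFinP; exact: measurable_sum.
  under eq_integral do rewrite -sumEFin.
  rewrite ge0_integral_sum//; last 2 first.
  - by move=> i; exact/measurable_EFinP.
  - by move=> i x _; rewrite lee_fin mulr_ge0 ?sqr_ge0.
  have -> : 5%:R / 9%:R * m * A `^ 2^-1 = 5%:R / 9%:R * A `^ (- 2^-1) * (A * m).
    have <- : A `^ (- 2^-1) * A = A `^ 2^-1; last by ring.
    by rewrite -[X in _ * X = _](powRr1 A0) -gt0_powRD//; congr powR; field.
  rewrite EFinM; apply: lee_wpmul2l; first by rewrite lee_fin.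
  rewrite /A mulr_suml -sumEFin big_seq [leRHS]big_seq; apply: lee_sum => i si.
  under eq_integral do rewrite EFinM.
  rewrite ge0_integralZl_EFin ?sqr_ge0//; last first.
    by apply/measurable_EFinP; apply: measurableT_comp => //; exact: measurable_funP.
  by rewrite EFinM; apply: lee_wpmul2l; [rewrite lee_fin sqr_ge0|exact/mX/sD].
have {}L : ((5%:R / 9%:R * m * A `^ 2^-1)%:E <= 2%:E * \int[P]_x `|wsum X a s x|%:E)%E.
  apply: (le_trans L); apply: le_trans S; apply: ge0_le_integral => //.
  - move=> x _; rewrite lee_fin mulr_ge0//; apply: sumr_ge0 => i _.
    by rewrite mulr_ge0 ?sqr_ge0.
  - by apply/measurable_EFinP; apply: measurable_funM => //; exact: measurable_sum.
  - by apply/measurable_EFinP; exact: measurable_sign_mean.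
  - by move=> x _; rewrite lee_fin.
have h0 : (0 <= 2^-1%:E :> \bar R)%E by rewrite lee_fin invr_ge0.
have := lee_wpmul2l h0 L; rewrite muleA -!EFinM mulVf// mul1e; apply: le_trans.
rewrite lee_fin le_eqVlt; apply/orP; left; apply/eqP; by field.
Qed.

End independent_sum_lower.

(** * Words and the cascade martingale *)

Section words.
Variable b : nat.

(** Letters are appended at the end, so that a sum over the next level splits into parents and
    children. *)
Fixpoint words n : seq (seq 'I_b) :=
  if n is m.+1 then [seq rcons u i | u <- words m, i <- enum 'I_b] else [:: [::]].

Lemma mem_words n u : (u \in words n) = (size u == n).
Proof.
elim: n u => [|n IH] u; first by rewrite inE; case: u.
apply/allpairsP/idP => [[[v i] /= [+ _ ->]]|].
  by rewrite IH size_rcons => /eqP ->.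
case/lastP: u => // v i; rewrite size_rcons eqSS => /eqP sv.
by exists (v, i); split => //=; rewrite ?IH ?sv ?mem_enum.
Qed.

Lemma size_words n u : u \in words n -> size u = n.
Proof. by rewrite mem_words => /eqP. Qed.

Lemma uniq_words n : uniq (words n).
Proof.
elim: n => // n IH; apply: allpairs_uniq => //; first exact: enum_uniq.
by move=> [u i] [v j] _ _ /= /rcons_inj[-> ->].
Qed.

Lemma big_words_recr (R : nmodType) n (F : seq 'I_b -> R) :
  \sum_(u <- words n.+1) F u = \sum_(u <- words n) \sum_(i < b) F (rcons u i).
Proof.
rewrite /= big_allpairs_dep; apply: eq_bigr => u _.
by rewrite big_enum.
Qed.

Lemma big_tuple_words (R : nmodType) n (F : seq 'I_b -> R) :
  \sum_(u : n.-tuple 'I_b) F u = \sum_(u <- words n) F u.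
Proof.
rewrite -(big_map (@tval n 'I_b) xpredT F).
apply: perm_big; apply: uniq_perm.
- rewrite map_inj_uniq ?index_enum_uniq//; exact: val_inj.
- exact: uniq_words.
- move=> u; rewrite mem_words; apply/mapP/idP => [[t _ ->]|su].
    by rewrite size_tuple.
  by exists (Tuple su); rewrite ?mem_index_enum.
Qed.

End words.

Section cascade_martingale.
Context {R : realType} {d : measure_display} {T : measurableType d}.
Context {P : probability T R} {b : nat}.
Variable X : seq 'I_b -> {RV P >-> R}.

(* weights are written [1 + X u] with [X u] centered *)
Definition cprod (u : seq 'I_b) (x : T) : R :=
  \prod_(1 <= j < (size u).+1) (1 + X (take j u) x).

Definition mart (c : seq 'I_b -> R) n (x : T) : R :=
  \sum_(u <- words b n) cprod u x * c u.

Definition mart_coef (c : seq 'I_b -> R) n (x : T) (u : seq 'I_b) : R :=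
  cprod (take n u) x * c u.

(** The outcome is split: [x] carries the first [n] levels and [y] the next one, so that [x] can be
    frozen. The actual difference is the diagonal [x = y]. *)
Definition mart_diff (c : seq 'I_b -> R) n (x y : T) : R :=
  wsum X (mart_coef c n x) (words b n.+1) y.

(** The square martingale before normalization, see [square_martingaleE]. *)
Definition energy n (x : T) : R := \sum_(u <- words b n) cprod u x ^+ 2.

Definition additive_on_words (c : seq 'I_b -> R) :=
  forall u, c u = \sum_(i < b) c (rcons u i).

Lemma cprod_rcons u i x : cprod (rcons u i) x = cprod u x * (1 + X (rcons u i) x).
Proof.
rewrite /cprod size_rcons big_nat_recr//= (_ : take _ _ = rcons u i); last first.
  by rewrite take_oversize// size_rcons.
congr (_ * _); rewrite big_nat [RHS]big_nat; apply: eq_bigr => j /andP[_ jn].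
by rewrite -cats1 takel_cat.
Qed.

Lemma mart0 c x : mart c 0 x = c [::].
Proof. by rewrite /mart /= big_seq1 /cprod big_geq// mul1r. Qed.

Lemma take_words_rcons n (u : seq 'I_b) i : u \in words b n -> take n (rcons u i) = u.
Proof. by move=> /size_words <-; rewrite -cats1 take_size_cat. Qed.

Lemma martS c n x : additive_on_words c ->
  mart c n.+1 x = mart c n x + mart_diff c n x x.
Proof.
move=> addc; rewrite /mart /mart_diff /wsum !big_words_recr -big_split/=.
rewrite big_seq [RHS]big_seq; apply: eq_bigr => u un.
rewrite (addc u) mulr_sumr -big_split/=; apply: eq_bigr => i _.
rewrite cprod_rcons /mart_coef take_words_rcons//; ring.
Qed.

(** [f] will be the square or a power of the absolute value; [g] accounts for the size of a
    coefficient and [b] counts the children of a word. *)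
Lemma sum_mart_coef (f : R -> R) c n x (g : R) :
  (forall u, u \in words b n.+1 -> forall t, f (t * c u) <= g * f t) ->
  \sum_(u <- words b n.+1) f (mart_coef c n x u) <=
  b%:R * g * \sum_(u <- words b n) f (cprod u x).
Proof.
move=> H; rewrite big_words_recr mulr_sumr big_seq [leRHS]big_seq.
apply: ler_sum => u un.
apply: (@le_trans _ _ (\sum_(i < b) g * f (cprod u x))).
  apply: ler_sum => i _; rewrite /mart_coef take_words_rcons//.
  by apply: H; rewrite mem_words size_rcons (size_words un).
by rewrite sumr_const card_ord -[X in X <= _]mulr_natl mulrA.
Qed.

(** The root is left out because independence is only given for nonempty words. *)
Definition below n := [set u : seq 'I_b | (0 < size u <= n)%N].
Definition level n := [set u : seq 'I_b | size u = n.+1].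

Local Notation T1 n := (sigma_of X (below n)).
Local Notation T2 n := (sigma_of X (level n)).

Lemma measurable_sum_mem (I : eqType) (s : seq I) d1 (S : measurableType d1)
    (f : I -> S -> R) :
  (forall i, i \in s -> measurable_fun setT (f i)) ->
  measurable_fun setT (fun x => \sum_(i <- s) f i x).
Proof.
move=> mf; rewrite (_ : (fun x => _) =
    fun x => \sum_(i <- s) if i \in s then f i x else 0).
  apply: measurable_sum => i; have [/mf//|_] := boolP (i \in s).
  exact: measurable_cst.
by apply/funext => x; rewrite big_seq [RHS]big_seq; apply: eq_bigr => i ->.
Qed.

Lemma measurable_prod_mem (I : eqType) (s : seq I) d1 (S : measurableType d1)
    (f : I -> S -> R) :
  (forall i, i \in s -> measurable_fun setT (f i)) ->
  measurable_fun setT (fun x => \prod_(i <- s) f i x).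
Proof.
elim: s => [|i s IH] mf.
  by under eq_fun do rewrite big_nil; exact: measurable_cst.
under eq_fun do rewrite big_cons; apply: measurable_funM.
  by apply: mf; rewrite inE eqxx.
by apply: IH => j js; apply: mf; rewrite inE js orbT.
Qed.

Lemma measurable_cprod_sigma n u : (size u <= n)%N ->
  measurable_fun setT (cprod u : T1 n -> R).
Proof.
move=> un; apply: measurable_prod_mem => j; rewrite mem_index_iota => /andP[j0 ju].
apply: measurable_funD; first exact: measurable_cst.
apply: (measurable_sigma_of (X := X)); rewrite /below /= size_take_min.
move: j0 ju un; rewrite /minn; case: ifP; lia.
Qed.

Lemma measurable_cprod u : measurable_fun setT (cprod u).
Proof. exact (measurable_sigma_ofW (X := X) (E := below (size u)) (measurable_cprod_sigma (leqnn (size u)))). Qed.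

Lemma measurable_mart_sigma c n : measurable_fun setT (mart c n : T1 n -> R).
Proof.
apply: measurable_sum_mem => u un; apply: measurable_funM; last exact: measurable_cst.
by apply: measurable_cprod_sigma; rewrite (size_words un).
Qed.

Lemma measurable_mart c n : measurable_fun setT (mart c n).
Proof. exact (measurable_sigma_ofW (X := X) (E := below n) (@measurable_mart_sigma c n)). Qed.

Lemma measurable_energy n : measurable_fun setT (energy n).
Proof.
by apply: measurable_sum => u; apply: measurable_funX; exact: measurable_cprod.
Qed.

Lemma measurable_mart_coef_sigma c n u :
  measurable_fun setT ((mart_coef c n)^~ u : T1 n -> R).
Proof.
apply: measurable_funM; last exact: measurable_cst.
by apply: measurable_cprod_sigma; rewrite size_take_min geq_minl.
Qed.

Lemma measurable_mart_coef c n u : measurable_fun setT ((mart_coef c n)^~ u).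
Proof. exact (measurable_sigma_ofW (X := X) (E := below n) (@measurable_mart_coef_sigma c n u)). Qed.

Lemma measurable_mart_diff_sigma c n :
  measurable_fun setT (fun z : T1 n * T2 n => mart_diff c n z.1 z.2).
Proof.
apply: measurable_sum_mem => u un; apply: measurable_funM.
  exact (measurable_fst_sigma (X := X) (E2 := level n) (@measurable_mart_coef_sigma c n u)).
exact (measurable_snd_sigma (X := X) (E1 := below n)
  (measurable_sigma_of (X := X) (E := level n) (size_words un))).
Qed.

Lemma measurable_mart_diff2 c n x : measurable_fun setT (mart_diff c n x).
Proof. exact: measurable_wsum. Qed.

Lemma measurable_mart_diff c n : measurable_fun setT (fun x => mart_diff c n x x).
Proof.
apply: measurable_sum => u; apply: measurable_funM; last exact: measurable_funP.
exact: measurable_mart_coef.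
Qed.

End cascade_martingale.

(** * Moments of the martingale and of its limit *)

Section cascade_moments.
Context {R : realType} {d : measure_display} {T : measurableType d}.
Context {P : probability T R} {b : nat}.
Variable X : seq 'I_b -> {RV P >-> R}.
Let D : set (seq 'I_b) := [set u | u != [::]].
Hypothesis indX : mutually_independent D X.
Hypothesis intX : forall u, D u -> P.-integrable setT (EFin \o X u).
Hypothesis centX : forall u, D u -> (\int[P]_x (X u x)%:E = 0)%E.

Local Notation T1 n := (sigma_of X (@below b n)).
Local Notation T2 n := (sigma_of X (@level b n)).

Let belowD n : below n `<=` D.
Proof. by move=> u /= /andP[u0 _]; case: u u0. Qed.

Let levelD n : level n `<=` D.
Proof. by move=> u /=; rewrite /level /D /=; case: u. Qed.

Let below_level n : @below b n `&` level n = set0.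
Proof.
by apply/seteqP; split => // u [/= /andP[_ un] su]; move: un; rewrite su ltnn.
Qed.

Let wordsD n u : u \in words b n.+1 -> D u.
Proof. by move=> /size_words su; apply: (@levelD n). Qed.

Lemma level_le n (F : T -> T -> R) (G : T -> R) :
  measurable_fun setT (fun z : T1 n * T2 n => F z.1 z.2) ->
  (forall x y, 0 <= F x y) -> measurable_fun setT G ->
  (forall x, \int[P]_y (F x y)%:E <= (G x)%:E)%E ->
  (\int[P]_x (F x x)%:E <= \int[P]_x (G x)%:E)%E.
Proof.
move=> mF F0 mG FG.
apply: (@decouple_le _ _ _ _ _ D X indX (below n) (level n) (@belowD n)
  (@levelD n) (below_level n) (fun z => (F z.1 z.2)%:E)).
- exact/measurable_EFinP.
- by move=> z; rewrite lee_fin.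
- exact/measurable_EFinP.
- by move=> x; exact (FG x).
Qed.

Lemma level_ge n (F : T -> T -> R) (G : T -> R) :
  measurable_fun setT (fun z : T1 n * T2 n => F z.1 z.2) ->
  (forall x y, 0 <= F x y) -> measurable_fun setT G -> (forall x, 0 <= G x) ->
  (forall x, (G x)%:E <= \int[P]_y (F x y)%:E)%E ->
  (\int[P]_x (G x)%:E <= \int[P]_x (F x x)%:E)%E.
Proof.
move=> mF F0 mG G0 FG.
apply: (@decouple_ge _ _ _ _ _ D X indX (below n) (level n) (@belowD n)
  (@levelD n) (below_level n) (fun z => (F z.1 z.2)%:E)).
- exact/measurable_EFinP.
- by move=> z; rewrite lee_fin.
- exact/measurable_EFinP.
- by move=> x; rewrite lee_fin.
- by move=> x; exact (FG x).
Qed.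

Lemma integrable_mart_diff c n x : P.-integrable setT (EFin \o mart_diff X c n x).
Proof. by apply: (integrable_wsum intX) => u; exact: wordsD. Qed.

Lemma integral_mart_diff c n x : (\int[P]_y (mart_diff X c n x y)%:E = 0)%E.
Proof. by apply: (integral_wsum intX centX) => u; exact: wordsD. Qed.

Lemma measurable_mart_fst c n :
  measurable_fun setT (fun z : T1 n * T2 n => mart X c n z.1).
Proof.
exact (measurable_fst_sigma (X := X) (E2 := level n) (@measurable_mart_sigma _ _ _ _ _ X c n)).
Qed.

(** [g] selects subgradients of the convex function [phi]; given the first [n] levels the linear
    term has mean zero. *)
Lemma mart_jensen c n (phi g : R -> R) : additive_on_words c ->
  measurable_fun setT phi -> (forall u, 0 <= phi u) ->
  (forall u v, phi u + g u * v <= phi (u + v)) ->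
  (\int[P]_x (phi (mart X c n x))%:E <= \int[P]_x (phi (mart X c n.+1 x))%:E)%E.
Proof.
move=> addc mphi phi0 phig.
under [leRHS]eq_integral do rewrite martS//.
apply: (@level_ge n (fun x y => phi (mart X c n x + mart_diff X c n x y))) => //.
- apply: measurableT_comp mphi _; apply: measurable_funD.
    exact: measurable_mart_fst.
  exact: measurable_mart_diff_sigma.
- by apply: measurableT_comp mphi _; exact: measurable_mart.
- move=> x; set k := g (mart X c n x).
  apply: (@integral_ge_centered _ _ _ P _ (fun y => k * mart_diff X c n x y)) => //.
  + apply: measurableT_comp mphi _; apply: measurable_funD => //.
    exact: measurable_mart_diff2.
  + have -> : EFin \o (fun y => k * mart_diff X c n x y) =
      (fun y => k%:E * (EFin \o mart_diff X c n x) y)%E by apply/funext => y /=.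
    by apply: integrableZl => //; exact: integrable_mart_diff.
  + under eq_integral do rewrite EFinM.
    rewrite integralZl//; last exact: integrable_mart_diff.
    by rewrite integral_mart_diff mule0.
Qed.

Lemma integral_tpow_mart_le c M p n m : additive_on_words c -> 1 <= p -> 0 <= M ->
  (n <= m)%N ->
  (\int[P]_x (tpow M p (mart X c n x))%:E <= \int[P]_x (tpow M p (mart X c m x))%:E)%E.
Proof.
move=> addc p1 M0 nm; rewrite -(subnKC nm); elim: (m - n)%N => [|k IH].
  by rewrite addn0.
apply: (le_trans IH); rewrite addnS.
apply: (@mart_jensen c (n + k) (tpow M p) (tpow_slope M p)) => //.
- by apply: continuous_measurable_fun; exact: continuous_tpow.
- by move=> u; apply: tpow_ge0 => //; lra.
- by move=> u v; have := tpow_ge_tangent u (u + v) p1 M0; rewrite [u + v - u]addrAC subrr add0r.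
Qed.

Lemma integral_powR_mart_le c (p : R) n : additive_on_words c -> 1 <= p ->
  (\int[P]_x (`|mart X c n x| `^ p)%:E <= \int[P]_x (`|mart X c n.+1 x| `^ p)%:E)%E.
Proof.
move=> addc p1.
(* Truncation at the base point itself: the slope of [tpow] at [u] with level the modulus of [u] is
   the subgradient of the full power. *)
apply: (@mart_jensen c n (fun u => `|u| `^ p) (fun u => tpow_slope `|u| p u)) => //.
- by apply: measurable_norm_powR; exact: measurable_id.
- move=> u v; have := tpow_ge_tangent u (u + v) p1 (normr_ge0 u).
  rewrite tpow_id// [u + v - u]addrAC subrr add0r => /le_trans; apply.
  exact: tpow_le_powR.
Qed.

(** The difference is that of two consecutive terms, and the moment of the earlier one is at most
    that of the later one; hence twice [2 ^ p]. *)
Lemma integral_mart_diff_powR_le c (p : R) n : additive_on_words c -> 1 <= p ->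
  (\int[P]_x (`|mart_diff X c n x x| `^ p)%:E <=
   (2 `^ (p + 1))%:E * \int[P]_x (`|mart X c n.+1 x| `^ p)%:E)%E.
Proof.
move=> addc p1; have p0 : 0 <= p by lra.
have mm k : measurable_fun setT (fun x => (`|mart X c k x| `^ p)%:E).
  by apply/measurable_EFinP; apply: measurable_norm_powR; exact: measurable_mart.
apply: (@le_trans _ _ (\int[P]_x ((2 `^ p)%:E * ((`|mart X c n.+1 x| `^ p)%:E + (`|mart X c n x| `^ p)%:E)))%E).
  apply: ge0_le_integral => //.
  - by apply/measurable_EFinP; apply: measurable_norm_powR; exact: measurable_mart_diff.
  - by apply: emeasurable_funM => //; exact: emeasurable_funD.
  - move=> x _; rewrite -EFinD -EFinM lee_fin.
    apply: le_trans (ler_powRD_max _ _ _) => //.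
    have -> : mart_diff X c n x x = mart X c n.+1 x - mart X c n x.
      by rewrite martS// addrAC subrr add0r.
    by rewrite ge0_ler_powR ?nnegrE ?addr_ge0// ler_normB.
rewrite ge0_integralZl_EFin//; last 2 first.
- by move=> x _; rewrite -EFinD lee_fin addr_ge0.
- exact: emeasurable_funD.
rewrite ge0_integralD//.
rewrite gt0_powRD// powRr1// EFinM -muleA; apply: lee_wpmul2l.
  by rewrite lee_fin powR_ge0.
have I0 : (0 <= \int[P]_x (`|mart X c n.+1 x| `^ p)%:E)%E.
  by apply: integral_ge0 => x _; rewrite lee_fin powR_ge0.
have -> : (2%:E * \int[P]_x (`|mart X c n.+1 x| `^ p)%:E =
   \int[P]_x (`|mart X c n.+1 x| `^ p)%:E + \int[P]_x (`|mart X c n.+1 x| `^ p)%:E)%E.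
  by rewrite -[2%R]/(1 + 1)%R EFinD ge0_muleDl ?mul1e// lee_fin.
by apply: leeD; [exact: lexx|exact: integral_powR_mart_le].
Qed.

(** With the first levels frozen, the lower bound for the first moment of an independent sum is
    raised to the power [p] by Jensen. *)
Lemma integral_mart_diff_powR_ge c (p m : R) n : 1 <= p -> 0 <= m ->
  (forall u, D u -> m%:E <= \int[P]_x `|X u x|%:E)%E ->
  (\int[P]_x ((5%:R / 18%:R * m *
      (\sum_(u <- words b n.+1) mart_coef X c n x u ^+ 2) `^ 2^-1) `^ p)%:E
   <= \int[P]_x (`|mart_diff X c n x x| `^ p)%:E)%E.
Proof.
move=> p1 m0 mX.
have B0 x : 0 <= 5%:R / 18%:R * m *
      (\sum_(u <- words b n.+1) mart_coef X c n x u ^+ 2) `^ 2^-1.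
  by rewrite mulr_ge0 ?powR_ge0// mulr_ge0// divr_ge0.
apply: (@level_ge n (fun x y => `|mart_diff X c n x y| `^ p)) => //.
- by apply: measurable_norm_powR; exact: measurable_mart_diff_sigma.
- apply: measurableT_comp (measurable_powR p) _; apply: measurable_funM => //.
  apply: measurable_fun_powR; apply: measurable_sum => u.
  by apply: measurable_funX; exact: measurable_mart_coef.
- by move=> x; exact: powR_ge0.
- move=> x; apply: (@powR_le_integral _ _ _ P (fun y => `|mart_diff X c n x y|)) => //.
    by apply: measurableT_comp => //; exact: measurable_mart_diff2.
  apply: (integral_norm_wsum_ge indX intX centX) => //; first exact: uniq_words.
  by move=> u; exact: wordsD.
Qed.

Lemma mart_diff_small_moment (r : R) : 1 <= r -> r <= 2 ->
  exists2 C : R, 0 < C & forall c n m,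
  (forall u, D u -> \int[P]_x (`|X u x| `^ r)%:E <= m%:E)%E ->
  (\int[P]_x (`|mart_diff X c n x x| `^ r)%:E <=
   \int[P]_x (C * m * \sum_(u <- words b n.+1) `|mart_coef X c n x u| `^ r)%:E)%E.
Proof.
move=> r1 r2; have [C C0 H] := integral_wsum_powR_le2 indX intX centX r1 r2.
exists C => // c n m mX.
apply: (@level_le n (fun x y => `|mart_diff X c n x y| `^ r)) => //.
- by apply: measurable_norm_powR; exact: measurable_mart_diff_sigma.
- apply: measurable_funM => //; apply: measurable_sum => u.
  by apply: measurable_norm_powR; exact: measurable_mart_coef.
- by move=> x; apply: H => //; [exact: uniq_words|move=> u; exact: wordsD].
Qed.

Lemma sum_cprod_moment (r w : R) n : 0 <= w ->
  (forall u, D u -> \int[P]_x (`|1 + X u x| `^ r)%:E <= w%:E)%E ->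
  (\int[P]_x (\sum_(u <- words b n) `|cprod X u x| `^ r)%:E <= ((b%:R * w) ^+ n)%:E)%E.
Proof.
move=> w0 wX.
have bw0 : 0 <= b%:R * w by rewrite mulr_ge0.
have mc u : measurable_fun setT (fun x => `|cprod X u x| `^ r).
  by apply: measurable_norm_powR; exact: measurable_cprod.
have mX1 u : measurable_fun setT (fun x => `|1 + X u x| `^ r).
  by apply: measurable_norm_powR; apply: measurable_funD => //; exact: measurable_funP.
elim: n => [|n IH].
  rewrite expr0; under eq_integral do rewrite /= big_seq1 /cprod big_geq// normr1 powR1.
  by rewrite probability_integral_cst.
have E x : \sum_(u <- words b n.+1) `|cprod X u x| `^ r =
   \sum_(u <- words b n.+1) `|cprod X (take n u) x| `^ r * `|1 + X u x| `^ r.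
  rewrite !big_words_recr big_seq [RHS]big_seq; apply: eq_bigr => u un.
  by apply: eq_bigr => i _; rewrite take_words_rcons// cprod_rcons normrM powRM.
under eq_integral do rewrite E.
apply: (@le_trans _ _ (\int[P]_x (b%:R * w * \sum_(u <- words b n) `|cprod X u x| `^ r)%:E)%E).
  apply: (@level_le n (fun x y => \sum_(u <- words b n.+1)
      `|cprod X (take n u) x| `^ r * `|1 + X u y| `^ r)) => //.
  - apply: measurable_sum_mem => u un; apply: measurable_funM.
      apply: measurable_norm_powR.
      apply: (measurable_fst_sigma (X := X) (E2 := level n)).
      by apply: measurable_cprod_sigma; rewrite size_take_min geq_minl.
    apply: measurable_norm_powR; apply: measurable_funD; first exact: measurable_cst.
    exact (measurable_snd_sigma (X := X) (E1 := below n)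
      (measurable_sigma_of (X := X) (E := level n) (size_words un))).
  - by move=> x y; apply: sumr_ge0 => u _; rewrite mulr_ge0.
  - by apply: measurable_funM => //; apply: measurable_sum.
  - move=> x; under eq_integral do rewrite -sumEFin.
    rewrite ge0_integral_sum//; last first.
      by move=> u; apply/measurable_EFinP; exact: measurable_funM.
    apply: (@le_trans _ _ (\sum_(u <- words b n.+1) (`|cprod X (take n u) x| `^ r * w)%:E)%E).
      rewrite big_seq [leRHS]big_seq; apply: lee_sum => u un.
      under eq_integral do rewrite EFinM.
      rewrite ge0_integralZl_EFin//; last exact/measurable_EFinP.
      by rewrite EFinM; apply: lee_wpmul2l; [rewrite lee_fin|exact/wX/wordsD/un].
    rewrite sumEFin lee_fin -mulr_suml big_words_recr.
    rewrite mulrC [_ * w]mulrC -mulrA ler_wpM2l// mulr_sumr.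
    rewrite big_seq [leRHS]big_seq; apply: ler_sum => u un.
    under eq_bigr do rewrite take_words_rcons//.
    by rewrite sumr_const card_ord -[X in X <= _]mulr_natl.
under eq_integral do rewrite EFinM.
rewrite ge0_integralZl_EFin//; last 2 first.
- by move=> x _; rewrite lee_fin; apply: sumr_ge0.
- by apply/measurable_EFinP; apply: measurable_sum.
by rewrite exprS [leRHS]EFinM; apply: lee_wpmul2l; rewrite ?lee_fin.
Qed.

(** With the first [n] levels frozen, the gradient term has mean zero. Since [p <= q], Jensen moves
    the power [p / q] of the remainder outside the integral, after which the Marcinkiewicz-Zygmund
    bound applies to each coordinate separately. *)
Lemma mart_lq_step (p q m : R) (K : Type) (ks : seq K) (c : K -> seq 'I_b -> R)
    (gam : K -> R) n : 1 <= p -> p <= 2 -> 2 <= q -> 0 <= m ->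
  (forall k, additive_on_words (c k)) ->
  (forall u, D u -> \int[P]_x (`|X u x| `^ q)%:E <= m%:E)%E ->
  (forall k u, u \in words b n.+1 -> `|c k u| <= gam k) ->
  (\int[P]_x (lq_pow q ks (fun k => mart X (c k) n.+1 x) `^ (p / q))%:E <=
   \int[P]_x (lq_pow q ks (fun k => mart X (c k) n x) `^ (p / q))%:E +
   (lq_cst p q * (mz_cst q * m * \sum_(k <- ks) gam k `^ q) `^ (p / q))%:E *
   \int[P]_x ((b%:R * energy X n x) `^ (p / 2))%:E)%E.
Proof.
move=> p1 p2 q2 m0 addc mX cgam.
have q0 : 0 < q by lra.
have pq01 : 0 <= p / q <= 1.
  by rewrite divr_ge0 ?ler_pdivrMr ?mul1r//=; lra.
have K0 := ltW (mz_cst_gt0 q2).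
have C0 := lq_cst_ge0 p1 q2.
set G := \sum_(k <- ks) gam k `^ q.
have G0 : 0 <= G by apply: sumr_ge0 => k _; exact: powR_ge0.
have E0 x : 0 <= energy X n x by apply: sumr_ge0 => u _; exact: sqr_ge0.
have mlq d1 (S : measurableType d1) (f : K -> S -> R) :
    (forall k, measurable_fun setT (f k)) ->
    measurable_fun setT (fun x => lq_pow q ks (f^~ x)).
  by move=> mf; apply: measurable_sum => k; exact: measurable_norm_powR.
have mlqp d1 (S : measurableType d1) (f : K -> S -> R) :
    (forall k, measurable_fun setT (f k)) ->
    measurable_fun setT (fun x => lq_pow q ks (f^~ x) `^ (p / q)).
  by move=> mf; apply: measurable_fun_powR; exact: mlq.
have mE : measurable_fun setT (fun x => (b%:R * energy X n x) `^ (p / 2)).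
  apply: measurable_fun_powR; apply: measurable_funM => //.
  exact: measurable_energy.
have B0 : 0 <= mz_cst q * m * G by rewrite !mulr_ge0.
have [A AE A0] : exists2 A, lq_cst p q * (mz_cst q * m * G) `^ (p / q) = A & 0 <= A.
  by eexists; first reflexivity; apply: mulr_ge0 => //; exact: powR_ge0.
rewrite AE.
apply: (@le_trans _ _ (\int[P]_x (lq_pow q ks (fun k => mart X (c k) n x) `^ (p / q)
    + A * (b%:R * energy X n x) `^ (p / 2))%:E)%E); last first.
  under eq_integral do rewrite EFinD EFinM.
  rewrite ge0_integralD//; last 4 first.
  - by move=> x _; rewrite lee_fin powR_ge0.
  - by apply/measurable_EFinP; apply: mlqp => k; exact: measurable_mart.
  - by move=> x _; rewrite -EFinM lee_fin mulr_ge0 ?powR_ge0.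
  - by apply: emeasurable_funM => //; exact/measurable_EFinP.
  rewrite leeD2l// le_eqVlt; apply/orP; left; apply/eqP.
  apply: ge0_integralZl_EFin => //; last exact/measurable_EFinP.
  by move=> x _; rewrite lee_fin powR_ge0.
under eq_integral => x _.
  rewrite (_ : (fun k => mart X (c k) n.+1 x) =
    (fun k => mart X (c k) n x + mart_diff X (c k) n x x)); last first.
    by apply/funext => k; rewrite martS.
  over.
apply: (@level_le n (fun x y => lq_pow q ks
    (fun k => mart X (c k) n x + mart_diff X (c k) n x y) `^ (p / q))) => //.
- apply: (mlqp _ _ (fun k (z : T1 n * T2 n) => mart X (c k) n z.1 + mart_diff X (c k) n z.1 z.2)) => k.
  by apply: measurable_funD; [exact: measurable_mart_fst|exact: measurable_mart_diff_sigma].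
- by move=> x y; exact: powR_ge0.
- apply: measurable_funD; first by apply: mlqp => k; exact: measurable_mart.
  exact: measurable_funM.
move=> x.
pose Y k := mart X (c k) n x; pose Z k y := mart_diff X (c k) n x y.
have mZ k : measurable_fun setT (Z k) by exact: measurable_mart_diff2.
have iZ k : P.-integrable setT (EFin \o Z k) by exact: integrable_mart_diff.
have gE : (fun y => (\sum_(k <- ks) lq_grad p q ks Y k * Z k y)%:E) =
   (fun y => \sum_(k <- ks) ((lq_grad p q ks Y k)%:E * (Z k y)%:E))%E.
  by apply/funext => y; rewrite -sumEFin.
have igk k : P.-integrable setT (fun y => (lq_grad p q ks Y k)%:E * (Z k y)%:E)%E.
  by apply: integrableZl => //; exact: iZ.
apply: (le_trans (@integral_le_centered _ _ _ P _
   (fun y => \sum_(k <- ks) lq_grad p q ks Y k * Z k y)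
   (fun y => lq_cst p q * lq_pow q ks (Z^~ y) `^ (p / q))
   (lq_pow q ks Y `^ (p / q)) _ _ _ _ _ _ _)) => //.
- by apply: (mlqp _ _ (fun k y => Y k + Z k y)) => k; exact: measurable_funD.
- by move=> y; exact: powR_ge0.
- rewrite (_ : EFin \o _ = (fun y => (\sum_(k <- ks) lq_grad p q ks Y k * Z k y)%:E))//.
  by rewrite gE; apply: integrable_sum.
- under eq_integral do rewrite -sumEFin.
  under eq_integral do under eq_bigr do rewrite EFinM.
  rewrite integral_sum//; apply: big1 => k _.
  rewrite integralZl//; last exact: iZ.
  by rewrite [X in (_ * X)%E](integral_mart_diff (c k) n x) mule0.
- by apply: measurable_funM => //; exact: mlqp.
- by move=> y; apply: mulr_ge0 => //; exact: powR_ge0.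
- by move=> y; exact: lq_pow_smooth.
rewrite EFinD; apply: leeD => //.
under eq_integral do rewrite EFinM.
rewrite ge0_integralZl_EFin//; last 2 first.
- by move=> y _; rewrite lee_fin powR_ge0.
- by apply/measurable_EFinP; exact: mlqp.
rewrite -AE -mulrA [leRHS]EFinM; apply: lee_wpmul2l => //.
have -> : (mz_cst q * m * G) `^ (p / q) * (b%:R * energy X n x) `^ (p / 2) =
    (mz_cst q * m * G * (b%:R * energy X n x) `^ (q / 2)) `^ (p / q).
  rewrite [RHS]powRM ?powR_ge0// -[in RHS]powRrM; congr (_ * _ `^ _); field; lra.
apply: integral_powR_le => //.
- exact: mlq.
- by move=> y; exact: lq_pow_ge0.
- by rewrite mulr_ge0 ?powR_ge0.
under eq_integral do rewrite -sumEFin.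
rewrite ge0_integral_sum//; last first.
  by move=> k; apply/measurable_EFinP; exact: measurable_norm_powR.
rewrite /G mulr_sumr mulr_suml -sumEFin; apply: lee_sum => k _.
have := @integral_wsum_powR_ge2 _ _ _ P _ D X indX intX centX q m
  (mart_coef X (c k) n x) (words b n.+1) q2 m0 (uniq_words b n.+1) (@wordsD n) mX.
move=> /le_trans; apply; rewrite lee_fin -[leRHS]mulrA ler_wpM2l ?mulr_ge0//.
(* On an empty level the hypothesis on [gam] would not even force [gam k] to be nonnegative. *)
have [/eqP|[u un]] : words b n.+1 = [::] \/ exists u, u \in words b n.+1.
  by case: (words b n.+1) => [|u l]; [left|right; exists u; rewrite inE eqxx].
  move=> /eqP ->; rewrite big_nil powR0; first by rewrite mulr_ge0 ?powR_ge0.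
  by rewrite mulf_neq0 ?gt_eqF ?invr_eq0.
have g0 : 0 <= gam k by apply: le_trans (cgam k u un).
have -> : gam k `^ q = (gam k ^+ 2) `^ (q / 2).
  rewrite -powR_mulrn// -powRrM; congr powR; by field.
rewrite -powRM ?sqr_ge0// ?mulr_ge0//.
rewrite ge0_ler_powR ?nnegrE ?mulr_ge0 ?sqr_ge0//.
- exact: ltW.
- by apply: sumr_ge0 => v _; exact: sqr_ge0.
rewrite mulrA [_ ^+ 2 * _]mulrC.
apply: (@sum_mart_coef _ _ _ _ _ X (fun t => t ^+ 2)) => v vn t.
rewrite exprMn mulrC ler_wpM2r ?sqr_ge0//.
by rewrite -real_normK ?num_real// ler_pXn2r ?nnegrE// cgam.
Qed.

Variables (c : seq 'I_b -> R) (r w m : R).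
Hypothesis b0 : (0 < b)%N.
Hypothesis addc : additive_on_words c.
Hypothesis c_le : forall u, `|c u| <= b%:R ^- size u.
Hypothesis r1 : 1 < r.
Hypothesis r2 : r <= 2.
Hypothesis w0 : 0 <= w.
Hypothesis wb : w < b%:R `^ (r - 1).
Hypothesis EXw : forall u, D u -> (\int[P]_x (`|1 + X u x| `^ r)%:E <= w%:E)%E.
Hypothesis m0 : 0 <= m.
Hypothesis EXm : forall u, D u -> (\int[P]_x (`|X u x| `^ r)%:E <= m%:E)%E.

Let bp : 0 < b%:R :> R.
Proof. by rewrite ltr0n. Qed.

Lemma integral_mart_diff_geometric : exists A rho : R, [/\ 0 <= A, 0 <= rho, rho < 1 &
  forall n, (\int[P]_x `|mart_diff X c n x x|%:E <= (A * rho ^+ n)%:E)%E].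
Proof.
have [C C0 H] := mart_diff_small_moment (ltW r1) r2.
set beta : R := b%:R^-1 `^ r.
have beta0 : 0 <= beta by exact: powR_ge0.
(* Passing to the next level multiplies the number of words by [b], the coefficients to the power
   [r] by [beta], and the moment of the products by [w]. The product [rho] is [w] times [b] to the
   power [1 - r], less than 1 by [wb]. *)
pose A := C * m * b%:R * beta; pose rho := beta * b%:R * w.
have A0 : 0 <= A by rewrite !mulr_ge0 ?(ltW C0).
have rho0 : 0 <= rho by rewrite !mulr_ge0.
have rho1 : rho < 1.
  have h : beta * b%:R = b%:R `^ (1 - r).
    rewrite /beta -[b%:R^-1]powR_inv1 ?(ltW bp)// -powRrM mulN1r.
    by rewrite -[X in _ * X]powRr1 ?(ltW bp)// -gt0_powRD// addrC.
  rewrite /rho h -(ltr_pM2r (powR_gt0 (r - 1) bp)) mul1r mulrAC -gt0_powRD//.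
  by rewrite -opprB addNr powRr0 mul1r.
have rp : 0 < r := lt_trans ltr01 r1.
have rV : 0 <= r^-1 <= 1 by rewrite invr_ge0 (ltW rp) invf_le1// ltW.
exists (A `^ r^-1), (rho `^ r^-1); split; rewrite ?powR_ge0//.
  have h1 : 1 `^ r^-1 = 1 :> R by rewrite powR1.
  by rewrite -[ltRHS]h1 gt0_ltr_powR ?nnegrE// invr_gt0.
move=> n; have mD := measurable_mart_diff X c n.
have e x : `|mart_diff X c n x x| = (`|mart_diff X c n x x| `^ r) `^ r^-1.
  by rewrite -powRrM divff ?powRr1// gt_eqF.
under eq_integral do rewrite e.
rewrite -powR_exprn// -powRM ?exprn_ge0//.
apply: integral_powR_le; rewrite ?mulr_ge0 ?exprn_ge0 ?(ltW C0)//.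
  exact: measurable_norm_powR.
apply: (le_trans (H c n m EXm)).
set g : R := (b%:R ^- n.+1) `^ r.
have g0 : 0 <= g by exact: powR_ge0.
have Cm0 : 0 <= C * m by rewrite mulr_ge0// ltW.
apply: (@le_trans _ _ (\int[P]_x ((C * m * (b%:R * g))%:E * (\sum_(u <- words b n) `|cprod X u x| `^ r)%:E))%E).
  apply: ge0_le_integral => //.
  - by move=> x _; rewrite lee_fin; apply: mulr_ge0 => //; apply: sumr_ge0 => u _.
  - apply/measurable_EFinP; apply: measurable_funM => //; apply: measurable_sum => u.
    by apply: measurable_norm_powR; exact: measurable_mart_coef.
  - apply: emeasurable_funM => //; apply/measurable_EFinP; apply: measurable_sum => u.
    by apply: measurable_norm_powR; exact: measurable_cprod.
  - move=> x _; rewrite -EFinM lee_fin -[leRHS]mulrA; apply: ler_wpM2l => //.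
    apply: (@sum_mart_coef _ _ _ _ _ X (fun t => `|t| `^ r)) => u un t.
    rewrite normrM powRM// [leRHS]mulrC; apply: ler_wpM2l => //.
    apply: ge0_ler_powR; rewrite ?nnegrE ?(ltW rp)//.
    by have := c_le u; rewrite (size_words un).
rewrite ge0_integralZl_EFin//; last 3 first.
- by move=> x _; rewrite lee_fin; apply: sumr_ge0 => u _.
- apply/measurable_EFinP; apply: measurable_sum => u.
  by apply: measurable_norm_powR; exact: measurable_cprod.
- by rewrite mulr_ge0// mulr_ge0.
have Cmg : (0 <= (C * m * (b%:R * g))%:E)%E by rewrite lee_fin mulr_ge0// mulr_ge0.
apply: (le_trans (lee_wpmul2l Cmg (sum_cprod_moment n w0 EXw))).
rewrite -EFinM lee_fin le_eqVlt; apply/orP; left; apply/eqP.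
have -> : g = beta ^+ n.+1.
  by rewrite /g -exprVn powR_exprn// invr_ge0 ltW.
by rewrite /A /rho !exprMn exprS; ring.
Qed.

(** The dominating function is the sum of the absolute values of all differences, integrable by
    their geometric decay; it replaces a maximal inequality. *)
Lemma mart_dominated : exists2 G : T -> \bar R, P.-integrable setT G &
  forall n x, (`|mart X c n x|%:E <= G x)%E.
Proof.
have [A [rho [A0 rho0 rho1 H]]] := integral_mart_diff_geometric.
pose S x : \bar R := (\sum_(0 <= n <oo) `|mart_diff X c n x x|%:E)%E.
have mD n : measurable_fun setT (fun x => `|mart_diff X c n x x|%:E).
  by apply/measurable_EFinP; apply: measurableT_comp => //; exact: measurable_mart_diff.
have S0 x : (0 <= S x)%E by apply: nneseries_ge0.
have mS : measurable_fun setT S.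
  by apply: ge0_emeasurable_sum => //.
have iS : P.-integrable setT S.
  apply/integrableP; split => //.
  under eq_integral => x _ do rewrite gee0_abs//.
  rewrite integral_nneseries//.
  apply: (@le_lt_trans _ _ (A * (1 - rho)^-1)%:E); last exact: ltry.
  apply: lime_le; first by apply: is_cvg_nneseries => n _ _; exact: integral_ge0.
  apply: nearW => n; apply: (@le_trans _ _ (\sum_(0 <= i < n) (A * rho ^+ i)%:E)%E).
    by apply: lee_sum => i _; exact: H.
  by rewrite sumEFin lee_fin -mulr_sumr ler_wpM2l// sum_exprn_le.
exists (fun x => (`|c [::]|%:E + S x)%E).
  by apply: integrableD => //; exact: finite_measure_integrable_cst.
move=> n x; apply: (@le_trans _ _ (`|c [::]|%:E + \sum_(0 <= i < n) `|mart_diff X c i x x|%:E)%E).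
  rewrite sumEFin lee_fin; elim: n => [|n IH].
    by rewrite mart0 big_geq// addr0.
  rewrite martS// big_nat_recr//= addrA (le_trans (ler_normD _ _))// lerD2r.
  exact: IH.
by apply: leeD2l => //; exact: nneseries_lim_ge.
Qed.

(* The truncated powers have linear growth, so that dominated convergence applies
   to them; the truncation level is then sent to infinity. *)
Lemma integral_powR_limit_ge (p : R) (f : T -> R) n : 1 <= p -> measurable_fun setT f ->
  {ae P, forall x, mart X c k x @[k --> \oo] --> f x} ->
  (\int[P]_x (`|mart X c n x| `^ p)%:E <= \int[P]_x (`|f x| `^ p)%:E)%E.
Proof.
move=> p1 mf cvf; have [G iG domG] := mart_dominated.
have mt M : 0 <= M -> measurable_fun setT (tpow M p : R -> R).
  by move=> M0; apply: continuous_measurable_fun; exact: continuous_tpow.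
have mY k : measurable_fun setT (mart X c k) by exact: measurable_mart.
have p0 : 0 < p by lra.
have HM M : 0 <= M -> (\int[P]_x (tpow M p (mart X c n x))%:E <= \int[P]_x (`|f x| `^ p)%:E)%E.
  move=> M0; have t0 : tpow M p (0 : R) = 0.
    by rewrite tpow_id normr0// powR0 ?gt_eqF.
  have K0 : 0 <= p * M `^ (p - 1) by rewrite mulr_ge0 ?powR_ge0// ltW.
  have mtY k : measurable_fun setT (fun x => (tpow M p (mart X c k x))%:E).
    by apply/measurable_EFinP; exact: measurableT_comp (mt M M0) (mY k).
  have [||||_ _ cv] := @dominated_convergence _ T R P setT measurableT
     (fun k x => (tpow M p (mart X c k x))%:E) (fun x => (tpow M p (f x))%:E)
     (fun x => (p * M `^ (p - 1))%:E * G x)%E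
     mtY.
  - by apply/measurable_EFinP; exact: measurableT_comp (mt M M0) mf.
  - apply: filterS cvf => x cvx _; apply: cvg_EFin; first exact: nearW.
    exact: (continuous_cvg _ (@continuous_tpow R M p p1 M0 _) cvx).
  - exact: integrableZl.
  - apply: aeW => x k _; rewrite abse_EFin.
    apply: (@le_trans _ _ (p * M `^ (p - 1) * `|mart X c k x|)%:E).
      have := tpow_lipschitz (mart X c k x) 0 p1 M0.
      by rewrite t0 !subr0 lee_fin.
    by rewrite EFinM; apply: lee_wpmul2l; rewrite ?lee_fin.
  apply: (@le_trans _ _ (\int[P]_x (tpow M p (f x))%:E)%E).
    apply: (cvge_ge _ cv); exists n => // k /= nk.
    exact: integral_tpow_mart_le.
  apply: ge0_le_integral => //.
  - by move=> x _; rewrite lee_fin tpow_ge0// ltW.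
  - by apply/measurable_EFinP; exact: measurableT_comp (mt M M0) mf.
  - by apply/measurable_EFinP; exact: measurable_norm_powR.
  - by move=> x _; rewrite lee_fin tpow_le_powR.
have cv x : (tpow k%:R p (mart X c n x))%:E @[k --> \oo] --> (`|mart X c n x| `^ p)%:E.
  apply: cvg_EFin; first exact: nearW.
  apply: cvg_near_cst; exists (Num.truncn `|mart X c n x|).+1 => // k /= nk.
  apply/esym/eqP; rewrite tpow_id//.
  by apply: ltW; apply: (lt_le_trans (truncnS_gt _)); rewrite ler_nat.
have -> : (\int[P]_x (`|mart X c n x| `^ p)%:E =
    \int[P]_x (limn (fun k => (tpow k%:R p (mart X c n x))%:E)))%E.
  by apply: eq_integral => x _; apply/esym/cvg_lim => //; exact: cv.
have mk k : measurable_fun setT (fun x => (tpow k%:R p (mart X c n x))%:E).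
  by apply/measurable_EFinP; exact: measurableT_comp (mt k%:R (ler0n _ _)) (mY n).
have cvI := @cvg_monotone_convergence _ T R P setT measurableT _ mk.
apply: (cvge_le _ (cvI _ _)).
- by apply: nearW => k; exact: HM.
- by move=> k x _; rewrite lee_fin tpow_ge0// ltW.
- by move=> x _ k l kl; rewrite lee_fin tpow_mono// ler_nat.
Qed.

End cascade_moments.

(** * Coefficients of intervals and trigonometric functions *)

Section word_coefficients.
Context {R : realType} {b : nat}.
Hypothesis b0 : (0 < b)%N.
Implicit Types (u : seq 'I_b) (F f : R -> R).

Lemma word_left_nil : word_left ([::] : seq 'I_b) = 0 :> R.
Proof. by rewrite /word_left big_ord0. Qed.

Lemma word_left_rcons u i :
  word_left (rcons u i) = word_left u + i%:R * b%:R ^- (size u).+1 :> R.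
Proof.
rewrite /word_left map_rcons size_rcons big_ord_recr/=; congr (_ + _).
  by apply: eq_bigr => k _; rewrite nth_rcons size_map ltn_ord.
by rewrite nth_rcons size_map ltnn eqxx.
Qed.

Definition wcoef F u : R := F (word_left u + b%:R ^- size u) - F (word_left u).

Lemma wcoef_additive F : additive_on_words (wcoef F : seq 'I_b -> R).
Proof.
move=> u; set h : R := b%:R ^- (size u).+1; pose G (j : nat) := F (word_left u + j%:R * h).
transitivity (\sum_(0 <= j < b) (G j.+1 - G j)).
  rewrite telescope_sumr// /G mul0r addr0 /wcoef; congr (F (_ + _) - _).
  rewrite /h exprS invfM mulrA divff ?mul1r// pnatr_eq0 -lt0n//.
rewrite big_mkord; apply: eq_bigr => i _.
rewrite /wcoef size_rcons word_left_rcons -/h /G; congr (F _ - _).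
by rewrite -addrA -natr1 mulrDl mul1r.
Qed.

Lemma wcoefD F G u : wcoef (fun t => F t + G t) u = wcoef F u + wcoef G u.
Proof. by rewrite /wcoef; ring. Qed.

Let h0 n : 0 < b%:R ^- n :> R.
Proof. by rewrite invr_gt0 exprn_gt0// ltr0n. Qed.

Lemma norm_wcoef_le F f (B : R) u : (forall x : R, is_derive x (1 : R) F (f x)) ->
  (forall x, `|f x| <= B) -> `|wcoef F u| <= B * b%:R ^- size u.
Proof.
move=> dF fB; rewrite /wcoef; set x := word_left u; set h := b%:R ^- size u.
have xh : x < x + h by rewrite ltrDl; exact: h0.
have [c _ ->] : exists2 c, c \in `]x, x + h[%R & F (x + h) - F x = f c * (x + h - x).
  apply: MVT => //.
  apply: continuous_subspaceT => z; apply: differentiable_continuous.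
  by apply/derivable1_diffP; have [] := dF z.
rewrite addrAC subrr add0r normrM (gtr0_norm (h0 _)).
by rewrite ler_wpM2r// ltW// h0.
Qed.

Lemma integral_word_interval F f u : (forall x : R, is_derive x (1 : R) F (f x)) ->
  continuous f ->
  (\int[lebesgue_measure]_(t in word_interval u) (f t)%:E = (wcoef F u)%:E)%E.
Proof.
move=> dF cf; rewrite /word_interval integral_itv_bndo_bndc; last first.
  apply/measurable_EFinP; apply: measurable_funTS.
  exact: continuous_measurable_fun.
have cF : continuous F.
  move=> z; apply: differentiable_continuous.
  by apply/derivable1_diffP; have [] := dF z.
rewrite (@continuous_FTC2 _ f F)//.
- by rewrite ltrDl; exact: h0.
- exact: continuous_subspaceT.
- split => //.
  + by apply: cvg_at_right_filter; exact: cF.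
  + by apply: cvg_at_left_filter; exact: cF.
- by move=> z _; rewrite derive1E; have [_ ->] := dF z.
Qed.

End word_coefficients.

Section trigonometric_coefficients.
Context {R : realType}.
Implicit Types (x w : R).

(* Real ([e = true]) and imaginary parts of [exp (- 2 i pi k t)], and their
   antiderivatives. *)
Definition trig (e : bool) (k : nat) (t : R) : R :=
  if e then cos (- (2 * pi * k%:R * t)) else sin (- (2 * pi * k%:R * t)).

Definition trig_prim (e : bool) (k : nat) (t : R) : R :=
  (2 * pi * k%:R)^-1 *
    (if e then sin (2 * pi * k%:R * t) else cos (2 * pi * k%:R * t)).

Lemma norm_trig_le e k t : `|trig e k t| <= 1.
Proof. by rewrite /trig; case: e; rewrite ?cos_max ?sin_max. Qed.

Lemma continuous_trig e k : continuous (trig e k).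
Proof.
have cl : continuous (fun t : R => - (2 * pi * k%:R * t)).
  by move=> t; apply: cvgN; apply: cvgMr; exact: cvg_id.
case: e => t; rewrite /trig.
  exact: (continuous_comp (cl t) (@continuous_cos R _)).
exact: (continuous_comp (cl t) (@continuous_sin R _)).
Qed.

Lemma is_derive_trig_prim e k x : (0 < k)%N ->
  is_derive (x : R) (1 : R) (trig_prim e k) (trig e k x).
Proof.
move=> k0; set w : R := 2 * pi * k%:R.
have w0 : w != 0 by rewrite gt_eqF// !mulr_gt0 ?pi_gt0 ?ltr0n.
have dl : is_derive x (1 : R) (fun t => w * t) w.
  have := is_deriveZ w (is_derive_id x (1 : R)).
  by rewrite /GRing.scale/= mulr1.
case: e; rewrite /trig /trig_prim -/w.
  have h1 := is_derive1_comp (is_derive_sin (w * x)) dl.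
  have := is_deriveZ w^-1 h1.
  by rewrite /GRing.scale/= mulrCA mulVf// mulr1 cosN.
have h1 := is_derive1_comp (is_derive_cos (w * x)) dl.
have := is_deriveZ w^-1 h1.
by rewrite /GRing.scale/= mulrCA mulVf// mulr1 sinN.
Qed.

(** Squared modulus of the integral of the exponential over an interval of length [h]. It is
    independent of the position [x], unlike the two parts taken separately. *)
Lemma trig_primE2 k x h : (0 < k)%N ->
  (trig_prim true k (x + h) - trig_prim true k x) ^+ 2
  + (trig_prim false k (x + h) - trig_prim false k x) ^+ 2 =
  2 * (1 - cos (2 * pi * k%:R * h)) / (2 * pi * k%:R) ^+ 2.
Proof.
move=> k0; rewrite /trig_prim; set w : R := 2 * pi * k%:R.
have w0 : w != 0 by rewrite gt_eqF// !mulr_gt0 ?pi_gt0 ?ltr0n.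
rewrite mulrDr sinD cosD.
have e1 := cos2Dsin2 (w * x); have e2 := cos2Dsin2 (w * h).
move: (cos (w * x)) (sin (w * x)) (cos (w * h)) (sin (w * h)) e1 e2.
move=> a s c d e1 e2.
have -> : (w^-1 * (s * c + a * d) - w^-1 * s) ^+ 2 +
  (w^-1 * (a * c - s * d) - w^-1 * a) ^+ 2 =
  ((a ^+ 2 + s ^+ 2) * (c ^+ 2 + d ^+ 2) + (a ^+ 2 + s ^+ 2) - 2 * c * (a ^+ 2 + s ^+ 2)) / w ^+ 2.
  by field.
by rewrite e1 e2; field.
Qed.

Context {b : nat}.
Hypothesis b2 : (2 <= b)%N.
Implicit Types u : seq 'I_b.

Definition fcoef (e : bool) (k : nat) u : R := wcoef (trig_prim e k) u.

Lemma fcoef_additive e k : additive_on_words (fcoef e k : seq 'I_b -> R).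
Proof. by apply: wcoef_additive; exact: ltnW. Qed.

(** Lebesgue measure on the unit interval has no nonzero integer frequency, so all the Fourier
    martingales start at 0. *)
Lemma fcoef_nil e k : fcoef e k [::] = 0.
Proof.
rewrite /fcoef /wcoef word_left_nil expr0 invr1 add0r /trig_prim mulr0 mulr1.
have -> : 2 * pi * k%:R = 0 + (pi *+ 2) *+ k :> R.
  by rewrite add0r -[RHS]mulr_natr -[pi *+ 2]mulr_natl.
case: e; rewrite ?(periodicn (@sinD2pi R)) ?(periodicn (@cosD2pi R));
  by rewrite subrr.
Qed.

Lemma norm_fcoef_le_pow e k u : (0 < k)%N -> `|fcoef e k u| <= b%:R ^- size u.
Proof.
move=> k0; rewrite -[leRHS]mul1r; apply: (norm_wcoef_le (ltnW b2) (f := trig e k)).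
  by move=> x; exact: is_derive_trig_prim.
exact: norm_trig_le.
Qed.

Lemma norm_fcoef_le_inv e k u : (0 < k)%N -> `|fcoef e k u| <= k%:R^-1.
Proof.
move=> k0; have kp : 0 < k%:R :> R by rewrite ltr0n.
have p2 : 2 <= pi :> R by exact: pi_ge2.
have w0 : 0 < 2 * pi * k%:R :> R by rewrite !mulr_gt0 ?pi_gt0.
have H (f : R -> R) x y : (forall z, `|f z| <= 1) ->
    `|(2 * pi * k%:R)^-1 * f x - (2 * pi * k%:R)^-1 * f y| <= k%:R^-1.
  move=> f1; rewrite -mulrBr normrM gtr0_norm ?invr_gt0//.
  apply: (@le_trans _ _ ((2 * pi * k%:R)^-1 * 2)).
    rewrite ler_wpM2l ?invr_ge0 ?(ltW w0)//.
    apply: (le_trans (ler_normB _ _)); have := f1 x; have := f1 y; lra.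
  have -> : (2 * pi * k%:R)^-1 * 2 = pi^-1 * k%:R^-1 :> R.
    by rewrite !invfM; move: (pi^-1) (k%:R^-1) => ? ?; field.
  rewrite ler_piMl ?invr_ge0 ?(ltW kp)// invf_le1 ?pi_gt0//; lra.
rewrite /fcoef /wcoef /trig_prim; case: e.
  by apply: (H (fun t => sin (2 * pi * k%:R * t))) => z; exact: sin_max.
by apply: (H (fun t => cos (2 * pi * k%:R * t))) => z; exact: cos_max.
Qed.

(* On the frequency block [b ^ n <= k <= 3/2 b ^ n] the squared modulus of the
   Fourier coefficient of an interval of length [b ^ -(n+1)] is comparable to
   [b ^ -2(n+1)]. *)
Definition block_cst : R :=
  (1 - Num.max (cos (2 * pi / b%:R)) 0) / (2 * pi ^+ 2).

Lemma block_cst_gt0 : 0 < block_cst.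
Proof.
have bp : 0 < b%:R :> R by rewrite ltr0n (ltnW b2).
have bge : 2 <= b%:R :> R by rewrite ler_nat.
have pp := @pi_gt0 R.
rewrite divr_gt0 ?mulr_gt0 ?exprn_gt0 ?pi_gt0// subr_gt0 gt_max ltr01 andbT.
rewrite -[X in _ < X]cos0 ltr_cos ?in_itv/=.
- by rewrite divr_gt0// mulr_gt0.
- by rewrite lexx ltW.
- apply/andP; split; last by rewrite ler_pdivrMr//; nra.
  by apply: divr_ge0; [apply: mulr_ge0 => //; exact: ltW|exact: ltW].
Qed.

(** The angle [y] lies between [2 pi / b] and [3 pi / b], hence below [3 pi / 2]. Up to [pi] the
    cosine decreases, and from there to [3 pi / 2] it is nonpositive. For [b = 2] it is the cut at
    [3/2] that keeps the angle away from [2 pi]. *)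
Lemma fcoef_block_ge n k u : (b ^ n <= k)%N -> (2 * k <= 3 * b ^ n)%N ->
  size u = n.+1 ->
  block_cst * b%:R ^- (n.+1) ^+ 2 <= fcoef true k u ^+ 2 + fcoef false k u ^+ 2.
Proof.
move=> kn kn3 su; have b0 : (0 < b)%N by exact: ltnW.
have bn0 : (0 < b ^ n)%N by rewrite expn_gt0 b0.
have k0 : (0 < k)%N by exact: leq_trans kn.
rewrite /fcoef /wcoef trig_primE2// su.
have pp := @pi_gt0 R.
have kp : 0 < k%:R :> R by rewrite ltr0n.
have bp : 0 < b%:R :> R by rewrite ltr0n.
have bge : 2 <= b%:R :> R by rewrite ler_nat.
set B : R := b%:R ^+ n; have Bp : 0 < B by exact: exprn_gt0.
have kB : B <= k%:R by rewrite /B -natrX ler_nat.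
have kB3 : 2 * k%:R <= 3%:R * B by rewrite /B -natrX -!natrM ler_nat.
have kb : k%:R <= b%:R * B by nra.
have bS : b%:R ^+ n.+1 = b%:R * B :> R by rewrite exprS.
rewrite bS.
set y := 2 * pi * k%:R * (b%:R * B)^-1.
have bB : 0 < b%:R * B by exact: mulr_gt0.
have y1 : 2 * pi / b%:R <= y.
  rewrite /y -!mulrA; do 2 (apply: ler_wpM2l; first lra).
  by rewrite invfM mulrCA ler_peMr ?invr_ge0 ?(ltW bp)// ler_pdivlMr// mul1r.
have y2 : y <= pi + pi / 2.
  rewrite /y ler_pdivrMr//.
  have -> : pi + pi / 2 = pi * (3%:R / 2) :> R by field.
  have -> : 2 * pi * k%:R = pi * (2 * k%:R) :> R by ring.
  rewrite -mulrA ler_pM2l//; nra.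
have cy : cos y <= Num.max (cos (2 * pi / b%:R)) 0.
  have z0 : 0 <= 2 * pi / b%:R :> R.
    by apply: divr_ge0; [apply: mulr_ge0 => //; exact: ltW|exact: ltW].
  rewrite le_max; have [yp|py] := leP y pi.
    have [->|ny] := eqVneq y (2 * pi / b%:R); first by rewrite lexx.
    apply/orP; left; apply: ltW; rewrite ltr_cos ?in_itv/=.
    - by rewrite lt_neqAle eq_sym ny.
    - by rewrite z0 (le_trans y1).
    - by rewrite yp (le_trans z0).
  apply/orP; right; have -> : y = (y - pi) + pi by rewrite subrK.
  rewrite cosDpi oppr_le0; apply: cos_ge0_pihalf; lra.
rewrite /block_cst.
have h1 : 0 <= 1 - Num.max (cos (2 * pi / b%:R)) 0 :> R.
  by rewrite subr_ge0 ge_max ler01 andbT cos_le1.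
move: (Num.max _ _) cy h1 => M cy h1.
apply: (@le_trans _ _ (2 * (1 - M) / (2 * pi * k%:R) ^+ 2)); last first.
  rewrite ler_wpM2r ?invr_ge0 ?sqr_ge0//; lra.
have -> : 2 * (1 - M) / (2 * pi * k%:R) ^+ 2 = (1 - M) / (2 * pi ^+ 2) * k%:R^-1 ^+ 2.
  rewrite exprVn !exprMn !invfM; move: (pi^-1) (k%:R^-1) => z v; by field.
have c0 : 0 <= (1 - M) / (2 * pi ^+ 2).
  by apply: divr_ge0 => //; apply: mulr_ge0 => //; exact: sqr_ge0.
apply: (ler_wpM2l c0).
by rewrite ler_pXn2r ?nnegrE ?invr_ge0 ?(ltW kp) ?(ltW bB)// lef_pV2 ?posrE.
Qed.

End trigonometric_coefficients.

(** * Copies of the weight and subcriticality *)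

Section weight_copies.
Context {R : realType} {b : nat}.
Context {d' : measure_display} {T' : measurableType d'} {P' : probability T' R}.
Context {d : measure_display} {T : measurableType d} {P : probability T R}.
Implicit Types (W : {RV P' >-> R}) (Wu : seq 'I_b -> {RV P >-> R}) (u : seq 'I_b).

Lemma measurable_excess (Y : {RV P >-> R}) : measurable_fun setT (fun x => Y x - 1).
Proof. by apply: measurable_funB => //; exact: measurable_funP. Qed.

Definition excess (Y : {RV P >-> R}) : {RV P >-> R} :=
  HB.pack (fun x => Y x - 1) (@isMeasurableFun.Build _ _ _ _ _ (measurable_excess Y)).

Lemma mutually_independent_excess (I : choiceType) (D : set I) (Y : I -> {RV P >-> R}) :
  mutually_independent D Y -> mutually_independent D (fun i => excess (Y i)).
Proof.
move=> indY s A us sD mA.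
have mB i : measurable ((fun y : R => y - 1) @^-1` A i).
  rewrite -[X in measurable X]setTI; apply: (_ : measurable_fun setT _) => //.
  by apply: measurable_funB => //; exact: measurable_id.
exact: (indY s (fun i => (fun y => y - 1) @^-1` A i)).
Qed.

Lemma ge0_integral_copy W Wu u (f : R -> \bar R) : iid_copies W Wu -> u != [::] ->
  measurable_fun setT f -> (forall y, (0 <= f y)%E) ->
  (\int[P]_x f (Wu u x) = \int[P']_x f (W x))%E.
Proof.
move=> [_ dW _] u0 mf f0.
rewrite -[LHS](@ge0_integral_distribution _ _ _ _ _ P (Wu u) f)//.
rewrite -[RHS](@ge0_integral_distribution _ _ _ _ _ P' W f)//.
by apply: eq_measure_integral => A mA _; exact: dW.
Qed.

Lemma integral_copy W Wu u (f : R -> R) : iid_copies W Wu -> u != [::] ->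
  measurable_fun setT f -> P'.-integrable setT (EFin \o (f \o W)) ->
  P.-integrable setT (EFin \o (f \o Wu u)) /\
  (\int[P]_x (f (Wu u x))%:E = \int[P']_x (f (W x))%:E)%E.
Proof.
move=> cW u0 mf /integrableP[_ If].
have iu : P.-integrable setT (EFin \o (f \o Wu u)).
  apply/integrableP; split.
    by apply/measurable_EFinP; apply: measurableT_comp mf _; exact: measurable_funP.
  rewrite (ge0_integral_copy (f := fun y => `|(f y)%:E|%E) cW u0)//.
  by apply: measurableT_comp => //; exact/measurable_EFinP.
split => //; have [_ dW _] := cW.
have mEf : measurable_fun setT (EFin \o f) by exact/measurable_EFinP.
have iW : P'.-integrable setT ((EFin \o f) \o W).
  by apply/integrableP; split => //; apply: measurableT_comp mEf _; exact: measurable_funP.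
transitivity (\int[P]_x ((EFin \o f) \o Wu u) x)%E; first by [].
rewrite -(@integral_distribution _ _ _ _ _ P (Wu u) (EFin \o f))//.
transitivity (\int[P']_x ((EFin \o f) \o W) x)%E; last by [].
rewrite -(@integral_distribution _ _ _ _ _ P' W (EFin \o f))//.
by apply: eq_measure_integral => A mA _; exact: dW.
Qed.

Lemma ae_copy_ge0 W Wu u : iid_copies W Wu -> u != [::] ->
  {ae P', forall x, 0 <= W x} -> {ae P, forall x, 0 <= Wu u x}.
Proof.
move=> [_ dW _] u0 W0.
have mN : measurable [set y : R | y < 0] by have := measurable_itv `]-oo, (0:R)[; rewrite set_itvE.
have e (d1 : measure_display) (S : measurableType d1) (Q : probability S R) (Y : {RV Q >-> R}) :
    ~` [set x | 0 <= Y x] = Y @^-1` [set y : R | y < 0].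
  by apply/seteqP; split => x /=; rewrite ltNge => /negP.
have mY (d1 : measure_display) (S : measurableType d1) (Q : probability S R) (Y : {RV Q >-> R}) :
    measurable (~` [set x | 0 <= Y x]).
  by rewrite e -[X in measurable X]setTI; exact: measurable_funP.
suff : P.-negligible (~` [set x | 0 <= Wu u x]) by [].
apply/(negligibleP _ (mY _ _ _ _)); rewrite e.
have : P'.-negligible (~` [set x | 0 <= W x]) by [].
move=> /(negligibleP _ (mY _ _ _ _)); rewrite e => <-.
exact: (dW u u0 _ mN).
Qed.

Lemma ae_copies_ge0 W Wu : iid_copies W Wu ->
  {ae P', forall x, 0 <= W x} -> {ae P, forall x, forall u, 0 <= Wu u x}.
Proof.
move=> cW W0; have [W1 _ _] := cW.
(* Words are countable, so the null sets are collected along [unpickle]; its default is the root,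
   whose weight is 1. *)
have : {ae P, forall x, forall n, 0 <= Wu (odflt [::] (unpickle n)) x}.
  apply: ae_foralln => n.
  have [->|u0] := eqVneq (odflt [::] (unpickle n) : seq 'I_b) [::].
    by apply: aeW => x; rewrite W1.
  exact: ae_copy_ge0 cW u0 W0.
by apply: filterS => x H u; have := H (pickle u); rewrite pickleK.
Qed.

End weight_copies.
Section subcritical_exponent.
Context {R : realType}.
Implicit Types (x r s t : R).

Lemma powR_le1D x r s : 0 <= x -> 0 <= r -> r <= s -> x `^ r <= 1 + x `^ s.
Proof.
move=> x0 r0 rs; have [x1|x1] := leP x 1.
  apply: (@le_trans _ _ 1); last by rewrite lerDl powR_ge0.
  have <- : 1 `^ r = 1 :> R by rewrite powR1.
  apply: ge0_ler_powR => //; exact: ler01.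
by rewrite ler_wpDl// ler_powR// ltW.
Qed.

(** Difference quotient at [s = 1], with step [n.+1%:R^-1], of the function sending [s] to [x] to
    the power [s]. *)
Definition powR_quot (n : nat) x : R := n.+1%:R * (x `^ (1 + n.+1%:R^-1) - x).

(** Bounds uniform in [n], for dominated convergence: with [t] the step, the lower one is the
    tangent at 1 of the power [1 + t], the upper one [x] times the tangent at 1 of the power [t]. *)
Lemma powR_quot_bounds n x : 0 <= x -> x - 1 <= powR_quot n x <= x ^+ 2 - x.
Proof.
move=> x0; rewrite /powR_quot; set t := n.+1%:R^-1; have t0 : 0 < t by rewrite invr_gt0 ltr0n.
have t1 : t <= 1 by rewrite invf_le1 ?ltr0n// ler1n.
have nt : n.+1%:R = t^-1 by rewrite invrK.
have [e|xn] := eqVneq x 0.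
  rewrite e powR0; last lra.
  rewrite subr0 mulr0; apply/andP; split; lra.
have xp : 0 < x by rewrite lt_neqAle eq_sym xn.
have h1 : 1 <= 1 + t by lra.
have := powR_ge_tangent h1 x0 ler01.
have h2 : 0 <= t <= 1 by rewrite (ltW t0).
have := powR_le_tangent h2 x0 ltr01.
rewrite !powR1 !mulr1 gt0_powRD// powRr1// nt.
move=> /(ler_wpM2l x0) u l; rewrite mulrC; apply/andP; split.
  rewrite ler_pdivlMr//; lra.
rewrite ler_pdivrMr//; lra.
Qed.

(* This is where the hypothesis on [W ln W] meets the moments of order
   [1 + n.+1%:R^-1]. *)
Lemma cvg_powR_quot x : 0 <= x -> (powR_quot n x) @[n --> \oo] --> x * ln x.
Proof.
move=> x0; have [->|xn] := eqVneq x 0.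
  rewrite mul0r (_ : powR_quot ^~ 0 = cst 0); first exact: cvg_cst.
  apply/funext => n; by rewrite /powR_quot powR0 ?subr0 ?mulr0// gt_eqF// ltr_wpDr// invr_ge0.
have xp : 0 < x by rewrite lt_neqAle eq_sym xn.
set s := ln x.
have E n : powR_quot n x = x * (n.+1%:R * (expR (n.+1%:R^-1 * s) - 1)).
  by rewrite /powR_quot gt0_powRD// powRr1// /powR gt_eqF//; ring.
rewrite (_ : powR_quot ^~ x = fun n => x * (n.+1%:R * (expR (n.+1%:R^-1 * s) - 1))); last exact/funext.
apply: cvgMr.
have h : n.+1%:R^-1 * s @[n --> \oo] --> (0 : R).
  by rewrite -[X in _ --> X](mul0r s); apply: cvgMl; exact: cvg_harmonic.
(* Squeeze from [y <= expR y - 1 <= y * expR y], both instances of [expR_ge1Dx], with [y] equal to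
   [s] times the step. *)
apply: (@squeeze_cvgr _ _ _ _ (cst s) (fun n => s * expR (n.+1%:R^-1 * s))).
- near=> n; have n0 : 0 < n.+1%:R :> R by rewrite ltr0n.
  have se : s = n.+1%:R * (n.+1%:R^-1 * s) by rewrite mulrA divff ?mul1r// gt_eqF.
  have ep := expR_gt0 (n.+1%:R^-1 * s); rewrite /cst; set y := _^-1 * s in ep *.
  rewrite (_ : s = n.+1%:R * y)// -[_ * y * _]mulrA !ler_pM2l//.
  have := expR_ge1Dx y; have := expR_ge1Dx (- y); rewrite expRN => h1 h2.
  have := ler_wpM2r (ltW ep) h1; rewrite mulVf ?gt_eqF//.
  move=> h3; apply/andP; split; lra.
- exact: cvg_cst.
- rewrite -[X in _ --> X]mulr1 -{2}(@expR0 R); apply: cvgMr.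
  exact: (continuous_cvg _ (@continuous_expR R _) h).
Unshelve. all: by end_near. Qed.

End subcritical_exponent.

Section subcritical_weight.
Context {R : realType} {d : measure_display} {T : measurableType d} {P : probability T R}.
Implicit Type W : {RV P >-> R}.

Lemma integrable_powR_le W (r s : R) : 0 <= r -> r <= s ->
  (\int[P]_x (`|W x| `^ s)%:E < +oo)%E ->
  P.-integrable setT (EFin \o (fun x : T => `|W x| `^ r)).
Proof.
move=> r0 rs Is; have mW t : measurable_fun setT (fun x => `|W x| `^ t).
  by apply: measurable_norm_powR; exact: measurable_funP.
have is_ : P.-integrable setT (EFin \o (fun x : T => `|W x| `^ s)).
  by apply: ge0_integrable => // x; exact: powR_ge0.
apply: (@le_integrable _ _ _ P _ measurableT _ (fun x => (1 + `|W x| `^ s)%:E)).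
- exact/measurable_EFinP.
- move=> x _; rewrite /= lee_fin [leLHS]ger0_norm ?powR_ge0// [leRHS]ger0_norm ?addr_ge0 ?powR_ge0//.
  exact: powR_le1D.
- under eq_fun do rewrite EFinD.
  apply: integrableD => //; exact: finite_measure_integrable_cst.
Qed.

(** Near [r = 1] the [r]-th moment of [W] has slope [E[W ln W]], strictly below the slope [ln B] of
    [B] to the power [r - 1], and both equal 1 at [r = 1]. Dominated convergence passes the strict
    inequality to some difference quotient, and the exponential lies above its tangent. *)
Lemma subcritical_exponent W (B : R) : 1 <= B -> {ae P, forall x, 0 <= W x} ->
  (\int[P]_x (W x)%:E = 1)%E -> (\int[P]_x (`|W x| `^ 2)%:E < +oo)%E ->
  (\int[P]_x (W x * ln (W x))%:E < (ln B)%:E)%E ->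
  exists r w : R, [/\ 1 < r, r <= 2, 0 <= w, w < B `^ (r - 1) &
    (\int[P]_x (`|W x| `^ r)%:E <= w%:E)%E].
Proof.
move=> B1 W0 EW W2 Wln.
have mW : measurable_fun setT W by exact: measurable_funP.
have iWr r : 0 <= r -> r <= 2 -> P.-integrable setT (EFin \o (fun x : T => `|W x| `^ r)).
  by move=> r0 r2; exact: integrable_powR_le W2.
have mq n : measurable_fun setT (fun x => (powR_quot n (W x))%:E).
  apply/measurable_EFinP; apply: measurable_funM => //; apply: measurable_funB => //.
  exact: measurableT_comp (measurable_powR _) mW.
have [||||_ _] := @dominated_convergence _ T R P setT measurableT
   (fun n x => (powR_quot n (W x))%:E) (fun x => (W x * ln (W x))%:E)
   (fun x => 1 + (`|W x| `^ 2)%:E)%E mq.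
- apply/measurable_EFinP; apply: measurable_funM => //.
  exact: (measurableT_comp (@measurable_ln R) mW).
- apply: filterS W0 => x x0 _; apply: cvg_EFin; first exact: nearW.
  exact: cvg_powR_quot.
- apply: integrableD => //; first exact: finite_measure_integrable_cst.
  exact: iWr.
- apply: filterS W0 => x x0 n _; rewrite -EFinD abse_EFin lee_fin.
  rewrite powR_mulrn// [`|W x|]ger0_norm//.
  have := powR_quot_bounds n x0; have := sqr_ge0 (W x); rewrite ler_norml; lra.
move=> cv.
have [n ] : exists n, (\int[P]_x (powR_quot n (W x))%:E < (ln B)%:E)%E.
  apply: contrapT => /forallNP H; move: Wln; apply/negP; rewrite -leNgt.
  apply: (cvge_ge _ cv); apply: nearW => n; rewrite leNgt; apply/negP; exact: H.
move=> Hn.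
have i1 : P.-integrable setT (EFin \o W).
  have := iWr 1 ler01 (ler1n _ 2); apply: le_integrable => //; first exact/measurable_EFinP.
  by move=> x _; rewrite /= powRr1// normr_id.
set t : R := n.+1%:R^-1; have t0 : 0 < t by rewrite invr_gt0 ltr0n.
have t1 : t <= 1 by rewrite invf_le1 ?ltr0n// ler1n.
have Ei : (\int[P]_x (powR_quot n (W x))%:E =
   (n.+1%:R)%:E * (\int[P]_x (`|W x| `^ (1 + t))%:E - 1))%E.
  have it : P.-integrable setT (EFin \o (fun x : T => `|W x| `^ (1 + t))) by apply: iWr; lra.
  rewrite -EW -(integralB measurableT it i1) -(integralZl measurableT (integrableB measurableT it i1)).
  apply: ae_eq_integral => //.
  - by apply: emeasurable_funM => //; apply: (measurable_int P); exact: integrableB.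
  - apply: filterS W0 => x x0 _; rewrite /powR_quot -EFinB -EFinM; congr (_ * (_ `^ _ - _))%:E.
    by rewrite ger0_norm.
exists (1 + t), (fine (\int[P]_x (`|W x| `^ (1 + t))%:E)%E).
have fI : (\int[P]_x (`|W x| `^ (1 + t))%:E)%E \is a fin_num.
  by apply: integrable_fin_num => //; apply: iWr; lra.
split; [lra|lra| | |by rewrite fineK].
  by apply: fine_ge0; apply: integral_ge0 => x _; rewrite lee_fin powR_ge0.
move: Hn; rewrite Ei -(fineK fI) -EFinB -EFinM lte_fin.
move: (fine _) => w; rewrite -ltr_pdivlMl ?ltr0n// -/t.
have -> : 1 + t - 1 = t by ring.
rewrite /= /powR gt_eqF; last lra.
have := expR_ge1Dx (t * ln B); lra.
Qed.
End subcritical_weight.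

(** * Integrals against the cascade measures and their limit *)

Section density.
Context {R : realType}.
Variables (nu : {measure set R -> \bar R}) (g : R -> R).
Hypothesis mg : measurable_fun setT g.
Hypothesis g0 : forall x, 0 <= g x.
Let mEg : measurable_fun setT (EFin \o g).
Proof. exact/measurable_EFinP. Qed.

Let Eg0 x : (0 <= (g x)%:E)%E.
Proof. by rewrite lee_fin. Qed.

Hypothesis nuE : forall A, measurable A -> nu A = (\int[lebesgue_measure]_(x in A) (g x)%:E)%E.

Import HBNNSimple.

Let density_nnsfun (h : {nnsfun R >-> R}) :
  (\int[nu]_x (h x)%:E = \int[lebesgue_measure]_x ((h x)%:E * (g x)%:E))%E.
Proof.
rewrite integralT_nnsfun sintegralE; under [RHS]eq_integral => x _.
  rewrite (fimfunE h x) -fsumEFin// ge0_mule_fsuml; last first.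
    by move=> y; exact: nnfun_muleindic_ge0.
  over.
have mi1 y : measurable_fun setT (fun x => (\1_(h @^-1` [set y]) x)%:E : \bar R).
  exact/measurable_EFinP.
have mind y : measurable_fun setT (fun x => (y * \1_(h @^-1` [set y]) x)%:E).
  by apply/measurable_EFinP; exact: measurable_funM.
rewrite ge0_integral_fsum//; last 2 first.
- by move=> y; exact (emeasurable_funM (mind y) mEg).
- by move=> y x _; apply: mule_ge0 => //; exact: nnfun_muleindic_ge0.
apply: eq_fsbigr => y /[!inE] -[x _ <-].
under [RHS]eq_integral do rewrite EFinM -muleA.
rewrite ge0_integralZl//.
- congr (_ * _)%E; rewrite nuE// [LHS]integral_mkcond.
  by apply: eq_integral => z _; rewrite epatch_indic muleC.
- exact (emeasurable_funM (mi1 (h x)) mEg).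
- by move=> z _; apply: mule_ge0; rewrite ?lee_fin.
- by rewrite lee_fin.
Qed.

Lemma integral_density (f : R -> R) : measurable_fun setT f -> (forall x, 0 <= f x) ->
  (\int[nu]_x (f x)%:E = \int[lebesgue_measure]_x ((f x)%:E * (g x)%:E))%E.
Proof.
move=> mf f0; have mEf : measurable_fun setT (EFin \o f) by exact/measurable_EFinP.
have Ef0 x : setT x -> (0 <= (EFin \o f) x)%E by rewrite lee_fin.
pose h := nnsfun_approx measurableT mEf.
have ch x : (h n x)%:E @[n --> \oo] --> (f x)%:E.
  exact: (@cvg_nnsfun_approx _ _ _ _ measurableT _ mEf).
have ndh x : {homo (fun n => (h n x)%:E) : m n / (m <= n)%N >-> (m <= n)%E}.
  by move=> m n mn; rewrite lee_fin; exact/lefP/nd_nnsfun_approx.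
have mh n : measurable_fun setT (fun x => (h n x)%:E) by exact/measurable_EFinP.
have -> : (\int[nu]_x (f x)%:E = limn (fun n => \int[nu]_x (h n x)%:E))%E.
  apply/esym/cvg_lim => //; under eq_integral => x _ do rewrite -(cvg_lim _ (ch x))//.
  apply: cvg_monotone_convergence => //.
  by move=> n x _; rewrite lee_fin.
have -> : (\int[lebesgue_measure]_x ((f x)%:E * (g x)%:E) = limn (fun n => \int[lebesgue_measure]_x ((h n x)%:E * (g x)%:E)))%E.
  apply/esym/cvg_lim => //.
  under eq_integral => x _ do rewrite -(cvg_lim _ (cvgeZr (isT : (g x)%:E \is a fin_num) (ch x)))//.
  apply: cvg_monotone_convergence => //.
  - by move=> n; exact (emeasurable_funM (mh n) mEg).
  - by move=> n x _; apply: mule_ge0; rewrite ?lee_fin.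
  - by move=> x _ m n mn; apply: lee_wpmul2r => //; exact: ndh.
by congr (limn _); apply/funext => n; exact: density_nnsfun.
Qed.

End density.
Section cascade_integral.
Context {R : realType} {b : nat} {d : measure_display} {T : measurableType d}.
Context {P : probability T R}.
Variable Wu : seq 'I_b -> {RV P >-> R}.
Hypothesis b0 : (0 < b)%N.
Local Notation X := (fun u => excess (Wu u)).
Implicit Types (x : T) (u : seq 'I_b).

Lemma cprod_excess u x : Wu [::] x = 1 ->
  \prod_(0 <= j < (size u).+1) Wu (take j u) x = cprod X u x.
Proof.
move=> W1; rewrite big_nat_recl// take0 W1 mul1r /cprod big_add1 /=.
by apply: eq_bigr => j _; rewrite addrC subrK.
Qed.

Lemma cascade_densityE n x t : Wu [::] x = 1 ->
  cascade_density Wu n x t =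
  \sum_(u <- words b n) cprod X u x * \1_(word_interval u) t.
Proof.
move=> W1; rewrite -big_tuple_words; apply: eq_bigr => u _.
by rewrite -cprod_excess// size_tuple.
Qed.

Lemma integral_cascade_measure n x (f F : R -> R) : Wu [::] x = 1 ->
  (forall u, 0 <= Wu u x) -> (forall t : R, is_derive t (1 : R) F (f t)) ->
  continuous f -> (forall t, 0 <= f t) ->
  (\int[cascade_measure Wu n x]_t (f t)%:E =
   (mart X (wcoef F) n x)%:E)%E.
Proof.
move=> W1 W0 dF cf f0.
have mf : measurable_fun setT f by exact: continuous_measurable_fun.
have Q0 u : 0 <= cprod X u x.
  by rewrite -cprod_excess//; apply: prodr_ge0.
have d0 t : 0 <= cascade_density Wu n x t.
  by rewrite cascade_densityE//; apply: sumr_ge0 => u _; rewrite mulr_ge0.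
have mg : measurable_fun setT (cascade_density Wu n x)^\+.
  by apply: measurable_funrpos; exact: measurable_cascade_density.
have -> : (\int[cascade_measure Wu n x]_t (f t)%:E =
    \int[lebesgue_measure]_t ((f t)%:E * ((cascade_density Wu n x)^\+ t)%:E))%E.
  exact: integral_density.
under eq_integral => t _.
  rewrite (@ge0_funrposE _ _ setT) ?inE// cascade_densityE// -EFinM mulr_sumr -sumEFin; over.
have mI u : measurable (word_interval u : set R) by exact: measurable_itv.
have mfc u : measurable_fun setT (fun t => (f t * (cprod X u x * \1_(word_interval u) t))%:E).
  by apply/measurable_EFinP; apply: measurable_funM => //; exact: measurable_funM.
rewrite ge0_integral_sum//; last first.
  by move=> u t _; rewrite lee_fin; apply: mulr_ge0 => //; apply: mulr_ge0.
rewrite /mart -sumEFin; apply: eq_bigr => u _.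
under eq_integral => t _ do rewrite mulrCA EFinM.
have mfi : measurable_fun setT (fun t => (f t * \1_(word_interval u) t)%:E).
  by apply/measurable_EFinP; exact: measurable_funM.
rewrite ge0_integralZl_EFin//; last first.
  by move=> t _; rewrite lee_fin mulr_ge0.
rewrite EFinM -(integral_word_interval b0 u dF cf); congr (_ * _)%E.
rewrite [RHS]integral_mkcond; apply: eq_integral => t _.
by rewrite epatch_indic -EFinM.
Qed.

End cascade_integral.
Section cascade_fourier.
Context {R : realType} {b : nat} {d : measure_display} {T : measurableType d}.
Context {P : probability T R}.
Variables (Wu : seq 'I_b -> {RV P >-> R}) (mu : R.-ftker T ~> R).
Hypothesis b2 : (2 <= b)%N.
Local Notation X := (fun u => excess (Wu u)).
Implicit Types (x : T) (u : seq 'I_b).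

Definition fhat (e : bool) (k : nat) (x : T) : R := (\int[mu x]_t trig e k t)%R.

Let mu_lty x : (mu x setT < +oo)%E.
Proof. by rewrite -ge0_fin_numE//; exact: kernel_finite_transition. Qed.

Let bounded_integrable x (f : R -> R) : continuous f -> bounded_fun f ->
  (mu x).-integrable setT (EFin \o f).
Proof.
move=> cf bf; apply: measurable_bounded_integrable => //.
exact: continuous_measurable_fun.
Qed.

Let bounded_trig e k : bounded_fun (trig e k : R -> R).
Proof. by exists 1; split => // y y1 z _; apply: (le_trans (norm_trig_le _ _ _)); exact: ltW. Qed.

Let bounded1 : bounded_fun (cst 1 : R -> R).
Proof. by exists 1; split; [exact: num_real|move=> y y1 z _; rewrite /= normr1; exact: ltW]. Qed.

Let continuous1 : continuous (cst 1 : R -> R).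
Proof. by move=> t; exact: cvg_cst. Qed.

Let bounded_trig1 e k : bounded_fun (fun t => trig e k t + 1 : R).
Proof.
exists 2; split => // y y2 z _; apply: ltW; apply: le_lt_trans y2.
apply: (le_trans (ler_normD _ _)); rewrite normr1 [leRHS](_ : _ = 1 + 1)//.
by rewrite lerD2r norm_trig_le.
Qed.

Let continuous_trig1 e k : continuous (fun t => trig e k t + 1 : R).
Proof. by move=> t; apply: cvgD; [exact: continuous_trig|exact: cvg_cst]. Qed.

Let trig1_ge0 e k t : 0 <= trig e k t + 1 :> R.
Proof. by have := norm_trig_le e k t; rewrite ler_norml; lra. Qed.

(** Adding 1 makes the trigonometric functions nonnegative, as the formulas for cascade measures and
    kernels require; the total mass is subtracted afterwards. *)
Lemma integral_trig1 e k x :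
  (\int[mu x]_t (trig e k t + 1)%:E = (fhat e k x)%:E + mu x setT)%E.
Proof.
under eq_integral do rewrite EFinD.
rewrite integralD//.
- rewrite integral_cst// mul1e /fhat /Rintegral fineK//.
  apply: integrable_fin_num => //; apply: bounded_integrable => //.
  exact: continuous_trig.
- by apply: bounded_integrable => //; exact: continuous_trig.
- exact: (bounded_integrable x (f := cst 1)).
Qed.

Lemma measurable_fhat e k : measurable_fun setT (fhat e k).
Proof.
have -> : fhat e k = fun x => fine (\int[mu x]_t (trig e k t + 1)%:E)%E - fine (mu x setT).
  apply/funext => x; rewrite integral_trig1 fineD//; last first.
    exact: kernel_finite_transition.
  by rewrite addrK.
apply: measurable_funB.
  apply: measurableT_comp => //.
  apply: (@measurable_fun_integral_kernel _ _ T R R mu) => //.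
  - by move=> U mU; exact: measurable_kernel.
  - by move=> t; rewrite lee_fin.
  - by apply/measurable_EFinP; exact: continuous_measurable_fun.
apply: measurableT_comp => //; exact: measurable_kernel.
Qed.

Lemma ae_cvg_mart_fhat : (forall x, Wu [::] x = 1) ->
  {ae P, forall x, forall u, 0 <= Wu u x} -> cascade_limit Wu P mu ->
  {ae P, forall x, forall e k, (0 < k)%N ->
    mart X (fcoef e k) n x @[n --> \oo] --> fhat e k x}.
Proof.
move=> W1' W0 [_ wc]; apply: filterS2 W0 wc => x W0 wc e k k0; have W1 := W1' x.
have c1 : mart X (wcoef id) n x @[n --> \oo] --> fine (mu x setT).
  have e1 : (\int[mu x]_t (cst 1 t)%:E = (fine (mu x setT))%:E)%E.
    rewrite (_ : (fun t => (cst 1 t)%:E) = cst 1%:E)// integral_cst// mul1e fineK//.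
    exact: kernel_finite_transition.
  have := wc _ continuous1 bounded1; rewrite e1 => /fine_cvg; apply: cvg_trans; apply: near_eq_cvg; apply: nearW => n /=.
  rewrite (@integral_cascade_measure _ _ _ _ _ _ (ltnW b2) n x (cst 1) id)//.
have c2 : mart X (wcoef (fun t => trig_prim e k t + t)) n x @[n --> \oo] -->
    fhat e k x + fine (mu x setT).
  have := wc _ (@continuous_trig1 e k) (bounded_trig1 e k).
  rewrite integral_trig1 -(fineK (kernel_finite_transition _ _ measurableT)) -EFinD.
  move=> /fine_cvg; apply: cvg_trans; apply: near_eq_cvg; apply: nearW => n /=.
  have dF (t : R) : is_derive t (1 : R) (fun t => trig_prim e k t + t) (trig e k t + 1).
    by apply: is_deriveD; exact: is_derive_trig_prim.
  by rewrite (integral_cascade_measure (ltnW b2) n W1 W0 dF (@continuous_trig1 e k)).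
have -> : (fun n => mart X (fcoef e k) n x) =
    (fun n => mart X (wcoef (fun t => trig_prim e k t + t)) n x - mart X (wcoef id) n x).
  apply/funext => n; rewrite /mart -sumrB; apply: eq_bigr => u _.
  by rewrite -mulrBr wcoefD addrK.
by rewrite -(addrK (fine (mu x setT)) (fhat e k x)); exact: cvgB.
Qed.

End cascade_fourier.

(** * The coordinates of the Fourier norm *)

Section frequencies.
Context {R : realType} {b : nat}.
Hypothesis b2 : (2 <= b)%N.
Variables (alpha q : R).
Hypothesis a0 : 0 <= alpha.
Hypothesis q0 : 0 < q.
Hypothesis aq : 1 < q - alpha * q.

(** Each frequency from 1 to [N] occurs twice, once for the real and once for the imaginary part, so
    that the inequality for real l^q norms applies. *)
Definition freqs N : seq (bool * nat) := [seq (e, k.+1) | e <- [:: true; false], k <- iota 0 N].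

Lemma big_freqs (M : nmodType) (F : bool * nat -> M) N :
  \sum_(i <- freqs N) F i = \sum_(0 <= k < N) (F (true, k.+1) + F (false, k.+1)).
Proof.
rewrite /freqs /= cats0 big_cat !big_map big_split /=.
by rewrite /index_iota subn0.
Qed.

Definition wfcoef (i : bool * nat) (u : seq 'I_b) : R := i.2%:R `^ alpha * fcoef i.1 i.2 u.

Definition fbound n (i : bool * nat) : R :=
  i.2%:R `^ alpha * Num.min (b%:R ^- n) i.2%:R^-1.

Lemma wfcoef_additive i : additive_on_words (wfcoef i).
Proof. by move=> u; rewrite /wfcoef (fcoef_additive b2) mulr_sumr. Qed.

Lemma wfcoef_nil i : wfcoef i [::] = 0.
Proof. by rewrite /wfcoef fcoef_nil mulr0. Qed.

(* the zero frequency is harmless, since [trig_prim e 0 = 0] *)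
Lemma norm_wfcoef_le i n u : size u = n -> `|wfcoef i u| <= fbound n i.
Proof.
move=> <-; rewrite normrM ger0_norm ?powR_ge0// ler_wpM2l ?powR_ge0//.
have [->|i0] := posnP i.2.
  rewrite /fcoef /wcoef /trig_prim mulr0 invr0 !mul0r subrr normr0.
  by rewrite le_min lexx invr_ge0 exprn_ge0.
by rewrite le_min norm_fcoef_le_pow ?norm_fcoef_le_inv.
Qed.

(** The factor 2 counts real and imaginary parts, the summand 1 comes from the frequencies up to
    [b ^ n] and the other one from the tail. *)
Definition freq_cst : R := 2 * (1 + (q - alpha * q - 1)^-1).

Lemma freq_cst_ge0 : 0 <= freq_cst.
Proof. by rewrite mulr_ge0// addr_ge0// invr_ge0 subr_ge0 ltW. Qed.

Lemma sum_fbound_le N n :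
  \sum_(i <- freqs N) fbound n i `^ q <=
  freq_cst * (b ^ n)%:R `^ (1 - (q - alpha * q)).
Proof.
set beta := q - alpha * q; set B := (b ^ n)%N.
have B0 : (0 < B)%N by rewrite expn_gt0 (ltnW b2).
have Bp : 0 < B%:R :> R by rewrite ltr0n.
have beta0 : 0 < beta - 1 by rewrite subr_gt0.
rewrite big_freqs; pose t k : R := k.+1%:R `^ alpha * Num.min (B%:R^-1) k.+1%:R^-1.
under eq_bigr do rewrite /fbound -natrX -/B -/(t _) -mulr2n -mulr_natl.
rewrite -mulr_sumr /freq_cst -mulrA ler_wpM2l//.
have t0 k : 0 <= t k by rewrite mulr_ge0 ?powR_ge0// le_min !invr_ge0 !ler0n.
have tq k (z : R) : 0 < z -> t k <= z `^ alpha * z^-1 -> t k `^ q <= z `^ (- beta).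
  move=> z0 tz; have -> : - beta = (alpha - 1) * q by rewrite /beta; ring.
  rewrite powRrM gt0_powRD// powR_inv1 ?(ltW z0)//.
  by rewrite ge0_ler_powR ?nnegrE ?t0 ?(ltW q0)// mulr_ge0 ?powR_ge0 ?invr_ge0 ?(ltW z0).
have tB k : (k < B)%N -> t k `^ q <= B%:R `^ (- beta).
  move=> kB; apply: tq => //; apply: ler_pM; rewrite ?powR_ge0//.
  - by rewrite ge0_ler_powR ?nnegrE ?ler_nat// ler0n.
  - by rewrite ge_min lexx.
have tk k : t k `^ q <= k.+1%:R `^ (- beta).
  apply: tq => //; rewrite ?ltr0n//; apply: ler_wpM2l; rewrite ?powR_ge0//.
  by rewrite ge_min lexx orbT.
(* The range is enlarged so that it can be cut at [B] whatever [N] is: below [B] the bound by the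
   length of the interval is used, above [B] the bound by the inverse frequency. *)
apply: (@le_trans _ _ (\sum_(0 <= k < B + N) t k `^ q)).
  rewrite (@big_cat_nat _ _ _ N 0 (B + N))//= ?leq_addl// lerDl.
  by apply: sumr_ge0 => k _; exact: powR_ge0.
rewrite (@big_cat_nat _ _ _ B 0 (B + N))//= ?leq_addr// mulrDl mul1r.
apply: lerD.
  apply: (@le_trans _ _ (\sum_(0 <= k < B) B%:R `^ (- beta))).
    by rewrite !big_mkord; apply: ler_sum => k _; exact: tB.
  rewrite big_mkord sumr_const card_ord -[X in X <= _]mulr_natl.
  by rewrite gt0_powRD// powRr1 ?(ltW Bp).
apply: (@le_trans _ _ (\sum_(B <= k < B + N) k.+1%:R `^ (- beta))).
  by apply: ler_sum => k _; exact: tk.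
exact: sum_natpow_tail.
Qed.

End frequencies.

(** * Limits of integrals and the Fourier norm *)

Section limits_of_integrals.
Context {R : realType}.

(** Continuity of the power along increasing partial sums, with the value [+oo] allowed: the
    supremum of the powers is carried back by the inverse power. *)
Lemma cvg_nneseries_poweR (u : nat -> \bar R) (t : R) m : 0 < t ->
  (forall k, (0 <= u k)%E) ->
  ((\sum_(m <= k < n) u k) `^ t)%E @[n --> \oo] --> ((\sum_(m <= k <oo) u k) `^ t)%E.
Proof.
move=> t0 u0; have tV : 0 <= t^-1 by rewrite invr_ge0 ltW.
pose S n := (\sum_(m <= k < n) u k)%E.
have S0 n : (0 <= S n)%E by apply: sume_ge0.
have SL n : (S n <= \sum_(m <= k <oo) u k)%E by exact: nneseries_lim_ge.
have nd : {homo (fun n => (S n `^ t)%E) : k l / (k <= l)%N >-> (k <= l)%E}.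
  move=> k l kl; apply: gt0_ler_poweR; rewrite ?(ltW t0)// ?in_itv/= ?leey ?S0//.
  exact: lee_sum_nneg_natr.
have cv := ereal_nondecreasing_cvgn nd.
suff -> : ((\sum_(m <= k <oo) u k) `^ t)%E = ereal_sup (range (fun n => (S n `^ t)%E)) by [].
set L := ereal_sup _.
have T0 : (0 <= \sum_(m <= k <oo) u k)%E by exact: nneseries_ge0.
apply/eqP; rewrite eq_le; apply/andP; split; last first.
  apply: ge_ereal_sup => _ [n _ <-].
  by apply: gt0_ler_poweR; rewrite ?(ltW t0)// ?in_itv/= ?leey ?S0// T0.
have HS n : (S n `^ t <= L)%E by apply: ereal_sup_ubound; exists n.
have L0 : (0 <= L)%E by exact: le_trans (poweR_ge0 _ _) (HS 0%N).
have -> : L = ((L `^ t^-1) `^ t)%E by rewrite -poweRrM mulVf ?gt_eqF// poweRe1.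
apply: gt0_ler_poweR; rewrite ?(ltW t0)// ?in_itv/= ?leey ?T0 ?poweR_ge0//.
apply: lime_le; first exact: is_cvg_nneseries.
apply: nearW => n; rewrite -/(S n).
have -> : S n = ((S n `^ t) `^ t^-1)%E by rewrite -poweRrM divff ?gt_eqF// poweRe1.
by apply: gt0_ler_poweR; rewrite ?in_itv/= ?leey ?poweR_ge0 ?L0.
Qed.

Lemma cvg_powR (I : Type) (F : set_system I) {FF : ProperFilter F} (u : I -> R) (l t : R) :
  0 < t -> (forall i, 0 <= u i) -> u i @[i --> F] --> l -> u i `^ t @[i --> F] --> l `^ t.
Proof.
move=> t0 u0 ul; have l0 : 0 <= l by apply: (cvgr_to_ge ul); exact: nearW.
have [l00|ln0] := eqVneq l 0.
  rewrite l00 powR0 ?gt_eqF//; apply/cvgrPdist_lt => e e0.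
  have e1 : 0 < e `^ t^-1 by exact: powR_gt0.
  move/cvgrPdist_lt: ul => /(_ _ e1); apply: filterS => i.
  rewrite l00 !sub0r !normrN !ger0_norm ?powR_ge0// => ui.
  have := @gt0_ltr_powR R t t0 (u i) (e `^ t^-1).
  by rewrite !nnegrE u0 powR_ge0 ui -powRrM mulVf ?gt_eqF// powRr1 ?(ltW e0)//; apply.
have lp : 0 < l by rewrite lt_neqAle eq_sym ln0.
have cl : {for l, continuous (fun x : R => x `^ t)}.
  apply: differentiable_continuous; apply/derivable1_diffP.
  by have [] := is_derive1_powR t lp.
exact: (continuous_cvg _ cl ul).
Qed.

Lemma cvg_sumr (I : Type) (F : set_system I) {FF : Filter F} (J : eqType) (s : seq J)
    (u : J -> I -> R) (l : J -> R) :
  (forall j, j \in s -> u j i @[i --> F] --> l j) ->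
  \sum_(j <- s) u j i @[i --> F] --> \sum_(j <- s) l j.
Proof.
elim: s => [|j s IH] H.
  under eq_fun do rewrite big_nil; rewrite big_nil; exact: cvg_cst.
under eq_fun do rewrite big_cons; rewrite big_cons; apply: cvgD.
  by apply: H; rewrite inE eqxx.
by apply: IH => k ks; apply: H; rewrite inE ks orbT.
Qed.

Context {d : measure_display} {T : measurableType d} {P : probability T R}.

(** Fatou's lemma for almost sure limits; the lower limit is defined everywhere and replaces [f] off
    a null set. *)
Lemma integral_limit_le (g : nat -> T -> \bar R) (f : T -> \bar R) (B : \bar R) :
  (forall n, measurable_fun setT (g n)) -> (forall n x, (0 <= g n x)%E) ->
  measurable_fun setT f -> (forall x, (0 <= f x)%E) ->
  {ae P, forall x, g n x @[n --> \oo] --> f x} ->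
  (forall n, \int[P]_x g n x <= B)%E -> (\int[P]_x f x <= B)%E.
Proof.
move=> mg g0 mf f0 cv gB.
have -> : (\int[P]_x f x = \int[P]_x limn_einf (g^~ x))%E.
  apply: ge0_ae_eq_integral => //.
  - rewrite (_ : (fun x => _) = fun x => (- limn_esup (fun n => - g n x))%E); last first.
      by apply/funext => x; rewrite (limn_esupN (g^~ x)) oppeK.
    apply: measurableT_comp => //; apply: measurable_fun_limn_esup => n.
    exact: measurableT_comp.
  - move=> x _; rewrite limn_einf_lim; apply: lime_ge; first exact: is_cvg_einfs.
    by apply: nearW => n; apply: le_ereal_inf_tmp => _ [k _ <-].
  - by apply: filterS cv => x cvx _; rewrite (cvg_limn_einf_sup cvx).1.
apply: (le_trans (fatou P measurableT mg (fun n x _ => g0 n x))).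
rewrite limn_einf_lim; apply: lime_le; first exact: is_cvg_einfs.
apply: nearW => n; apply: le_trans (gB n); apply: ereal_inf_lbound.
by exists n => /=.
Qed.

End limits_of_integrals.

Section amplitude.
Context {R : realType} {d : measure_display} {T : measurableType d}.
Variables (P : probability T R) (mu : R.-ftker T ~> R) (alpha p q : R).
Hypothesis q0 : 0 < q.
Hypothesis p0 : 0 < p.

Definition amplitude (k : nat) (x : T) : R :=
  Normc.normc ((k%:R `^ alpha)%R%:C%C * fourier (mu x) k%:R)%R.

Lemma amplitudeE k x :
  amplitude k x = k%:R `^ alpha * Num.sqrt (fhat mu true k x ^+ 2 + fhat mu false k x ^+ 2).
Proof.
have -> : amplitude k x = Num.sqrt ((k%:R `^ alpha * fhat mu true k x - 0 * fhat mu false k x) ^+ 2 +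
   (k%:R `^ alpha * fhat mu false k x + 0 * fhat mu true k x) ^+ 2) by [].
rewrite !mul0r subr0 addr0 !exprMn -mulrDr sqrtrM ?sqr_ge0// sqrtr_sqr.
by rewrite ger0_norm ?powR_ge0.
Qed.

Lemma amplitude_ge0 k x : 0 <= amplitude k x.
Proof. by rewrite amplitudeE mulr_ge0 ?powR_ge0 ?sqrtr_ge0. Qed.

Lemma measurable_amplitude k : measurable_fun setT (amplitude k).
Proof.
rewrite (_ : amplitude k = fun x => k%:R `^ alpha *
  Num.sqrt (fhat mu true k x ^+ 2 + fhat mu false k x ^+ 2)); last first.
  by apply/funext => x; rewrite amplitudeE.
apply: measurable_funM => //; apply: measurableT_comp; first by apply: continuous_measurable_fun; exact: sqrt_continuous.
by apply: measurable_funD; apply: measurable_funX; exact: measurable_fhat.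
Qed.

Lemma amplitude_le k x : amplitude k x <=
  `|k%:R `^ alpha * fhat mu true k x| + `|k%:R `^ alpha * fhat mu false k x|.
Proof.
rewrite amplitudeE !normrM (ger0_norm (powR_ge0 _ _)) -mulrDr ler_wpM2l ?powR_ge0//.
rewrite -[leRHS]ger0_norm ?addr_ge0// -sqrtr_sqr ler_sqrt; last exact: sqr_ge0.
rewrite sqrrD !real_normK ?num_real//.
have := mulr_ge0 (normr_ge0 (fhat mu true k x)) (normr_ge0 (fhat mu false k x)); lra.
Qed.

Lemma fourier_normE : (fourier_norm P alpha p q mu =
  (\int[P]_x ((\sum_(1 <= k <oo) (amplitude k x `^ q)%:E) `^ (p / q))) `^ p^-1)%E.
Proof. by []. Qed.

Lemma sum_amplitude_le N x :
  \sum_(1 <= k < N.+1) amplitude k x `^ q <=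
  2 `^ q * lq_pow q (freqs N) (fun i => i.2%:R `^ alpha * fhat mu i.1 i.2 x).
Proof.
rewrite big_add1 /= /lq_pow big_freqs mulr_sumr; apply: ler_sum => k _.
apply: le_trans (ler_powRD_max _ _ _) => //; last exact: ltW.
by rewrite ge0_ler_powR ?nnegrE ?amplitude_ge0 ?addr_ge0 ?amplitude_le// ltW.
Qed.

Lemma measurable_sum_amplitude m n :
  measurable_fun setT (fun x => \sum_(m <= k < n) amplitude k x `^ q).
Proof.
apply: measurable_sum => k.
apply: measurable_fun_powR; exact: measurable_amplitude.
Qed.

Let pq0 : 0 < p / q. Proof. exact: divr_gt0. Qed.

Let cv x := @cvg_nneseries_poweR R (fun k => (amplitude k x `^ q)%:E) (p / q) 1 pq0
  (fun k => powR_ge0 _ _).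

Let mS n :
  measurable_fun setT (fun x => (\sum_(1 <= k < n) (amplitude k x `^ q)%:E) `^ (p / q))%E.
Proof.
rewrite (_ : (fun x => _) = fun x => ((\sum_(1 <= k < n) amplitude k x `^ q) `^ (p / q))%:E).
  apply/measurable_EFinP; apply: measurable_fun_powR.
  exact: measurable_sum_amplitude.
by apply/funext => x; rewrite sumEFin poweR_EFin.
Qed.

Lemma measurable_series_amplitude :
  measurable_fun setT (fun x => (\sum_(1 <= k <oo) (amplitude k x `^ q)%:E) `^ (p / q))%E.
Proof. by apply: (emeasurable_fun_cvg _ _ mS) => x _; exact: cv. Qed.

Lemma fourier_norm_powR_le (B : \bar R) :
  (forall N, \int[P]_x ((\sum_(1 <= k < N.+1) amplitude k x `^ q) `^ (p / q))%:E <= B)%E ->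
  (fourier_norm P alpha p q mu `^ p <= B)%E.
Proof.
move=> HB.
rewrite fourier_normE -poweRrM mulVf ?gt_eqF// poweRe1; last first.
  by apply: integral_ge0 => x _; exact: poweR_ge0.
apply: (@integral_limit_le _ _ _ _
  (fun n x => (\sum_(1 <= k < n) (amplitude k x `^ q)%:E) `^ (p / q))%E) => //.
- by move=> n x; exact: poweR_ge0.
- exact: measurable_series_amplitude.
- by move=> x; exact: poweR_ge0.
- by apply: aeW => x; exact: cv.
- case=> [|n].
    under eq_integral do rewrite big_geq// poweR0r ?gt_eqF//.
    by rewrite integral0; apply: le_trans (HB 0%N); apply: integral_ge0 => x _; rewrite lee_fin powR_ge0.
  by under eq_integral do rewrite sumEFin poweR_EFin.
Qed.

Lemma fourier_norm_powR_ge N :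
  (\int[P]_x ((\sum_(1 <= k < N) amplitude k x `^ q) `^ (p / q))%:E
   <= fourier_norm P alpha p q mu `^ p)%E.
Proof.
rewrite fourier_normE -poweRrM mulVf ?gt_eqF// poweRe1; last first.
  by apply: integral_ge0 => x _; exact: poweR_ge0.
apply: ge0_le_integral => //.
- by move=> x _; rewrite lee_fin powR_ge0.
- apply/measurable_EFinP; apply: measurable_fun_powR.
  exact: measurable_sum_amplitude.
- exact: measurable_series_amplitude.
- move=> x _; rewrite -poweR_EFin -sumEFin.
  have u0 k : (0 <= (amplitude k x `^ q)%:E)%E by rewrite lee_fin powR_ge0.
  apply: gt0_ler_poweR; rewrite ?(ltW pq0)// ?in_itv/= ?leey ?andbT.
  + by apply: sume_ge0.
  + exact: nneseries_ge0.
  + exact: nneseries_lim_ge.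
Qed.

End amplitude.

(** * The upper bound *)

Section upper_bound.
Context {R : realType} {d : measure_display} {T : measurableType d}.
Context {P : probability T R} {b : nat}.
Variable X : seq 'I_b -> {RV P >-> R}.
Let D : set (seq 'I_b) := [set u | u != [::]].
Hypothesis indX : mutually_independent D X.
Hypothesis intX : forall u, D u -> P.-integrable setT (EFin \o X u).
Hypothesis centX : forall u, D u -> (\int[P]_x (X u x)%:E = 0)%E.
Variables (alpha p q m : R).
Hypothesis b2 : (2 <= b)%N.
Hypothesis a0 : 0 <= alpha.
Hypothesis p1 : 1 <= p.
Hypothesis p2 : p <= 2.
Hypothesis q2 : 2 <= q.
Hypothesis aq : 1 < q - alpha * q.
Hypothesis m0 : 0 <= m.
Hypothesis EXm : forall u, D u -> (\int[P]_x (`|X u x| `^ q)%:E <= m%:E)%E.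

Definition upper_cst : R := lq_cst p q * (mz_cst q * freq_cst alpha q) `^ (p / q).

Let q0 : 0 < q. Proof. exact: lt_le_trans q2. Qed.
Let p0 : 0 < p. Proof. exact: lt_le_trans p1. Qed.
Let pq0 : 0 < p / q. Proof. exact: divr_gt0. Qed.

(* [R_(n+1)] up to the factor [E[W^2] `^ (p / 2)], see [cascade_seqE]. *)
Definition level_term n : \bar R :=
  ((((b ^ n.+1)%:R `^ (1 - (q - alpha * q))) `^ (p / q))%:E *
   \int[P]_x ((b%:R * energy X n x) `^ (p / 2))%:E)%E.

Lemma level_term_ge0 n : (0 <= level_term n)%E.
Proof.
apply: mule_ge0; first by rewrite lee_fin powR_ge0.
by apply: integral_ge0 => x _; rewrite lee_fin powR_ge0.
Qed.

Lemma integral_lq_mart_le N n :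
  (\int[P]_x (lq_pow q (freqs N) (fun i => mart X (wfcoef alpha i) n x) `^ (p / q))%:E
   <= (upper_cst * m `^ (p / q))%:E * \sum_(0 <= j < n) level_term j)%E.
Proof.
have fc := freq_cst_ge0 aq; have mz := mz_cst_gt0 q2; have lc := lq_cst_ge0 p1 q2.
have uc : 0 <= upper_cst * m `^ (p / q).
  by rewrite mulr_ge0 ?powR_ge0// mulr_ge0 ?powR_ge0.
elim: n => [|n IH].
  rewrite big_geq// mule0; under eq_integral => x _.
    rewrite (_ : lq_pow _ _ _ = 0) ?powR0 ?gt_eqF//; first over.
    by apply: big1 => i _; rewrite mart0 wfcoef_nil normr0 powR0// gt_eqF.
  by rewrite integral0.
have := mart_lq_step indX intX centX (freqs N) p1 p2 q2 m0 (wfcoef_additive b2 alpha) EXm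
  (fun i u un => norm_wfcoef_le b2 alpha i (size_words un)).
move=> /(_ n)/le_trans; apply; rewrite big_nat_recr//=.
have L0 : (0 <= \sum_(0 <= j < n) level_term j)%E.
  by apply: sume_ge0 => j _; exact: level_term_ge0.
rewrite (ge0_muleDr _ L0 (level_term_ge0 n)).
apply: leeD => //; rewrite /level_term muleA -EFinM; apply: lee_wpmul2r.
  by apply: integral_ge0 => x _; rewrite lee_fin powR_ge0.
have mf : 0 <= mz_cst q * freq_cst alpha q := mulr_ge0 (ltW mz) fc.
rewrite lee_fin /upper_cst -!mulrA ler_wpM2l//.
rewrite -(powRM _ m0) ?powR_ge0// -(powRM _ mf); last exact: mulr_ge0 (powR_ge0 _ _).
have S0 : 0 <= \sum_(i <- freqs N) (@fbound R b alpha n.+1 i) `^ q.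
  by apply: sumr_ge0 => i _; exact: powR_ge0.
have -> : mz_cst q * freq_cst alpha q * (m * (b ^ n.+1)%:R `^ (1 - (q - alpha * q))) =
   mz_cst q * (m * (freq_cst alpha q * (b ^ n.+1)%:R `^ (1 - (q - alpha * q)))) by ring.
have h z : 0 <= z -> 0 <= mz_cst q * (m * z) by move=> z0; rewrite mulr_ge0 ?(ltW mz)// mulr_ge0.
apply: ge0_ler_powR; rewrite ?(ltW pq0)// ?nnegrE; [exact: h| |].
  by apply: h; rewrite mulr_ge0 ?powR_ge0.
apply: ler_wpM2l; first exact: ltW.
apply: ler_wpM2l => //; exact: sum_fbound_le.
Qed.

Variable mu : R.-ftker T ~> R.
Hypothesis cvX : {ae P, forall x, forall e k, (0 < k)%N ->
    mart X (fcoef e k) n x @[n --> \oo] --> fhat mu e k x}.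

Lemma martZ (c : seq 'I_b -> R) (k : R) n x :
  mart X (fun u => k * c u) n x = k * mart X c n x.
Proof. by rewrite /mart mulr_sumr; apply: eq_bigr => u _; rewrite mulrCA. Qed.

(** The number [N] of frequencies stays fixed while the level tends to infinity; as the bound does
    not depend on [N], all frequencies can then be included. *)
Lemma fourier_norm_upper :
  (fourier_norm P alpha p q mu `^ p <=
   (2 `^ p * (upper_cst * m `^ (p / q)))%:E *
   \sum_(0 <= j <oo) level_term j)%E.
Proof.
have fc := freq_cst_ge0 aq; have mz := mz_cst_gt0 q2; have lc := lq_cst_ge0 p1 q2.
have uc : 0 <= upper_cst * m `^ (p / q).
  by rewrite mulr_ge0 ?powR_ge0// mulr_ge0 ?powR_ge0.
set B := (\sum_(0 <= j <oo) level_term j)%E.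
have lt0 j : (0 <= level_term j)%E by exact: level_term_ge0.
have mlq N (f : bool * nat -> T -> R) : (forall i, measurable_fun setT (f i)) ->
    measurable_fun setT (fun x => (lq_pow q (freqs N) (f^~ x) `^ (p / q))%:E).
  move=> mf; apply/measurable_EFinP; apply: measurable_fun_powR.
  by apply: measurable_sum => i; exact: measurable_norm_powR.
have mfh i : measurable_fun setT (fun x => i.2%:R `^ alpha * fhat mu i.1 i.2 x).
  by apply: measurable_funM => //; exact: measurable_fhat.
apply: fourier_norm_powR_le => // N.
apply: (@le_trans _ _ (\int[P]_x ((2 `^ p)%:E *
   (lq_pow q (freqs N) (fun i => i.2%:R `^ alpha * fhat mu i.1 i.2 x) `^ (p / q))%:E))%E).
  apply: ge0_le_integral => //.
  - by move=> x _; rewrite lee_fin powR_ge0.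
  - apply/measurable_EFinP; apply: measurable_fun_powR.
    exact: measurable_sum_amplitude.
  - by apply: emeasurable_funM => //; exact: mlq.
  - move=> x _; rewrite -EFinM lee_fin.
    have -> : 2 `^ p = (2 `^ q) `^ (p / q) :> R.
      by rewrite -powRrM mulrCA divff ?mulr1// gt_eqF.
    rewrite -powRM ?powR_ge0//; last exact: lq_pow_ge0.
    apply: ge0_ler_powR; rewrite ?(ltW pq0)// ?nnegrE.
    + by apply: sumr_ge0 => k _; exact: powR_ge0.
    + by apply: mulr_ge0; [exact: powR_ge0|exact: lq_pow_ge0].
    + exact: sum_amplitude_le.
rewrite ge0_integralZl_EFin//; last 2 first.
- by move=> x _; rewrite lee_fin powR_ge0.
- exact: mlq.
rewrite [X in (X * B)%E]EFinM -[leRHS]muleA; apply: lee_wpmul2l; first by rewrite lee_fin powR_ge0.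
apply: (@integral_limit_le _ _ _ _ (fun n x =>
  (lq_pow q (freqs N) (fun i => mart X (wfcoef alpha i) n x) `^ (p / q))%:E)).
- by move=> n; apply: mlq => i; exact: measurable_mart.
- by move=> n x; rewrite lee_fin powR_ge0.
- exact: mlq.
- by move=> x; rewrite lee_fin powR_ge0.
- apply: filterS cvX => x cvx; apply: cvg_EFin; first exact: nearW.
  apply: cvg_powR => //; first by move=> n; exact: lq_pow_ge0.
  apply: cvg_sumr => -[e k]; rewrite /freqs => /allpairsP[[e' k'] [/= _ _ [-> ->]]].
  apply: cvg_powR => //; apply: cvg_norm.
  under eq_fun do rewrite martZ.
  by apply: cvgMr; exact: cvx.
- move=> n; apply: (le_trans (integral_lq_mart_le N n)).
  by apply: lee_wpmul2l; [rewrite lee_fin|exact: nneseries_lim_ge].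
Qed.

End upper_bound.

Section cascade_sequence.
Context {R : realType} {b : nat} {d : measure_display} {T : measurableType d}.
Context {P : probability T R}.
Variable Wu : seq 'I_b -> {RV P >-> R}.
Local Notation X := (fun u => excess (Wu u)).

Lemma square_martingaleE (m2 : R) n x :
  square_martingale Wu m2 n x = (b%:R * m2) ^- n * energy X n x.
Proof.
rewrite exprMn invfM -mulrA; congr (_ * _); rewrite /energy mulr_sumr -big_tuple_words.
apply: eq_bigr => u _; rewrite /cprod size_tuple -prodrXl.
under eq_bigr do rewrite mulrC.
rewrite big_split/=; congr (_ * _).
  by rewrite big_const_nat subSS subn0 iter_mulr_1 exprVn.
by apply: eq_bigr => j _; rewrite addrC subrK.
Qed.

(** Normalizing the square martingale uses up [n] of the [n + 1] factors [m2] present in the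
    sequence; the remaining one, to the power [p / 2], stands in front. *)
Lemma cascade_seqE (m2 alpha p q : R) n : (0 < b)%N -> 0 < m2 -> 0 < q -> 0 <= p ->
  cascade_seq P Wu m2 alpha p q n.+1 = ((m2 `^ (p / 2))%:E * level_term X alpha p q n)%E.
Proof.
move=> b0 m20 q0 p0; rewrite /cascade_seq /level_term unlock /=.
have bp : 0 < b%:R :> R by rewrite ltr0n.
set c : R := (b%:R * m2) ^+ n.
have c0 : 0 < c by rewrite exprn_gt0// mulr_gt0.
have e0 x : 0 <= energy X n x by apply: sumr_ge0 => u _; exact: sqr_ge0.
have E x : (b%:R * energy X n x) `^ (p / 2) =
    (b%:R * c) `^ (p / 2) * square_martingale Wu m2 n x `^ (p / 2).
  rewrite square_martingaleE -/c -powRM ?mulr_ge0 ?invr_ge0 ?(ltW c0)//.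
  congr (_ `^ _); rewrite -mulrA mulVKf// gt_eqF//.
under [in RHS]eq_integral do rewrite E EFinM.
rewrite ge0_integralZl_EFin//; last 3 first.
- by move=> x _; rewrite lee_fin powR_ge0.
- apply/measurable_EFinP; apply: measurable_fun_powR.
  rewrite (_ : square_martingale _ _ _ = fun x => c^-1 * energy X n x); last first.
    by apply/funext => x; rewrite square_martingaleE.
  by apply: measurable_funM => //; exact: measurable_energy.
- exact: powR_ge0.
rewrite muleC [in RHS]muleA -EFinM [in RHS]muleA -EFinM; congr (_%:E * _)%E.
have -> : b%:R * c = b%:R `^ n.+1%:R * m2 `^ n%:R.
  by rewrite /c !powR_mulrn ?(ltW bp) ?(ltW m20)// exprMn mulrA -exprS.
rewrite natrX -powR_mulrn ?(ltW bp)// -powRN.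
rewrite !powRM ?powR_ge0 ?(ltW m20)// -!powRrM.
have -> (x y z t : R) : x * y * (z * t) = (x * t) * (y * z) by ring.
rewrite -!gt0_powRD//.
by congr (_ `^ _ * _ `^ _); rewrite -natr1; field; rewrite ?gt_eqF.
Qed.

End cascade_sequence.

(** * The lower bound *)

Section minkowski.
Context {R : realType} {d : measure_display} {T : measurableType d} {P : probability T R}.

(** Duality in l^s: both sides are paired with the extremal vector of the [e i] to the power
    [s - 1]. Hölder at each outcome bounds the pairing with [a], and dividing by the norm of that
    vector gives the claim. *)
Lemma integral_minkowski (I : Type) (ks : seq I) (a : I -> T -> R) (e : I -> R) (s : R) :
  1 <= s -> (forall i, measurable_fun setT (a i)) -> (forall i x, 0 <= a i x) ->
  (forall i, 0 <= e i) -> (forall i, (e i)%:E <= \int[P]_x (a i x)%:E)%E ->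
  (((\sum_(i <- ks) e i `^ s) `^ s^-1)%:E <=
   \int[P]_x ((\sum_(i <- ks) a i x `^ s) `^ s^-1)%:E)%E.
Proof.
move=> s1 ma a0 e0 ea; have s0 : 0 < s by exact: lt_le_trans s1.
have sV : 0 <= s^-1 <= 1 by rewrite invr_ge0 (ltW s0) invf_le1.
move Ee : (\sum_(i <- ks) e i `^ s) => E.
have E0 : 0 <= E by rewrite -Ee; apply: sumr_ge0 => i _; exact: powR_ge0.
have mS : measurable_fun setT (fun x => (\sum_(i <- ks) a i x `^ s) `^ s^-1).
  apply: measurable_fun_powR; apply: measurable_sum => i.
  exact: measurableT_comp (measurable_powR _) (ma i).
have I0 : (0 <= \int[P]_x ((\sum_(i <- ks) a i x `^ s) `^ s^-1)%:E)%E.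
  by apply: integral_ge0 => x _; rewrite lee_fin powR_ge0.
have [E00|En0] := eqVneq E 0.
  by rewrite E00 powR0 ?gt_eqF ?invr_gt0.
have Ep : 0 < E by rewrite lt_neqAle eq_sym En0.
have Es : 0 < E `^ (1 - s^-1) by exact: powR_gt0.
rewrite -(@lee_pmul2l _ (E `^ (1 - s^-1))%:E)// -EFinM -gt0_powRD// subrK powRr1//.
have -> : ((E `^ (1 - s^-1))%:E * \int[P]_x ((\sum_(i <- ks) a i x `^ s) `^ s^-1)%:E =
    \int[P]_x ((E `^ (1 - s^-1))%:E * ((\sum_(i <- ks) a i x `^ s) `^ s^-1)%:E))%E.
  apply: esym; apply: ge0_integralZl_EFin; [exact: measurableT| | |exact: ltW].
    by move=> x _; rewrite lee_fin powR_ge0.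
  exact/measurable_EFinP.
apply: (@le_trans _ _ (\int[P]_x (\sum_(i <- ks) e i `^ (s - 1) * a i x)%:E)%E); last first.
  apply: ge0_le_integral => //.
  - by move=> x _; rewrite lee_fin; apply: sumr_ge0 => i _; rewrite mulr_ge0 ?powR_ge0.
  - apply/measurable_EFinP; apply: measurable_sum => i; exact: measurable_funM.
  - by apply: emeasurable_funM => //; exact/measurable_EFinP.
  - move=> x _; rewrite -EFinM lee_fin.
    have := holder_sum ks sV (fun i => powR_ge0 (a i x) s) (fun i => powR_ge0 (e i) s).
    rewrite Ee [X in _ <= X -> _]mulrC => /(le_trans _); apply.
    apply: ler_sum => i _; rewrite -!powRrM divff ?gt_eqF// powRr1// mulrC.
    by rewrite mulrBr mulr1 divff// gt_eqF.
under eq_integral do rewrite -sumEFin.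
rewrite ge0_integral_sum//; last 2 first.
- by move=> i; apply/measurable_EFinP; exact: measurable_funM.
- by move=> i x _; rewrite lee_fin mulr_ge0 ?powR_ge0.
rewrite -Ee -sumEFin; apply: lee_sum => i _.
under eq_integral do rewrite EFinM.
have -> : (\int[P]_x ((e i `^ (s - 1))%:E * (a i x)%:E) =
    (e i `^ (s - 1))%:E * \int[P]_x (a i x)%:E)%E.
  apply: ge0_integralZl_EFin; [exact: measurableT| | |exact: powR_ge0].
    by move=> x _; rewrite lee_fin.
  exact/measurable_EFinP.
apply: (@le_trans _ _ (e i `^ (s - 1) * e i)%:E); last first.
  by rewrite EFinM; apply: lee_wpmul2l; rewrite ?lee_fin ?powR_ge0.
rewrite lee_fin; have [->|ei] := eqVneq (e i) 0.
  by rewrite mulr0 powR0 ?gt_eqF.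
rewrite -[X in _ <= _ * X]powRr1// -powRD ?subrK//.
by apply/implyP.
Qed.

End minkowski.

Section lower_estimate.
Context {R : realType} {d : measure_display} {T : measurableType d} {P : probability T R}.
Context {b : nat}.
Variables (X : seq 'I_b -> {RV P >-> R}) (mu : R.-ftker T ~> R).
Let D : set (seq 'I_b) := [set u | u != [::]].
Hypothesis indX : mutually_independent D X.
Hypothesis intX : forall u, D u -> P.-integrable setT (EFin \o X u).
Hypothesis centX : forall u, D u -> (\int[P]_x (X u x)%:E = 0)%E.
Hypothesis cvX : {ae P, forall x, forall e k, (0 < k)%N ->
    mart X (fcoef e k) n x @[n --> \oo] --> fhat mu e k x}.
Variables (r w m m1 m2 : R).
Hypothesis b2 : (2 <= b)%N.
Hypothesis r1 : 1 < r.
Hypothesis r2 : r <= 2.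
Hypothesis w0 : 0 <= w.
Hypothesis wb : w < b%:R `^ (r - 1).
Hypothesis EXw : forall u, D u -> (\int[P]_x (`|1 + X u x| `^ r)%:E <= w%:E)%E.
Hypothesis m0 : 0 <= m.
Hypothesis EXm : forall u, D u -> (\int[P]_x (`|X u x| `^ r)%:E <= m%:E)%E.
Hypothesis m10 : 0 <= m1.
Hypothesis EX1 : forall u, D u -> (m1%:E <= \int[P]_x `|X u x|%:E)%E.
Hypothesis m20 : 0 <= m2.
Hypothesis EX2 : forall u, D u -> (\int[P]_x (`|1 + X u x| `^ 2)%:E <= m2%:E)%E.
Variables (alpha p q : R).
Hypothesis a0 : 0 <= alpha.
Hypothesis p1 : 1 <= p.
Hypothesis p2 : p <= 2.
Hypothesis q2 : 2 <= q.

Let b0 : (0 < b)%N. Proof. exact: ltnW. Qed.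
Let bp : 0 < b%:R :> R. Proof. by rewrite ltr0n. Qed.
Let p0 : 0 < p. Proof. exact: lt_le_trans p1. Qed.

(** [2 * 2 ^ (p + 1)] comes from passing from the limit to the difference, for two parts; the power
    of [b] from frequencies starting at [b ^ n] while the term is expressed in [b ^ n.+1]; [5/18]
    from Khinchin; [2 ^ (p / 2)] from splitting the power of a sum of two squares. *)
Definition lower_cst : R := (2 * 2 `^ (p + 1))^-1 * b%:R `^ (- (alpha * p)) *
  ((5%:R / 18%:R) `^ p * (2 `^ (p / 2))^-1 * @block_cst R b `^ (p / 2)).

Let energy_ge0 n x : 0 <= energy X n x.
Proof. by apply: sumr_ge0 => u _; exact: sqr_ge0. Qed.

Let menergy n : measurable_fun setT (fun x => (b%:R * energy X n x) `^ (p / 2)).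
Proof.
apply: measurable_fun_powR; apply: measurable_funM => //.
exact: measurable_energy.
Qed.

Let S e k n x : R := \sum_(u <- words b n.+1) mart_coef X (fcoef e k) n x u ^+ 2.

Let S0 e k n x : 0 <= S e k n x.
Proof. by apply: sumr_ge0 => u _; exact: sqr_ge0. Qed.

Let mS e k n : measurable_fun setT (S e k n).
Proof.
by apply: measurable_sum => u; apply: measurable_funX; exact: measurable_mart_coef.
Qed.

Let block_coef n k x : (b ^ n <= k)%N -> (2 * k <= 3 * b ^ n)%N ->
  @block_cst R b * b%:R ^- n.+1 ^+ 2 * (b%:R * energy X n x) <= S true k n x + S false k n x.
Proof.
move=> kn kn3; rewrite /S -big_split/= /energy big_words_recr !mulr_sumr.
rewrite big_seq [leRHS]big_seq; apply: ler_sum => u un.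
apply: (@le_trans _ _ (\sum_(i < b) cprod X u x ^+ 2 * (@block_cst R b * b%:R ^- n.+1 ^+ 2))).
  by rewrite sumr_const card_ord -[X in _ <= X]mulr_natl le_eqVlt; apply/orP; left; apply/eqP; ring.
apply: ler_sum => i _; rewrite /mart_coef take_words_rcons// !exprMn -mulrDr.
rewrite ler_wpM2l ?sqr_ge0//; apply: (fcoef_block_ge b2) => //.
by rewrite size_rcons (size_words un).
Qed.

Lemma fhat_moment_ge e n k : (0 < k)%N ->
  (\int[P]_x ((5%:R / 18%:R * m1 * (S e k n x) `^ 2^-1) `^ p)%:E <=
   (2 `^ (p + 1))%:E * \int[P]_x (`|fhat mu e k x| `^ p)%:E)%E.
Proof.
move=> k0.
apply: (le_trans (integral_mart_diff_powR_ge indX intX centX (fcoef e k) n p1 m10 EX1)).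
have addc : additive_on_words (fcoef e k : seq 'I_b -> R) := fcoef_additive b2 e k.
apply: (le_trans (integral_mart_diff_powR_le indX intX centX n addc p1)).
apply: lee_wpmul2l; first by rewrite lee_fin powR_ge0.
have c_le (u : seq 'I_b) : `|fcoef e k u| <= b%:R ^- size u :> R by exact: norm_fcoef_le_pow.
apply: (integral_powR_limit_ge indX intX centX b0 addc c_le r1 r2 w0 wb EXw m0 EXm) => //.
  exact: measurable_fhat.
by apply: filterS cvX => x cvx; exact: cvx.
Qed.

Lemma amplitude_moment_ge n k : (b ^ n <= k)%N -> (2 * k <= 3 * b ^ n)%N ->
  ((lower_cst * m1 `^ p * (b ^ n.+1)%:R `^ ((alpha - 1) * p))%:E *
    \int[P]_x ((b%:R * energy X n x) `^ (p / 2))%:E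
   <= \int[P]_x (amplitude mu alpha k x `^ p)%:E)%E.
Proof.
move=> kn kn3; have bn0 : (0 < b ^ n)%N by rewrite expn_gt0 b0.
have k0 : (0 < k)%N by exact: leq_trans kn.
have kp : 0 < k%:R :> R by rewrite ltr0n.
set L := (\int[P]_x ((b%:R * energy X n x) `^ (p / 2))%:E)%E.
have L0 : (0 <= L)%E by apply: integral_ge0 => x _; rewrite lee_fin powR_ge0.
set B : R := (b ^ n.+1)%:R.
have Bp : 0 < B by rewrite ltr0n expn_gt0 b0.
have BE : B = b%:R ^+ n.+1 by rewrite /B natrX.
pose A e := (\int[P]_x ((5%:R / 18%:R * m1 * (S e k n x) `^ 2^-1) `^ p)%:E)%E.
have A0 e : (0 <= A e)%E by apply: integral_ge0 => x _; rewrite lee_fin powR_ge0.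
set I := (\int[P]_x (amplitude mu alpha k x `^ p)%:E)%E.
have HA e : (((k%:R `^ alpha) `^ p)%:E * A e <= (2 `^ (p + 1))%:E * I)%E.
  apply: (@le_trans _ _ (((k%:R `^ alpha) `^ p)%:E *
      ((2 `^ (p + 1))%:E * \int[P]_x (`|fhat mu e k x| `^ p)%:E))%E).
    by apply: lee_wpmul2l; [rewrite lee_fin powR_ge0|exact: fhat_moment_ge].
  rewrite muleCA; apply: lee_wpmul2l; first by rewrite lee_fin powR_ge0.
  have -> : (((k%:R `^ alpha) `^ p)%:E * \int[P]_x (`|fhat mu e k x| `^ p)%:E =
     \int[P]_x (((k%:R `^ alpha) `^ p)%:E * (`|fhat mu e k x| `^ p)%:E))%E.
    apply: esym; apply: ge0_integralZl_EFin; [exact: measurableT| | |exact: powR_ge0].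
      by move=> x _; rewrite lee_fin powR_ge0.
    by apply/measurable_EFinP; apply: measurable_norm_powR; exact: measurable_fhat.
  apply: ge0_le_integral => //.
  - apply: emeasurable_funM => //; apply/measurable_EFinP; apply: measurable_norm_powR.
    exact: measurable_fhat.
  - apply/measurable_EFinP; apply: measurable_fun_powR.
    exact: measurable_amplitude.
  - move=> x _; rewrite -EFinM lee_fin -powRM ?powR_ge0//.
    apply: ge0_ler_powR; rewrite ?(ltW p0)// ?nnegrE ?amplitude_ge0 ?mulr_ge0 ?powR_ge0//.
    rewrite amplitudeE; apply: ler_wpM2l; rewrite ?powR_ge0// -sqrtr_sqr ler_wsqrtr//.
    by case: e; [rewrite lerDl|rewrite lerDr]; exact: sqr_ge0.
have cm0 : 0 <= 5%:R / 18%:R * m1 :> R by rewrite mulr_ge0.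
pose cm : R := (5%:R / 18%:R * m1) `^ p * (2 `^ (p / 2))^-1 *
  (@block_cst R b * B ^- 2) `^ (p / 2).
have bc0 : 0 <= @block_cst R b :> R by exact: ltW (block_cst_gt0 b2).
have mA e : measurable_fun setT (fun x => ((5%:R / 18%:R * m1 * (S e k n x) `^ 2^-1) `^ p)%:E).
  apply/measurable_EFinP; apply: measurable_fun_powR.
  apply: measurable_funM => //.
  exact: measurableT_comp (measurable_powR _) (mS e k n).
(* The block estimate concerns the sum of the squared parts, so a lower bound is available only for
   both parts together. *)
have HL : (cm%:E * L <= A true + A false)%E.
  have -> : (A true + A false = \int[P]_x (((5%:R / 18%:R * m1 * (S true k n x) `^ 2^-1) `^ p)%:E +
      ((5%:R / 18%:R * m1 * (S false k n x) `^ 2^-1) `^ p)%:E))%E.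
    by apply: esym; apply: ge0_integralD => //; move=> x _; rewrite lee_fin powR_ge0.
  have cm_ge0 : 0 <= cm by rewrite mulr_ge0 ?powR_ge0// mulr_ge0 ?powR_ge0// invr_ge0 powR_ge0.
  have -> : (cm%:E * L = \int[P]_x (cm%:E * ((b%:R * energy X n x) `^ (p / 2))%:E))%E.
    apply: esym; apply: ge0_integralZl_EFin; [exact: measurableT| | |exact: cm_ge0].
      by move=> x _; rewrite lee_fin powR_ge0.
    exact/measurable_EFinP.
  apply: ge0_le_integral => //.
  - by move=> x _; rewrite -EFinM lee_fin mulr_ge0 ?powR_ge0.
  - by apply: emeasurable_funM => //; exact/measurable_EFinP.
  - exact: emeasurable_funD.
  - move=> x _; rewrite -EFinM -EFinD lee_fin.
    have E1 e : (5%:R / 18%:R * m1 * (S e k n x) `^ 2^-1) `^ p =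
        (5%:R / 18%:R * m1) `^ p * S e k n x `^ (p / 2).
      by rewrite (powRM _ cm0 (powR_ge0 _ _)) -powRrM [2^-1 * p]mulrC.
    have e2 : 0 <= b%:R * energy X n x by rewrite mulr_ge0.
    rewrite !E1 -mulrDr -[cm * _]mulrA -mulrA; apply: ler_wpM2l; first exact: powR_ge0.
    rewrite mulrC ler_pdivrMr ?powR_gt0// [leRHS]mulrC.
    apply: (le_trans _ (ler_powRD_max _ (S0 _ _ _ _) (S0 _ _ _ _))); last exact: ltW (divr_gt0 _ _).
    rewrite -powRM//; last by rewrite mulr_ge0// invr_ge0 exprn_ge0// ltW.
    apply: ge0_ler_powR; rewrite ?nnegrE ?addr_ge0 ?S0//.
    + exact: ltW (divr_gt0 _ _).
    + by rewrite mulr_ge0// mulr_ge0// invr_ge0 exprn_ge0// ltW.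
    + have -> : B ^- 2 = b%:R ^- n.+1 ^+ 2 by rewrite BE exprVn.
      exact: block_coef.
set K : R := (k%:R `^ alpha) `^ p in HA.
have K0 : 0 <= K by exact: powR_ge0.
have C2 : 0 < 2 * 2 `^ (p + 1) :> R by rewrite mulr_gt0// powR_gt0.
rewrite -(@lee_pmul2l _ (2 * 2 `^ (p + 1))%:E)// muleA -EFinM.
apply: (@le_trans _ _ (K%:E * (cm%:E * L))%E).
  rewrite muleA -EFinM; apply: lee_wpmul2r => //; rewrite lee_fin.
  have -> : cm = (5%:R / 18%:R) `^ p * m1 `^ p * (2 `^ (p / 2))^-1 *
      (@block_cst R b `^ (p / 2) * B `^ (- p)).
    rewrite /cm (powRM _ _ m10)// (powRM _ bc0); last by rewrite invr_ge0 exprn_ge0// ltW.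
    congr (_ * (_ * _)); rewrite -powR_mulrn ?(ltW Bp)// -powRN -powRrM.
    by congr powR; field.
  have -> : (alpha - 1) * p = alpha * p + - p by ring.
  have KB : b%:R `^ (- (alpha * p)) * B `^ (alpha * p) <= K.
    have -> : B = b%:R * (b ^ n)%:R by rewrite /B expnS natrM.
    rewrite powRM// mulrA -gt0_powRD// addNr powRr0 mul1r /K -powRrM.
    apply: ge0_ler_powR; rewrite ?nnegrE ?ler_nat//; exact: mulr_ge0 (ltW p0).
  rewrite [B `^ _]gt0_powRD// /lower_cst.
  set u := (5%:R / 18%:R) `^ p; set v := m1 `^ p; set z := (2 `^ (p / 2))^-1.
  set y := @block_cst R b `^ (p / 2); set t := B `^ (- p).
  have uvz : 0 <= u * v * z * (y * t).
    by rewrite mulr_ge0 ?mulr_ge0 ?powR_ge0// invr_ge0 powR_ge0.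
  move: (B `^ (alpha * p)) (b%:R `^ (- (alpha * p))) KB => c1 c2 KB.
  have -> : 2 * 2 `^ (p + 1) * ((2 * 2 `^ (p + 1))^-1 * c2 * (u * z * y) * v * (c1 * t)) =
      c2 * c1 * (u * v * z * (y * t)).
    by move: (2 `^ (p + 1)) C2 => g C2; field; lra.
  exact: ler_wpM2r.
apply: (@le_trans _ _ (K%:E * (A true + A false))%E).
  by apply: lee_wpmul2l; rewrite ?lee_fin.
rewrite (ge0_muleDr _ (A0 true) (A0 false)).
have -> : (2 * 2 `^ (p + 1) = 2 `^ (p + 1) + 2 `^ (p + 1))%R by ring.
rewrite EFinD ge0_muleDl ?lee_fin ?powR_ge0//.
by apply: leeD; exact: HA.
Qed.
(** The blocks are disjoint because the one starting at [b ^ n] ends before [b ^ n.+1]. *)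
Lemma sum_blocks (F : nat -> R) N : (forall k, 0 <= F k) ->
  \sum_(0 <= n < N) \sum_(b ^ n <= k < b ^ n + (b ^ n)./2.+1) F k <=
  \sum_(1 <= k < b ^ N) F k.
Proof.
move=> F0; elim: N => [|N IH]; first by rewrite !big_geq.
have bN : (0 < b ^ N)%N by rewrite expn_gt0 b0.
have le2 : (b ^ N + (b ^ N)./2.+1 <= b ^ N.+1)%N.
  apply: (@leq_trans (b ^ N + b ^ N)); last first.
    by rewrite addnn -mul2n expnS leq_mul2r b2 orbT.
  by rewrite leq_add2l ltn_half_double -addnn -[X in (X < _)%N]addn0 ltn_add2l.
rewrite big_nat_recr//= (@big_cat_nat _ _ _ (b ^ N) 1 (b ^ N.+1))//=; last first.
  by rewrite (leq_trans _ le2)// leq_addr.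
apply: lerD => //.
rewrite [leRHS](@big_cat_nat _ _ _ (b ^ N + (b ^ N)./2.+1))//= ?leq_addr//.
by rewrite lerDl; apply: sumr_ge0.
Qed.

Lemma fourier_norm_lower :
  ((((2 * b%:R)^-1 * lower_cst `^ (q / p)) `^ (p / q) * m1 `^ p)%:E *
    (\sum_(0 <= n <oo) level_term X alpha p q n `^ (q / p)) `^ (p / q)
   <= fourier_norm P alpha p q mu `^ p)%E.
Proof.
have q0 : 0 < q by exact: lt_le_trans q2.
have pq0 : 0 < p / q by exact: divr_gt0.
pose L n := (\int[P]_x ((b%:R * energy X n x) `^ (p / 2))%:E)%E.
have L0 n : (0 <= L n)%E by apply: integral_ge0 => x _; rewrite lee_fin powR_ge0.
(* Minkowski's inequality is fed with real numbers [eb], so the level terms have to be finite; this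
   follows from the second moment of the weights. *)
have Lfin n : L n \is a fin_num.
  rewrite ge0_fin_numE//.
  have := sum_cprod_moment indX n m20 EX2.
  under eq_integral do under eq_bigr do rewrite powR_mulrn// real_normK ?num_real//.
  move=> EE.
  apply: le_lt_trans (integral_powR_le (B := b%:R * (b%:R * m2) ^+ n) _ _ _ _ _) (ltry _).
  - by apply: measurable_funM => //; exact: measurable_energy.
  - by move=> x; rewrite mulr_ge0.
  - by rewrite mulr_ge0 ?exprn_ge0// mulr_ge0.
  - by rewrite divr_ge0 ?(ltW p0)// ler_pdivrMr// mul1r.
  - under eq_integral do rewrite EFinM.
    rewrite ge0_integralZl_EFin//; last 2 first.
    + by move=> x _; rewrite lee_fin.
    + by apply/measurable_EFinP; exact: measurable_energy.
    by rewrite EFinM; apply: lee_wpmul2l; rewrite ?lee_fin.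
pose eb n : R := lower_cst * m1 `^ p * (b ^ n.+1)%:R `^ ((alpha - 1) * p) * fine (L n).
have bc0 : 0 <= @block_cst R b by exact: ltW (block_cst_gt0 b2).
have lc0 : 0 <= lower_cst.
  rewrite mulr_ge0 ?mulr_ge0 ?powR_ge0 ?invr_ge0 ?mulr_ge0 ?powR_ge0//.
have eb0 n : 0 <= eb n.
  by rewrite mulr_ge0 ?fine_ge0// mulr_ge0 ?powR_ge0// mulr_ge0 ?powR_ge0.
pose s := q / p; have s0 : 0 < s by exact: divr_gt0.
have s1 : 1 <= s by rewrite ler_pdivlMr// mul1r (le_trans p2).
have sV : s^-1 = p / q by rewrite invf_div.
have ps : p * s = q by rewrite /s mulrC divfK// gt_eqF.
pose c := (2 * b%:R)^-1 * lower_cst `^ s.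
have c0 : 0 <= c by rewrite mulr_ge0 ?powR_ge0// invr_ge0 mulr_ge0.
pose lt n : R := (b ^ n.+1)%:R `^ (1 - (q - alpha * q)) * fine (L n) `^ s.
have lt0 n : 0 <= lt n by rewrite mulr_ge0 ?powR_ge0.
have ltE n : (level_term X alpha p q n `^ s = (lt n)%:E)%E.
  rewrite /level_term -/(L n) -(fineK (Lfin n)) -EFinM poweR_EFin; congr (_%:E).
  by rewrite powRM ?powR_ge0 ?fine_ge0// -powRrM -sV mulVf ?gt_eqF// powRr1// powR_ge0.
(* A block contains at least [b ^ n.+1 / (2 * b)] frequencies. This count gives the factor
   [(2 * b)^-1] and raises the exponent of [b ^ n.+1] by the 1 that appears in [level_term]. *)
have ebE n : c * m1 `^ q * lt n <= \sum_(b ^ n <= k < b ^ n + (b ^ n)./2.+1) eb n `^ s.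
  rewrite big_const_nat iter_addr_0 addnC addnK -mulr_natl.
  rewrite /eb powRM ?fine_ge0//; last by rewrite mulr_ge0 ?powR_ge0// mulr_ge0 ?powR_ge0.
  rewrite powRM ?powR_ge0//; last by rewrite mulr_ge0 ?powR_ge0.
  rewrite powRM ?powR_ge0// -[(m1 `^ p) `^ s]powRrM ps.
  rewrite /lt /c; set B : R := (b ^ n.+1)%:R.
  have Bp : 0 < B by rewrite ltr0n expn_gt0 b0.
  have -> : (B `^ ((alpha - 1) * p)) `^ s = B `^ (- (q - alpha * q)).
    by rewrite -powRrM -mulrA ps; congr powR; ring.
  rewrite gt0_powRD// powRr1 ?(ltW Bp)//.
  set x := B `^ _; set y := fine _ `^ s; set z := lower_cst `^ s; set v := m1 `^ q.
  have xyzv : 0 <= z * v * x * y by rewrite mulr_ge0 ?powR_ge0// mulr_ge0 ?powR_ge0// mulr_ge0 ?powR_ge0.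
  have hB : (2 * b%:R)^-1 * B <= ((b ^ n)./2.+1)%:R.
    rewrite /B expnS natrM invfM -mulrA mulKf ?gt_eqF// mulrC ler_pdivrMr//.
    by rewrite -natrM ler_nat muln2 ltnW// -ltn_half_double.
  have -> : (2 * b%:R)^-1 * z * v * (B * x * y) = (2 * b%:R)^-1 * B * (z * v * x * y) by ring.
  exact: ler_wpM2r.
suff HN N : (((c * m1 `^ q * \sum_(0 <= n < N) lt n) `^ (p / q))%:E
    <= fourier_norm P alpha p q mu `^ p)%E.
  have lev0 n : (0 <= level_term X alpha p q n `^ s)%E by exact: poweR_ge0.
  have cv := @cvg_nneseries_poweR R _ (p / q) 0 pq0 lev0.
  apply: (cvge_le _ (cvgeZl (_ : (c `^ (p / q) * m1 `^ p)%:E \is a fin_num) cv)) => //.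
  apply: nearW => N; apply: le_trans (HN N).
  under eq_bigr do rewrite ltE.
  rewrite sumEFin poweR_EFin -EFinM lee_fin.
  rewrite [leRHS]powRM; last 2 first.
  - by rewrite mulr_ge0 ?powR_ge0.
  - by apply: sumr_ge0.
  by rewrite (powRM _ c0 (powR_ge0 _ _)) -(powRrM m1) mulrCA divff ?mulr1// gt_eqF.
pose rng n := index_iota (b ^ n) (b ^ n + (b ^ n)./2.+1).
pose ks := [seq (n, k) | n <- index_iota 0 N, k <- rng n].
(* The value 0 off the blocks makes the moment bound valid for every pair, as required by
   [integral_minkowski]. *)
pose e (i : nat * nat) : R := if (b ^ i.1 <= i.2)%N && (2 * i.2 <= 3 * b ^ i.1)%N then eb i.1 else 0.
have ma (i : nat * nat) : measurable_fun setT (fun x => amplitude mu alpha i.2 x `^ p).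
  apply: measurable_fun_powR; exact: measurable_amplitude.
have e0 i : 0 <= e i by rewrite /e; case: ifP.
have ea i : ((e i)%:E <= \int[P]_x (amplitude mu alpha i.2 x `^ p)%:E)%E.
  rewrite /e; case: ifP => [/andP[h1 h2]|_]; last first.
    by apply: integral_ge0 => x _; rewrite lee_fin powR_ge0.
  rewrite EFinM fineK//; exact: amplitude_moment_ge.
have := integral_minkowski ks s1 ma (fun i x => powR_ge0 _ _) e0 ea.
have big_ks (F : nat * nat -> R) : \sum_(i <- ks) F i = \sum_(0 <= n < N) \sum_(k <- rng n) F (n, k).
  by rewrite /ks big_allpairs_dep.
rewrite sV => /le_trans h; apply: (@le_trans _ _ ((\sum_(i <- ks) e i `^ s) `^ (p / q))%:E).
  rewrite lee_fin; apply: ge0_ler_powR; rewrite ?(ltW pq0)// ?nnegrE.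
  - by rewrite mulr_ge0 ?sumr_ge0// mulr_ge0 ?powR_ge0.
  - by apply: sumr_ge0 => i _; exact: powR_ge0.
  rewrite big_ks mulr_sumr; apply: ler_sum => n _; apply: (le_trans (ebE n)).
  rewrite /rng big_seq [leRHS]big_seq; apply: ler_sum => k.
  rewrite mem_index_iota => /andP[h1 h2]; rewrite /e /= h1 /=.
  rewrite ifT//; have : ((b ^ n)./2.*2 <= b ^ n)%N by rewrite -geq_half_double.
  by move: h1 h2; clear; lia.
apply: h; apply: le_trans (fourier_norm_powR_ge P mu alpha q0 p0 (b ^ N)).
apply: ge0_le_integral => //.
- by move=> x _; rewrite lee_fin powR_ge0.
- apply/measurable_EFinP; apply: measurable_fun_powR.
  apply: measurable_sum => i; exact: measurableT_comp (measurable_powR _) (ma i).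
- apply/measurable_EFinP; apply: measurable_fun_powR.
  exact: measurable_sum_amplitude.
- move=> x _; rewrite lee_fin; apply: ge0_ler_powR; rewrite ?(ltW pq0)// ?nnegrE.
  + by apply: sumr_ge0 => i _; exact: powR_ge0.
  + by apply: sumr_ge0 => i _; exact: powR_ge0.
  rewrite big_ks.
  apply: le_trans (sum_blocks N (fun k => powR_ge0 (amplitude mu alpha k x) q)).
  by apply: ler_sum => n _; apply: ler_sum => k _; rewrite -powRrM ps.
Qed.

End lower_estimate.

(** * Moments of the weight and the final normalization *)

Section weight_moments.
Context {R : realType} {d : measure_display} {T : measurableType d} {P : probability T R}.
Variables (W : {RV P >-> R}) (q : R).
Hypothesis q2 : 2 <= q.
Hypothesis W0 : {ae P, forall x, 0 <= W x}.
Hypothesis EW : (\int[P]_x (W x)%:E = 1)%E.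
Hypothesis Wq : (\int[P]_x (W x `^ q)%:E < +oo)%E.

Let mW : measurable_fun setT W. Proof. exact: measurable_funP. Qed.

Lemma weight_moment_lty : (\int[P]_x (`|W x| `^ q)%:E < +oo)%E.
Proof.
have <- : (\int[P]_x (W x `^ q)%:E = \int[P]_x (`|W x| `^ q)%:E)%E; last exact: Wq.
apply: ae_eq_integral => //.
- by apply/measurable_EFinP; exact: measurableT_comp (measurable_powR _) mW.
- by apply/measurable_EFinP; exact: measurable_norm_powR.
- by apply: filterS W0 => x x0 _; rewrite ger0_norm.
Qed.

Lemma centered_weight_moment_lty (s : R) : 0 <= s -> s <= q ->
  (\int[P]_x (`|W x - 1| `^ s)%:E < +oo)%E.
Proof.
move=> s0 sq; have is_ := integrable_powR_le s0 sq weight_moment_lty.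
have i1 : P.-integrable setT (fun x => (`|W x| `^ s)%:E + 1)%E.
  by apply: integrableD => //; exact: finite_measure_integrable_cst.
apply: (@le_lt_trans _ _ (\int[P]_x ((2 `^ s)%:E * ((`|W x| `^ s)%:E + 1)))%E); last first.
  by rewrite ltey_eq (integrable_fin_num measurableT (integrableZl measurableT (2 `^ s) i1)).
apply: ge0_le_integral => //.
- by apply/measurable_EFinP; apply: measurable_norm_powR; exact: measurable_funB.
- by apply: emeasurable_funM => //; exact: (measurable_int P).
- move=> x _; rewrite -EFinD -EFinM lee_fin.
  apply: (@le_trans _ _ ((`|W x| + 1) `^ s)).
    rewrite ge0_ler_powR ?nnegrE ?addr_ge0//.
    by apply: (le_trans (ler_normB _ _)); rewrite normr1.
  by have := ler_powRD_max s0 (normr_ge0 (W x)) ler01; rewrite powR1.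
Qed.

Lemma weight_second_moment : (\int[P]_x (`|W x| `^ 2)%:E = \int[P]_x (W x ^+ 2)%:E)%E.
Proof. by apply: eq_integral => x _; rewrite powR_mulrn// real_normK// num_real. Qed.

Lemma integrable_weight : P.-integrable setT (EFin \o W).
Proof.
have q1 : 1 <= q by apply: le_trans q2; rewrite ler1n.
have := integrable_powR_le ler01 q1 weight_moment_lty.
apply: le_integrable => //; first exact/measurable_EFinP.
by move=> x _; rewrite /= powRr1// normr_id.
Qed.

(** From the tangent [1 + 2 * (W - 1)] of the square at 1, whose linear term is centered. *)
Lemma weight_second_moment_ge1 :
  (\int[P]_x (W x ^+ 2)%:E)%E \is a fin_num /\ 1 <= fine (\int[P]_x (W x ^+ 2)%:E)%E.
Proof.
have i2 := integrable_powR_le (ler0n _ 2) q2 weight_moment_lty.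
have fin : (\int[P]_x (W x ^+ 2)%:E)%E \is a fin_num.
  by rewrite -weight_second_moment; exact: integrable_fin_num.
have i1 := integrable_weight.
split => //; rewrite -lee_fin fineK//.
have ig : P.-integrable setT (fun x => 2%:E * ((W x)%:E - 1))%E.
  apply: integrableZl => //; apply: integrableB => //.
  exact: finite_measure_integrable_cst.
apply: (@integral_ge_centered _ _ _ P _ (fun x => 2 * (W x - 1))).
- exact: measurable_funX.
- by move=> x; exact: sqr_ge0.
- exact: ig.
- have -> : (\int[P]_x (2 * (W x - 1))%:E = \int[P]_x (2%:E * ((W x)%:E - 1)))%E by [].
  have i11 : P.-integrable setT (EFin \o cst 1) by exact: finite_measure_integrable_cst.
  rewrite (integralZl measurableT (integrableB measurableT i1 i11)).
  by rewrite (integralB measurableT i1 i11) EW probability_integral_cst subee// mule0.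
- by move=> x; have := sqr_ge0 (W x - 1); rewrite sqrrB; lra.
Qed.

End weight_moments.

Section ell_norm_cascade.
Context {R : realType}.

Lemma lower_cst_gt0 (b : nat) (alpha p : R) : (2 <= b)%N -> 0 < @lower_cst R b alpha p.
Proof.
move=> b2; have bp : 0 < b%:R :> R by rewrite ltr0n ltnW.
have := @block_cst_gt0 R b b2; rewrite /lower_cst; move: (@block_cst R b) => bc bc0.
have h : 0 < 5%:R / 18%:R :> R by exact: divr_gt0.
by rewrite !mulr_gt0 ?powR_gt0 ?invr_gt0 ?mulr_gt0 ?powR_gt0.
Qed.

Lemma ell_norm_scale (r k : R) (a f : nat -> \bar R) : 0 < r -> 0 <= k ->
  (forall n, (0 <= f n)%E) -> (forall n, a n.+1 = k%:E * f n)%E ->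
  ell_norm r a = (k%:E * (\sum_(0 <= n <oo) f n `^ r) `^ r^-1)%E.
Proof.
move=> r0 k0 f0 aE; rewrite /ell_norm.
have kr0 : 0 <= k `^ r by exact: powR_ge0.
rewrite -nneseries_addn; last by move=> n; exact: poweR_ge0.
have -> : (\sum_(0 <= n <oo) `|a (n + 1)%N| `^ r = \sum_(0 <= n <oo) (k `^ r)%:E * f n `^ r)%E.
  apply: eq_eseriesr => n _; rewrite addn1 aE gee0_abs; last first.
    by apply: mule_ge0 => //; rewrite lee_fin.
  by rewrite poweRM ?lee_fin// poweR_EFin.
rewrite nneseriesZl; last by move=> n _; exact: poweR_ge0.
rewrite poweRM ?lee_fin//; last by apply: nneseries_ge0 => n _ _; exact: poweR_ge0.
by rewrite poweR_EFin -powRrM divff ?powRr1// gt_eqF.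
Qed.

End ell_norm_cascade.

Theorem theorem6p1 (R : realType) (b : nat) (alpha p q : R)
    (hb : (2 <= b)%N) (halpha0 : 0 <= alpha) (halpha1 : alpha < 1)
    (hp1 : 1 < p) (hp2 : p <= 2) (hq2 : 2 <= q) (hq : (1 - alpha)^-1 < q) :
  exists c1 c2 : R, [/\ 0 < c1, 0 < c2 &
    forall (d' : measure_display) (T' : measurableType d')
      (P' : probability T' R) (W : {RV P' >-> R})
      (d : measure_display) (T : measurableType d) (P : probability T R)
      (Wu : seq 'I_b -> {RV P >-> R}) (mu : R.-ftker T ~> R),
    random_weight W ->
    ('E_P'[fun x => (W x * ln (W x))%R] < (ln b%:R)%:E)%E ->
    ('E_P'[fun x => (W x `^ q)%R] < +oo)%E ->
    iid_copies W Wu ->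
    cascade_limit Wu P mu ->
    let m2 := fine 'E_P'[fun x => (W x ^+ 2)%R]%E in
    let Rn := cascade_seq P Wu m2 alpha p q in
    (c1%:E * ('N[P']_1%:E[EFin \o centered P' W] / 'N[P']_2%:E[EFin \o W])
       * (ell_norm (q / p) Rn) `^ p^-1
     <= fourier_norm P alpha p q mu)%E /\
    (fourier_norm P alpha p q mu
     <= c2%:E * 'N[P']_q%:E[EFin \o centered P' W]
       * (ell_norm 1 Rn) `^ p^-1)%E].
Proof.
have p0 : 0 < p by exact: lt_trans hp1.
have q0 : 0 < q by exact: lt_le_trans hq2.
have b1 : 1 <= b%:R :> R by rewrite ler1n ltnW.
have aq : 1 < q - alpha * q.
  by move: hq; rewrite -[_^-1]mul1r ltr_pdivrMr ?subr_gt0// mulrBr mulr1 mulrC.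
have lc := lower_cst_gt0 alpha p hb.
have uc : 0 <= upper_cst alpha p q.
  by rewrite mulr_ge0 ?powR_ge0// lq_cst_ge0// ltW.
pose k1 := ((2 * b%:R)^-1 * @lower_cst R b alpha p `^ (q / p)) `^ (p / q).
(* The estimates concern [p]-th powers of the norm, hence the roots below. Adding 1 makes the
   constant positive when only nonnegativity of [upper_cst] is at hand. *)
pose k2 := 2 `^ p * (upper_cst alpha p q + 1).
exists (k1 `^ p^-1), (k2 `^ p^-1); split.
- by rewrite !powR_gt0// mulr_gt0 ?powR_gt0// invr_gt0 mulr_gt0// (lt_le_trans ltr01).
- by rewrite powR_gt0// mulr_gt0 ?powR_gt0// ltr_wpDl.
move=> d' T' P' W d T P Wu mu [W0 EW _] Wln Wq cW cmu m2 Rn.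
rewrite unlock in EW Wln Wq.
have Wq' := weight_moment_lty W0 Wq.
have W2 : (\int[P']_x (`|W x| `^ 2)%:E < +oo)%E.
  by rewrite ltey_eq (integrable_fin_num measurableT (integrable_powR_le (ler0n _ 2) hq2 Wq')).
have [r [w [r1 r2 w0 wb Ww]]] := subcritical_exponent b1 W0 EW W2 Wln.
have rq : r <= q by exact: le_trans hq2.
have [fm2 m2ge1] := weight_second_moment_ge1 hq2 W0 EW Wq.
have m2E : m2 = fine (\int[P']_x (W x ^+ 2)%:E)%E by rewrite /m2 unlock.
rewrite -m2E in m2ge1; have m20 : 0 < m2 by exact: lt_le_trans m2ge1.
have mW : measurable_fun setT W by exact: measurable_funP.
pose mom s := fine (\int[P']_x (`|W x - 1| `^ s)%:E)%E.
have momE s : 0 <= s -> s <= q -> (\int[P']_x (`|W x - 1| `^ s)%:E = (mom s)%:E)%E.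
  move=> s0 sq; rewrite fineK// ge0_fin_numE; first exact: (centered_weight_moment_lty W0 Wq s0 sq).
  by apply: integral_ge0 => x _; rewrite lee_fin powR_ge0.
have mom0 s : 0 <= mom s.
  by apply: fine_ge0; apply: integral_ge0 => x _; rewrite lee_fin powR_ge0.
have [W1 dW indW] := cW.
pose X u := excess (Wu u).
have indX : mutually_independent [set u | u != [::]] X by exact: mutually_independent_excess.
have EXs s u : 0 <= s -> s <= q -> u != [::] ->
    (\int[P]_x (`|X u x| `^ s)%:E = (mom s)%:E)%E.
  move=> s0 sq u0; rewrite -momE//.
  apply: (ge0_integral_copy (f := fun y => (`|y - 1| `^ s)%:E) cW u0).
    by apply/measurable_EFinP; apply: measurable_norm_powR; apply: measurable_funB.
  by move=> y; rewrite lee_fin powR_ge0.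
have EWs s u : u != [::] ->
    (\int[P]_x (`|1 + X u x| `^ s)%:E = \int[P']_x (`|W x| `^ s)%:E)%E.
  move=> u0; rewrite -(ge0_integral_copy (f := fun y => (`|y| `^ s)%:E) cW u0).
  - by apply: eq_integral => x _; rewrite addrC subrK.
  - by apply/measurable_EFinP; exact: measurable_norm_powR.
  - by move=> y; rewrite lee_fin powR_ge0.
have q1 : 1 <= q by apply: le_trans hq2; rewrite ler1n.
have iW := integrable_weight hq2 W0 Wq.
have i1 : P'.-integrable setT (EFin \o cst 1) by exact: finite_measure_integrable_cst.
have iW1 : P'.-integrable setT (EFin \o ((fun y => y - 1) \o W)).
  exact (integrableB measurableT iW i1).
have m1 : measurable_fun setT (fun y : R => y - 1) by exact: measurable_funB.
have intX u : u != [::] -> P.-integrable setT (EFin \o X u).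
  by move=> u0; have [] := integral_copy cW u0 m1 iW1.
have centX u : u != [::] -> (\int[P]_x (X u x)%:E = 0)%E.
  move=> u0; have [_ ->] := integral_copy cW u0 m1 iW1.
  by rewrite (integralB measurableT iW i1) EW probability_integral_cst subee.
have cvX := ae_cvg_mart_fhat hb W1 (ae_copies_ge0 cW W0) cmu.
have RnE n : Rn n.+1 = ((m2 `^ (p / 2))%:E * level_term X alpha p q n)%E.
  by apply: cascade_seqE => //; [exact: ltnW|exact: ltW].
have lev0 n : (0 <= level_term X alpha p q n)%E by exact: level_term_ge0.
have cE : centered P' W = fun x => W x - 1.
  by apply/funext => x; rewrite /centered unlock EW.
have N1 : 'N[P']_1%:E[EFin \o centered P' W]%E = (mom 1)%:E.
  rewrite Lnorm1 -momE ?ler01// cE; apply: eq_integral => x _.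
  by rewrite /= powRr1.
have Nq : 'N[P']_q%:E[EFin \o centered P' W]%E = (mom q `^ q^-1)%:E.
  rewrite unlock /= -poweR_EFin -(momE q (ltW q0) (lexx q)); congr (_ `^ _)%E.
  by apply: eq_integral => x _; rewrite cE.
have N2 : 'N[P']_2%:E[EFin \o W]%E = (m2 `^ 2^-1)%:E.
  rewrite unlock /= -poweR_EFin m2E fineK// -weight_second_moment; congr (_ `^ _)%E.
have F0 : (0 <= fourier_norm P alpha p q mu)%E by exact: poweR_ge0.
have FE : fourier_norm P alpha p q mu = ((fourier_norm P alpha p q mu `^ p) `^ p^-1)%E.
  by rewrite -poweRrM divff ?gt_eqF// poweRe1.
have pV : 0 <= p^-1 by rewrite invr_ge0 ltW.
have mono (x y : \bar R) : (0 <= x -> x <= y -> x `^ p^-1 <= y `^ p^-1)%E.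
  move=> x0 xy; apply: gt0_ler_poweR; rewrite ?in_itv/= ?leey ?andbT//.
  exact: le_trans xy.
have m2p : 0 <= m2 `^ (p / 2) by exact: powR_ge0.
have mp : (m2 `^ (p / 2)) `^ p^-1 = m2 `^ 2^-1.
  by rewrite -powRrM mulrAC divff ?mul1r// gt_eqF.
split.
- have EX1 u : u != [::] -> ((mom 1)%:E <= \int[P]_x `|X u x|%:E)%E.
    move=> u0; rewrite -(EXs 1 u ler01 q1 u0) le_eqVlt; apply/orP; left; apply/eqP.
    by apply: eq_integral => x _; rewrite powRr1.
  have EXr u : u != [::] -> (\int[P]_x (`|X u x| `^ r)%:E <= (mom r)%:E)%E.
    by move=> u0; rewrite EXs// (le_trans ler01)// ltW.
  have EWr u : u != [::] -> (\int[P]_x (`|1 + X u x| `^ r)%:E <= w%:E)%E.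
    by move=> u0; rewrite EWs.
  have EW2 u : u != [::] -> (\int[P]_x (`|1 + X u x| `^ 2)%:E <= m2%:E)%E.
    by move=> u0; rewrite EWs// weight_second_moment m2E fineK.
  have := fourier_norm_lower indX intX centX cvX hb r1 r2 w0 wb EWr (mom0 r) EXr (mom0 1) EX1
    (ltW m20) EW2 halpha0 (ltW hp1) hp2 hq2.
  have s0 : 0 < q / p by exact: divr_gt0.
  rewrite (ell_norm_scale s0 m2p lev0 RnE) invf_div N1 N2.
  set S := (\sum_(0 <= n <oo) _)%E.
  have S0 : (0 <= S `^ (p / q))%E by exact: poweR_ge0.
  (* The square root of [m2] that comes out of the sequence is exactly the L^2 norm of [W], so it
     cancels the denominator. *)
  rewrite poweRM ?lee_fin// poweR_EFin mp inver gt_eqF ?powR_gt0//.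
  rewrite -EFinM muleA -EFinM -!mulrA mulVf ?gt_eqF ?powR_gt0// mulr1 -/k1 => HL.
  have -> : ((k1 `^ p^-1 * mom 1)%:E * (S `^ (p / q)) `^ p^-1 =
      ((k1 * mom 1 `^ p)%:E * S `^ (p / q)) `^ p^-1)%E.
    rewrite poweRM ?lee_fin ?mulr_ge0 ?powR_ge0// poweR_EFin powRM ?powR_ge0//.
    by rewrite -powRrM divff ?powRr1// gt_eqF.
  rewrite [leRHS]FE; apply: mono => //.
  by apply: mule_ge0 => //; rewrite lee_fin mulr_ge0 ?powR_ge0.
- have EXq u : u != [::] -> (\int[P]_x (`|X u x| `^ q)%:E <= (mom q)%:E)%E.
    by move=> u0; rewrite EXs// ltW.
  have := fourier_norm_upper indX intX centX hb halpha0 (ltW hp1) hp2 hq2 aq (mom0 q) EXq cvX.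
  rewrite (ell_norm_scale ltr01 m2p lev0 RnE) invr1 Nq.
  under [X in _ -> (_ <= _ * (_ * X `^ _) `^ _)%E]eq_eseriesr do rewrite poweRe1//.
  set S := (\sum_(0 <= n <oo) _)%E => HU.
  have S0 : (0 <= S)%E by exact: nneseries_ge0.
  rewrite poweRe1//.
  have -> : ((k2 `^ p^-1)%:E * (mom q `^ q^-1)%:E * ((m2 `^ (p / 2))%:E * S) `^ p^-1 =
      ((k2 * mom q `^ (p / q))%:E * ((m2 `^ (p / 2))%:E * S)) `^ p^-1)%E.
    rewrite [RHS]poweRM; last 2 first.
    + by rewrite lee_fin mulr_ge0 ?powR_ge0// mulr_ge0 ?powR_ge0// addr_ge0.
    + by apply: mule_ge0; rewrite ?lee_fin.
    rewrite poweR_EFin powRM ?powR_ge0//; last by rewrite mulr_ge0 ?powR_ge0// addr_ge0.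
    by rewrite -EFinM -(powRrM (mom q)) mulrAC divff ?mul1r// gt_eqF.
  rewrite [leLHS]FE; apply: mono; first exact: poweR_ge0.
  apply: (le_trans HU); rewrite muleA -EFinM; apply: lee_wpmul2r => //.
  (* The power of [m2] is absent from the upper estimate; since [m2 >= 1], inserting it only
     enlarges the right-hand side. *)
  rewrite lee_fin mulrA -[leLHS]mulr1; apply: ler_pM => //.
  + by rewrite mulr_ge0 ?powR_ge0// mulr_ge0 ?powR_ge0.
  + by rewrite ler_wpM2r ?powR_ge0// ler_wpM2l ?powR_ge0// lerDl.
  + apply: (@le_trans _ _ (1 `^ (p / 2))); first by rewrite powR1.
    by apply: ge0_ler_powR; rewrite ?nnegrE ?(ltW m20)// divr_ge0// ltW.
Qed.
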